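(* Let $X=X(\sigma,\tau)$ be a square-tiled surface. Let $S(X)$ be the orbit of $X$ under the action of $SL_2(\mathbb{Z})$, and let $$S^+(X)=\{X(\omega_1,\omega_2)\mid (\omega_1,\omega_2)=\mathsf{Code}^L_X(A)\text{ for some }A\in SL_2^+(\mathbb{Z})\},$$ where square-tiled surfaces are considered up to equivalence. Then: (1) $S(X)=S^+(X)$. (2) The index of $Veech(X)$ in $SL_2(\mathbb{Z})$ is $|S^+(X)|$.
   Context: Permutations are multiplied left to right: $\alpha\beta$ means apply $\alpha$ first, then $\beta$. Square-tiled surface: for $\sigma,\tau\in S_n$, $X(\sigma,\tau)$ is obtained from $n$ unit squares $Q_1,\dots,Q_n$ (sides parallel to the axes) by gluing, via translations, the right side of $Q_i$ to the left side of $Q_{\sigma(i)}$ and the top side of $Q_i$ to the bottom side of $Q_{\tau(i)}$. $X(\sigma,\tau)$ and $X(\sigma',\tau')$ are equivalent if there is a single $\omega\in S_n$ conjugating $\sigma$ to $\sigma'$ and $\tau$ to $\tau'$. The images of corners of squares are the marked points. The map of $X$ to the unit square torus pulls back $dz$ to a holomorphic 1-form on $X$; its zeros are marked points (those of total angle $>2\pi$), and away from them $X$ has a translation structure. Action: $A\in SL_2(\mathbb{Z})$ acts on translation surfaces by replacing the translation charts $\{(U,f_U)\}$ by $\{(U,A\circ f_U)\}$; the image of a square-tiled surface is again (represented by) a square-tiled surface, and surfaces are taken up to equivalence. Rational numbers and saddle connections: a ''rational number'' $\frac pq$ means that $(q,p)$ is a coprime pair of positive integers or $(q,p)\in\{(1,0),(0,1)\}$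 (so $0=\frac01$ and $\infty=\frac10$ are allowed). For $r=\frac pq$ and $i\in\{1,\dots,n\}$, $\gamma_i$ is the straight segment on $X$ with displacement $(q,p)$ starting at the south-west corner of $Q_i$: if $r\notin\{0,\infty\}$ it begins inside $Q_i$; if $r=0$ it is the bottom side of $Q_i$; if $r=\infty$ it is the left side of $Q_i$. The complement of $\gamma_1\cup\dots\cup\gamma_n$ is a disjoint union of open Euclidean cylinders. $\gamma_i$ is a left boundary of the cylinder $C$ if $C$ lies on the left-hand side when walking along $\gamma_i$ in direction $(q,p)$. Left code: $\mathsf{Code}^L_X(r)\in S_n$ is defined by $\mathsf{Code}^L_X(r)(i)=k$ if, $C$ being the cylinder having $\gamma_i$ as a left boundary, the next left boundary of $C$ met after $\gamma_i$ when walking in direction $(q,p)$ along the boundary of $C$ is $\gamma_k$. (With these conventions $\mathsf{Code}^L_X(0)=\sigma$ and $\mathsf{Code}^L_X(\infty)=\sigma^{-1}\tau\sigma$.) Matrices: $SL_2^+(\mathbb{Z})$ is the set of matrices in $SL_2(\mathbb{Z})$ with all entries nonnegative. For $A=\begin{bmatrix} a&c\\ b&d\end{bmatrix}\in SL_2^+(\mathbb{Z})$, $\mathsf{Code}^L_X(A):=\left(\mathsf{Code}^L_X\left(\frac ba\right),\mathsf{Code}^L_X\left(\frac dc\right)\right)$. Veech group: an affine diffeomorphism of $X$ is an orientation-preserving homeomorphism $f$ of $X$ that preserves the set of zeros of the 1-form, is a diffeomorphism off that set, and there has constant derivative (in the translation structure) equal to a matrix of $SL_2(\mathbb{Z})$.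 $Veech(X)$ is the group of derivatives of affine diffeomorphisms of $X$. *)

(* Defs.v *)
From HB Require Import structures.
From Stdlib Require Import Relation_Operators.
From mathcomp Require Import all_boot all_order all_algebra all_fingroup.
From mathcomp Require Import generic_quotient.
From mathcomp Require Import all_classical all_reals all_analysis.

Set Implicit Arguments.
Unset Strict Implicit.
Unset Printing Implicit Defensive.

Import Order.TTheory GRing.Theory Num.Theory.
Import numFieldNormedType.Exports.

Local Open Scope classical_set_scope.
Local Open Scope quotient_scope.
Local Open Scope ring_scope.

(* The plane R^2 is 'cV[R]_2, so that A : 'M_2 acts by z |-> A *m z; the
   horizontal coordinate of z is z 0 0 and the vertical one is z 1 0. *)

(* Near z, the two maps g and d differ by a translation of the plane. *)
Definition translation_near (R : realType) (T : topologicalType)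
    (g d : T -> 'cV[R]_2) (z : T) : Prop :=
  \forall y \near z, g y - g z = d y - d z.

(** Translation surfaces *)

(* The data of a translation surface: a space, the zeros of its 1-form, and its
   maximal atlas of translation charts off the zeros.  A chart (U, f) is represented by a total map f, of which only
   the restriction to U is meaningful. *)
Record translation_surface (R : realType) := TranslationSurface {
  carrier :> topologicalType;
  zeros : set carrier;
  charts : set (set carrier * (carrier -> 'cV[R]_2))
}.

Definition homeomorphism (S T : topologicalType) (h : S -> T) : Prop :=
  exists g : T -> S, [/\ continuous h, continuous g, cancel h g & cancel g h].

Definition translation_iso (R : realType) (S T : translation_surface R) : Prop :=
  exists h : S -> T,
    [/\ homeomorphism h,
        h @` @zeros R S = @zeros R T &
        forall (U : set T) (f : T -> 'cV[R]_2),
          @charts R T (U, f) <-> @charts R S (h @^-1` U, f \o h)].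

Definition SL2Z : set 'M[int]_2 := [set A | \det A = 1].

Definition SL2Zplus : set 'M[int]_2 :=
  [set A | SL2Z A /\ forall i j, 0 <= A i j].

Definition SL2Z_act (R : realType) (A : 'M[int]_2) (S : translation_surface R) :
    translation_surface R :=
  @TranslationSurface R S (@zeros R S)
    [set (c.1, fun x => map_mx intr A *m c.2 x) | c in @charts R S].

(* At every point off the zeros, the expression F = g o h o f^-1 of h in
   translation charts (U, f) and (V, g) has differential A. *)
Definition constant_derivative (R : realType) (S : translation_surface R)
    (A : 'M[int]_2) (h : S -> S) : Prop :=
  forall (U V : set S) (f g : S -> 'cV[R]_2) (p : S),
    @charts R S (U, f) -> @charts R S (V, g) -> U p -> V (h p) ->
    exists F : 'cV[R]_2 -> 'cV[R]_2,
      (\forall q \near p, g (h q) = F (f q)) /\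
      is_diff (f p) F (mulmx (map_mx intr A)).

(* Having a constant derivative A with \det A = 1, such an h is automatically
   an orientation-preserving diffeomorphism off the zeros. *)
Definition affine_diffeo (R : realType) (S : translation_surface R)
    (A : 'M[int]_2) (h : S -> S) : Prop :=
  [/\ homeomorphism h, h @` @zeros R S = @zeros R S & constant_derivative A h].

Definition Veech (R : realType) (S : translation_surface R) : set 'M[int]_2 :=
  [set A | SL2Z A /\ exists h : S -> S, affine_diffeo A h].

Definition SL2Z_lcosets (H : set 'M[int]_2) : set (set 'M[int]_2) :=
  [set [set A *m B | B in H] | A in SL2Z].

(** Square-tiled surfaces *)

Definition unit_square (R : realType) : set 'cV[R]_2 :=
  [set z | forall i, 0 <= z i 0 <= 1].

Section SquareTiled.
Context (R : realType) (n : nat) (s t : 'S_n).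

Local Notation square := (set_type (@unit_square R)).

(* The disjoint union of the n squares. *)
Local Notation squares := {i : 'I_n & square}.

Definition hglue (a b : squares) : Prop :=
  let z := \val (projT2 a) in let w := \val (projT2 b) in
  [/\ projT1 b = s (projT1 a), z 0 0 = 1, w 0 0 = 0 & z 1 0 = w 1 0].

Definition vglue (a b : squares) : Prop :=
  let z := \val (projT2 a) in let w := \val (projT2 b) in
  [/\ projT1 b = t (projT1 a), z 1 0 = 1, w 1 0 = 0 & z 0 0 = w 0 0].

Definition glue_relation (a b : squares) : bool :=
  `[< clos_refl_sym_trans squares (fun x y => hglue x y \/ vglue x y) a b >].

Lemma glue_refl : reflexive glue_relation.
Proof. by move=> a; apply/asboolP; exact: rst_refl. Qed.

Lemma glue_sym : symmetric glue_relation.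
Proof. by move=> a b; apply: asbool_equiv_eq; split; exact: rst_sym. Qed.

Lemma glue_trans : transitive glue_relation.
Proof.
move=> b a c /asboolP ab /asboolP bc; apply/asboolP.
exact: rst_trans ab bc.
Qed.

Definition glue : equiv_rel squares :=
  EquivRel glue_relation glue_refl glue_sym glue_trans.

Definition tiled_space := {eq_quot glue}.

HB.instance Definition _ :=
  Topological.copy tiled_space (quotient_topology tiled_space).

Definition pt (i : 'I_n) (z : square) : tiled_space :=
  \pi_tiled_space (existT (fun=> square) i z).

(* The corner of Q_i with coordinates (b1, b2) becomes x in the surface. *)
Definition corner_at (x : tiled_space) (i : 'I_n) (b1 b2 : bool) : Prop :=
  exists2 z : square, \val z 0 0 = b1%:R /\ \val z 1 0 = b2%:R & pt i z = x.

(* Each square corner glued to a marked point contributes pi / 2 to the total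
   angle there; the value is 0 at points that are not marked. *)
Definition total_angle (x : tiled_space) : R :=
  (pi / 2) *+ #|[pred c : 'I_n * bool * bool | `[< corner_at x c.1.1 c.1.2 c.2 >]]|.

Definition tiled_zeros : set tiled_space := [set x | 2 * pi < total_angle x].

(* f is a homeomorphism from the open set U onto an open set of the plane, and
   on each square it is locally a translation, that is, df is the form dz. *)
Definition tiled_charts : set (set tiled_space * (tiled_space -> 'cV[R]_2)) :=
  [set c | let U := c.1 in let f := c.2 in
    [/\ open U /\ U `&` tiled_zeros = set0,
        {within U, continuous f},
        set_inj U f,
        forall V, open V -> V `<=` U -> open (f @` V) &
        forall (i : 'I_n) (z : square), U (pt i z) ->
          translation_near (f \o pt i) (fun w : square => \val w) z]].

Definition square_tiled : translation_surface R :=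
  @TranslationSurface R tiled_space tiled_zeros tiled_charts.

(** Saddle connections, cylinders and left codes *)

(* The segment, parametrized by [0, 1], with displacement v, starting at the
   south-west corner of Q_i and running at first in the closed square Q_i. *)
Definition saddle_connection (v : 'cV[R]_2) (i : 'I_n) (gamma : R -> tiled_space)
    : Prop :=
  [/\ {within `[0, 1], continuous gamma},
      exists2 e : R, 0 < e & forall x, 0 <= x <= e ->
        exists2 z : square, \val z = x *: v & gamma x = pt i z &
      forall x, 0 < x < 1 -> forall U f, tiled_charts (U, f) -> U (gamma x) ->
        translation_near (f \o gamma) (fun y => y *: v) x].

Definition cylinder (gamma : 'I_n -> R -> tiled_space) (C : set tiled_space)
    : Prop :=
  let D := ~` \bigcup_j (gamma j @` `[0, 1]) in
  exists2 x, D x & C = connected_component D x.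

Definition left_normal (v : 'cV[R]_2) : 'cV[R]_2 :=
  \col_i (if i == 0 then - v 1 0 else v 0 0).

(* Walking along beta on [0, L] in direction v, the set C is on the left-hand
   side all along: beta is the bottom side of a thin flat rectangle whose
   interior is immersed in C.  In particular, when beta passes through a marked
   point, the angle on its left is pi. *)
Definition on_left (C : set tiled_space) (v : 'cV[R]_2) (L : R)
    (beta : R -> tiled_space) : Prop :=
  exists2 e : R, 0 < e & exists Phi : R * R -> tiled_space,
    [/\ {within `[0, L] `*` `[0, e[, continuous Phi},
        forall x, 0 <= x <= L -> Phi (x, 0) = beta x,
        forall x y, 0 < x < L -> 0 < y < e -> C (Phi (x, y)) &
        forall x y, 0 < x < L -> 0 < y < e ->
          forall U f, tiled_charts (U, f) -> U (Phi (x, y)) ->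
          translation_near (f \o Phi)
            (fun z => z.1 *: v + z.2 *: left_normal v) (x, y)].

(* The walk beta along the boundary of C follows gamma_i and then gamma_k. *)
Definition next_left_boundary (v : 'cV[R]_2) (gamma : 'I_n -> R -> tiled_space)
    (i k : 'I_n) : Prop :=
  exists C : set tiled_space,
    [/\ cylinder gamma C,
        on_left C v 1 (gamma i),
        on_left C v 1 (gamma k) &
        exists beta : R -> tiled_space,
          [/\ on_left C v 2 beta,
              forall x, 0 <= x <= 1 -> beta x = gamma i x &
              forall x, 0 <= x <= 1 -> beta (1 + x) = gamma k x]].

(* w is the left code of the rational p / q, given as the vector v = (q, p) of
   the coprime nonnegative integers that represent it. *)
Definition is_codeL (v : 'cV[int]_2) (w : 'S_n) : Prop :=
  exists gamma : 'I_n -> R -> tiled_space,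
    (forall j, saddle_connection (map_mx intr v) j (gamma j)) /\
    (forall i, next_left_boundary (map_mx intr v) gamma i (w i)).

(* For A = [a c; b d], the codes of b / a and of d / c. *)
Definition is_codeL_mx (A : 'M[int]_2) (w : 'S_n * 'S_n) : Prop :=
  is_codeL (col 0 A) w.1 /\ is_codeL (col 1 A) w.2.

End SquareTiled.

(** Surfaces up to equivalence *)

Definition equiv_class (n : nat) (w : 'S_n * 'S_n) : set ('S_n * 'S_n) :=
  range (fun u : 'S_n => (w.1 ^ u, w.2 ^ u)%g).

Definition orbit_SL2Z (R : realType) (n : nat) (s t : 'S_n) :
    set (set ('S_n * 'S_n)) :=
  [set equiv_class w | w in [set w | exists2 A, SL2Z A &
    translation_iso (SL2Z_act A (square_tiled R s t)) (square_tiled R w.1 w.2)]].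

Definition orbit_plus (R : realType) (n : nat) (s t : 'S_n) :
    set (set ('S_n * 'S_n)) :=
  [set equiv_class w | w in [set w | exists2 A, SL2Zplus A &
    is_codeL_mx R s t A w]].

(* Main.v *)
(* An affine map between square-tiled surfaces (locally of the form z |-> A z + c in charts) is
   the common notion behind the action of SL_2(Z) and the Veech group: B X and X(w) are
   isomorphic iff there is an affine map X -> X(w) with derivative B. Such maps compose and can
   be inverted, and an affine map of derivative 1 between X(w) and X(w') makes w and w'
   simultaneously conjugate: following the half-open squares hit by the images of the centers
   works even on the tori, where marked points need not be preserved.

   For A in SL_2^+(Z), cutting X along the parallelograms spanned by the columns of A gives an
   affine map X(p) -> X of derivative A preserving the labels of south-west corners, and
   Code^L_X(A) = (p_1, p_1^-1 p_2 p_1) because codes are transported by affine maps and the code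
   of the horizontal direction of X(p) is p_1. The generators (1 1; 0 1) and (1 0; 1 1) of the
   monoid act on pairs of permutations by bijections of a finite set, so that the monoid orbit is
   already the group orbit. Finally A Veech(X) = B Veech(X) iff A X and B X are isomorphic. *)
Require Import Defs.
From Stdlib Require Import Relation_Operators.
From mathcomp Require Import all_boot all_order all_algebra all_fingroup.
From mathcomp Require Import generic_quotient.
From mathcomp Require Import all_classical all_reals all_analysis.
From mathcomp Require Import zify ring lra.

Set Implicit Arguments.
Unset Strict Implicit.
Unset Printing Implicit Defensive.

Import Order.TTheory GRing.Theory Num.Theory.
Import numFieldNormedType.Exports.

Local Open Scope classical_set_scope.
Local Open Scope quotient_scope.
Local Open Scope ring_scope.

(** Codes are given by a relation, so both existence and uniqueness of the code are needed, and
    uniqueness is the delicate half. Straight paths continue uniquely only through regular points,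
    while the walk along the boundary of a cylinder meets a corner, possibly a zero, between two
    saddle connections; the comparison therefore makes a detour inside the open cylinder. The same
    uniqueness drives rigidity. There X may be disconnected, so the offset of the squares under a
    translation isomorphism is only constant on components, and injectivity of the relabelling needs
    an argument of its own.

    Affine maps do not respect orthogonality, so before codes are transported the left normal in
    their definition is replaced by any transversal vector pointing to the left.

    The maps X(p) -> X of derivative A point towards X, so the surfaces met in S^+ are the A^-1 X;
    this is harmless since SL_2(Z) is closed under inverses. The pair (p_1, p_1^-1 p_2 p_1) is p
    conjugated by p_1, hence names the same surface as p. *)

Section Plane.
Variable R : realType.
Notation pl := 'cV[R]_2.

(** * Coordinates in the plane and the retraction onto the unit square *)

Lemma ord2P (k : 'I_2) : k = 0 \/ k = 1.
Proof. by case: k => [[|[|//]] ?]; [left|right]; apply/val_inj. Qed.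

Lemma cV2P (u v : pl) : (forall k, u k 0 = v k 0) -> u = v.
Proof. by move=> h; apply/matrixP => i j; rewrite ord1. Qed.

Definition unitv (k : 'I_2) : pl := delta_mx k 0.

Lemma unitvE k l : unitv k l 0 = (l == k)%:R.
Proof. by rewrite mxE eqxx andbT. Qed.

Lemma sub_unitvE (u : pl) k m : (u - unitv k) m 0 = u m 0 - (m == k)%:R.
Proof. by rewrite !mxE eqxx andbT. Qed.

Lemma add_unitvE (u : pl) k m : (u + unitv k) m 0 = u m 0 + (m == k)%:R.
Proof. by rewrite !mxE eqxx andbT. Qed.

Lemma nbhs_cV2P (u : pl) (N : set pl) :
  nbhs u N <-> exists2 e : R, 0 < e &
    forall w : pl, (forall k, `|w k 0 - u k 0| < e) -> N w.
Proof.
split.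
  move=> /nbhs_ballP [e /= e0 sN]; exists e => // w h; apply: sN; split => // i j.
  by rewrite ord1 /ball /= distrC; exact: h.
move=> [e e0 h]; apply/nbhs_ballP; exists e => //= w [_ bw].
by apply: h => k; have := bw k 0; rewrite /ball /= distrC.
Qed.

Lemma cvg_cV2 (T : Type) (F : set_system T) {FF : Filter F} (f : T -> pl) (u : pl) :
  (forall k, f x k 0 @[x --> F] --> u k 0) -> f @ F --> u.
Proof.
move=> h N /nbhs_cV2P [e e0 hN].
have : \forall x \near F, forall k, `|f x k 0 - u k 0| < e.
  apply: filter_forall => k.
  have /cvgrPdist_lt/(_ e e0) := h k.
  by apply: filterS => x; rewrite distrC.
by apply: filterS => x; exact: hN.
Qed.

Lemma continuous_cV2 (T : topologicalType) (f : T -> pl) (x : T) :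
  (forall k, {for x, continuous (fun y => f y k 0)}) -> {for x, continuous f}.
Proof. by move=> h; apply: (@cvg_cV2 _ (nbhs x)) => k; exact: h. Qed.

Lemma coordC (k : 'I_2) : continuous (fun u : pl => u k 0).
Proof. exact: coord_continuous. Qed.

Lemma lift01 : lift ord0 ord0 = 1 :> 'I_2.
Proof. exact/val_inj. Qed.

Lemma mulmx2E (A : 'M[R]_2) (u : pl) k :
  (A *m u) k 0 = A k 0 * u 0 0 + A k 1 * u 1 0.
Proof. by rewrite mxE !big_ord_recl big_ord0 addr0 lift01. Qed.

Lemma mulmx_continuous (A : 'M[R]_2) : continuous (fun u : pl => A *m u).
Proof.
move=> u; apply: continuous_cV2 => k.
have E : (fun x : pl => (A *m x) k 0) =
         (fun x : pl => A k 0 * x 0 0 + A k 1 * x 1 0).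
  by apply/funext => x; exact: mulmx2E.
rewrite E.
by apply: continuousD; apply: continuousM; (try exact: cst_continuous); exact: coordC.
Qed.

Definition clampR (x : R) : R := Num.min 1 (Num.max 0 x).

Lemma clampR_itv x : 0 <= clampR x <= 1.
Proof.
rewrite /clampR ge_min lexx /= andbT le_min ler01 /= le_max lexx //.
Qed.

Lemma clampR_id x : 0 <= x <= 1 -> clampR x = x.
Proof. by case/andP => x0 x1; rewrite /clampR max_r // min_r. Qed.

Lemma clampR_continuous : continuous clampR.
Proof.
move=> x; apply: (@continuous_min R R (cst 1) (fun y => Num.max 0 y)); first exact: cvg_cst.
apply: (@continuous_max R R (cst 0) id); first exact: cvg_cst.
exact: cvg_id.
Qed.

Definition clamp (u : pl) : pl := \col_k clampR (u k 0).

Lemma clampE u k : clamp u k 0 = clampR (u k 0).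
Proof. by rewrite mxE. Qed.

Lemma clamp_unit u : unit_square (clamp u).
Proof. by move=> k; rewrite clampE clampR_itv. Qed.

Lemma clamp_id u : unit_square u -> clamp u = u.
Proof. by move=> h; apply: cV2P => k; rewrite clampE clampR_id. Qed.

Lemma clamp_continuous : continuous clamp.
Proof.
move=> u; apply: continuous_cV2 => k.
have -> : (fun x => clamp x k 0) = clampR \o (fun x : pl => x k 0).
  by apply/funext => x; rewrite /= clampE.
by apply: continuous_comp; [exact: coordC|exact: clampR_continuous].
Qed.

(** Clamping makes this total, so that points of a square can be named by plane vectors without a
    membership proof. Outside the square the value is that of the clamped vector. *)
Definition sq (u : pl) : set_type (@unit_square R) :=
  exist _ (clamp u) (mem_set (clamp_unit u)).

Lemma sqK (z : set_type (@unit_square R)) : sq (\val z) = z.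
Proof. by apply: val_inj; rewrite /= clamp_id //; case: z => /= u /set_mem. Qed.

Lemma val_unit (z : set_type (@unit_square R)) : unit_square (\val z).
Proof. by case: z => /= u /set_mem. Qed.

Lemma sq_continuous : continuous sq.
Proof.
by apply: continuous_comp_initial; exact: clamp_continuous.
Qed.

Lemma nbhs_square (z : set_type (@unit_square R)) (N : set (set_type (@unit_square R))) :
  (\forall w \near z, N w) <-> (\forall u \near \val z, unit_square u -> N (sq u)).
Proof.
split=> h.
  have : \forall u \near \val z, N (sq u).
    by have /(_ N) := @sq_continuous (\val z); apply; rewrite sqK.
  by apply: filterS.
have := @initial_continuous _ _ (@set_val pl (@unit_square R)) z _ h.
apply: (@filterS _ (nbhs z)) => w /= /(_ (val_unit w)).
by rewrite sqK.
Qed.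

End Plane.

Definition dir_perm n (s t : 'S_n) (k : 'I_2) : 'S_n := if k == 0 then s else t.

(** * The glued squares *)

Section Tiled.
Variables (R : realType) (n : nat) (s t : 'S_n).
Notation pl := 'cV[R]_2.
Notation X := (tiled_space R s t).
Notation dp := (dir_perm s t).
Notation unitv := (@unitv R).

Definition plot (i : 'I_n) (u : pl) : X := pt s t i (sq u).

Lemma plot_val i z : plot i (\val z) = pt s t i z.
Proof. by rewrite /plot sqK. Qed.

Lemma plot_surj (p : X) : exists i (u : pl), unit_square u /\ plot i u = p.
Proof.
elim/quotW: p => -[i z]; exists i, (\val z); split; first exact: val_unit.
by rewrite plot_val.
Qed.

(** The two gluings in one relation indexed by the direction k, so that horizontal and vertical
    arguments are made once. *)
Definition edge_glued k (i : 'I_n) (u : pl) (j : 'I_n) (w : pl) : Prop :=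
  [/\ j = dp k i, u k 0 = 1 & w = u - unitv k].

Definition corner (u : pl) := forall k, u k 0 = 0 \/ u k 0 = 1.

Lemma edge_glued_hglue (a b : {i : 'I_n & set_type (@unit_square R)}) :
  hglue s a b <-> edge_glued 0 (projT1 a) (\val (projT2 a)) (projT1 b) (\val (projT2 b)).
Proof.
rewrite /hglue /edge_glued /dir_perm eqxx; split.
  move=> [-> h1 h0 e]; split=> //; apply: cV2P => k; rewrite !mxE.
  by case: (ord2P k) => -> /=; rewrite ?h1 ?h0 ?subrr ?subr0.
move=> [-> h1 ->]; split=> //; rewrite !mxE /= ?h1 ?subrr ?subr0 //.
Qed.

Lemma edge_glued_vglue (a b : {i : 'I_n & set_type (@unit_square R)}) :
  vglue t a b <-> edge_glued 1 (projT1 a) (\val (projT2 a)) (projT1 b) (\val (projT2 b)).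
Proof.
rewrite /vglue /edge_glued /dir_perm /=; split.
  move=> [-> h1 h0 e]; split=> //; apply: cV2P => k; rewrite !mxE.
  by case: (ord2P k) => -> /=; rewrite ?h1 ?h0 ?subrr ?subr0.
move=> [-> h1 ->]; split=> //; rewrite !mxE /= ?h1 ?subrr ?subr0 //.
Qed.

Lemma plot_glue k i (u : pl) : u k 0 = 1 -> plot i u = plot (dp k i) (u - unitv k).
Proof.
move=> uk; apply/eqmodP/asboolP/rst_step.
have h : edge_glued k i (clamp u) (dp k i) (clamp (u - unitv k)).
  split=> //; first by rewrite clampE uk clampR_id // ler01 lexx.
  apply: cV2P => l. rewrite clampE !mxE eqxx andbT.
  have [->|] := eqVneq l k; last by rewrite subr0 oppr0 addr0.
  by rewrite uk subrr !clampR_id ?subrr // lexx ler01.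
by case: (ord2P k) h => -> h; [left; apply/edge_glued_hglue|right; apply/edge_glued_vglue].
Qed.

(** Coarser than the actual gluing: all corners are related to each other. This makes the relation
    transitive without following the squares around a vertex, and it serves only as a necessary
    condition for two points to be glued. *)
Definition gluing (a b : 'I_n * pl) : Prop :=
  [\/ a = b, exists k, edge_glued k a.1 a.2 b.1 b.2, exists k, edge_glued k b.1 b.2 a.1 a.2
    | corner a.2 /\ corner b.2].

Lemma edge_glued_corner k i u j w : edge_glued k i u j w -> corner u <-> corner w.
Proof.
move=> [_ uk ->]; split=> h l; have := h l; rewrite !mxE eqxx andbT;
  have [->|] := eqVneq l k; rewrite ?uk ?subrr /= ?subr0; by [left|right|].
Qed.

Lemma corner2 k m (u : pl) : k != m -> u k 0 = 0 \/ u k 0 = 1 ->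
  u m 0 = 0 \/ u m 0 = 1 -> corner u.
Proof.
by move=> km uk um x; case: (ord2P x) (ord2P k) (ord2P m) km uk um => -> [] -> [] ->.
Qed.

Lemma edge_glued0 k i u j w : edge_glued k i u j w -> w k 0 = 0.
Proof. by move=> [_ uk ->]; rewrite !mxE !eqxx uk subrr. Qed.

Lemma edge_glued1 k i u j w : edge_glued k i u j w -> u k 0 = 1.
Proof. by case. Qed.

(** Two edge gluings in the same direction cancel, or are contradictory because the middle point
    would have a coordinate equal to both 0 and 1; in different directions they force the middle
    point to be a corner. *)
Lemma gluing_trans a b c : gluing a b -> gluing b c -> gluing a c.
Proof.
case: a b c => [i u] [j v] [l w].
case=> [-> //|[k ab]|[k ba]|[cu cv]]; case=> [<- //|[m bc]|[m cb]|[cv' cw]] /=;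
  try by [apply: Or42; exists k|apply: Or43; exists k].
- have [e|km] := eqVneq k m.
    by subst m; move: (edge_glued0 ab) (edge_glued1 bc) => /= -> /esym/eqP; rewrite oner_eq0.
  have cv : corner v by apply: (corner2 km); [left; exact: edge_glued0 ab|right;
    exact: edge_glued1 bc].
  by apply: Or44; split; [apply/(edge_glued_corner ab)|apply/(edge_glued_corner bc)].
- have [e|km] := eqVneq k m.
    subst m; case: ab cb => /= -> _ -> [] /= /perm_inj -> _ /addIr ->.
    exact: Or41.
  have cv : corner v by apply: (corner2 km); left; [exact: edge_glued0 ab|exact: edge_glued0 cb].
  by apply: Or44; split; [apply/(edge_glued_corner ab)|apply/(edge_glued_corner cb)].
- by apply: Or44; split => //=; apply/(edge_glued_corner ab).
- have [e|km] := eqVneq k m.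
    subst m; case: ba bc => /= -> _ -> [] /= -> _ ->.
    exact: Or41.
  have cv : corner v by apply: (corner2 km); right; [exact: edge_glued1 ba|exact: edge_glued1 bc].
  by apply: Or44; split; [apply/(edge_glued_corner ba)|apply/(edge_glued_corner bc)].
- have [e|km] := eqVneq k m.
    by subst m; move: (edge_glued0 cb) (edge_glued1 ba) => /= -> /esym/eqP; rewrite oner_eq0.
  have cv : corner v by apply: (corner2 km); [right; exact: edge_glued1 ba|left;
    exact: edge_glued0 cb].
  by apply: Or44; split; [apply/(edge_glued_corner ba)|apply/(edge_glued_corner cb)].
- by apply: Or44; split => //=; apply/(edge_glued_corner ba).
- exact: Or44.
- by apply: Or44; split => //=; apply/(edge_glued_corner bc).
- by apply: Or44; split => //=; apply/(edge_glued_corner cb).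
- exact: Or44.
Qed.

Lemma gluing_sym a b : gluing a b -> gluing b a.
Proof.
case=> [->|ab|ba|[ca cb]]; by [exact: Or41|exact: Or43|exact: Or42|exact: Or44].
Qed.

Lemma plot_eqP i j (u w : pl) : unit_square u -> unit_square w ->
  plot i u = plot j w -> gluing (i, u) (j, w).
Proof.
move=> uu uw /eqmodP/asboolP.
suff H a b : clos_refl_sym_trans _ (fun x y => hglue s x y \/ vglue t x y) a b ->
    gluing (projT1 a, \val (projT2 a)) (projT1 b, \val (projT2 b)).
  by move/H => /=; rewrite !clamp_id.
elim=> [x y [/edge_glued_hglue|/edge_glued_vglue] h|x|x y _|x y z _ h1 _ h2].
- by apply: Or42; exists 0.
- by apply: Or42; exists 1.
- exact: Or41.
- exact: gluing_sym.
- exact: gluing_trans h1 h2.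
Qed.

Lemma plot_continuous i : continuous (plot i).
Proof.
move=> u; apply: continuous_comp; first exact: sq_continuous.
apply: (@continuous_comp _ _ _ (existT (fun=> set_type (@unit_square R)) i)
  (\pi_(quotient_topology X) : _ -> quotient_topology X)).
  exact: existT_continuous.
exact: pi_continuous.
Qed.

Lemma open_plot (U : set X) : open U <-> forall i, open (plot i @^-1` U).
Proof.
split=> [oU i|h]; first by apply: open_comp => // u _; exact: plot_continuous.
rewrite /open /= /quotient_open; apply/sigT_openP => i.
rewrite openE => z /= hz; apply/nbhs_square.
have : \forall u \near \val z, U (plot i u).
  by apply: open_nbhs_nbhs; split; [exact: h|rewrite /= plot_val].
exact: filterS.
Qed.

Lemma tiled_continuous (T : topologicalType) (f : X -> T) :
  (forall i, continuous (f \o plot i)) -> continuous f.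
Proof.
move=> h; apply/continuousP => A oA; apply/open_plot => i.
by rewrite -comp_preimage; move/continuousP: (h i); exact.
Qed.

Lemma translation_nearP (f : X -> pl) i (u : pl) : unit_square u ->
  translation_near (f \o pt s t i) (fun w => \val w) (sq u) <->
  \forall w \near u, unit_square w -> f (plot i w) - f (plot i u) = w - u.
Proof.
move=> uu; rewrite /translation_near nbhs_square /= clamp_id //.
split; apply: filterS => w + uw => /(_ uw) /=.
  by rewrite clamp_id.
by rewrite clamp_id.
Qed.

Lemma near_coord_neq k (u : pl) c : u k 0 <> c -> \forall w \near u, (w : pl) k 0 <> c.
Proof.
move=> uc; apply/nbhs_cV2P; exists `|u k 0 - c|.
  by rewrite normr_gt0 subr_eq0; apply/eqP.
by move=> w /(_ k) h e; move: h; rewrite e distrC ltxx.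
Qed.

Lemma near_forall (u : pl) (Q : 'I_2 -> pl -> Prop) :
  (forall k, \forall w \near u, Q k w) -> \forall w \near u, forall k, Q k w.
Proof. by move=> h; exact: (@filter_forall pl _ Q (nbhs u) _ h). Qed.

(** Corners are isolated. This disposes of the coarse corner case of [gluing] in local arguments. *)
Lemma near_corner (u : pl) : \forall w \near u, corner w -> w = u.
Proof.
suff : \forall w \near u, forall k, (w : pl) k 0 = 0 \/ w k 0 = 1 -> w k 0 = u k 0.
  by apply: filterS => w h cw; apply: cV2P => k; exact/h/cw.
apply: near_forall => k.
have near_c c : \forall w \near u, (w : pl) k 0 = c -> w k 0 = u k 0.
  have [->|/eqP uc] := eqVneq (u k 0) c; first by near=> w.
  by apply: filterS (near_coord_neq uc) => w h /h.
have := near_c 0; have := near_c 1; apply: filterS2 => w h1 h0.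
by case; [exact: h0|exact: h1].
Unshelve. all: by end_near.
Qed.

Lemma plot_clamp i u : plot i (clamp u) = plot i u.
Proof.
by rewrite /plot; congr pt; apply: val_inj => /=; rewrite clamp_id //; exact: clamp_unit.
Qed.

Lemma unit_sub k (u : pl) : unit_square u -> u k 0 = 1 -> unit_square (u - unitv k).
Proof.
move=> uu uk l; rewrite !mxE eqxx andbT; have [->|_] := eqVneq l k.
  by rewrite uk subrr lexx ler01.
by rewrite subr0; exact: uu.
Qed.

Lemma unit_add k (u : pl) : unit_square u -> u k 0 = 0 -> unit_square (u + unitv k).
Proof.
move=> uu uk l; rewrite !mxE eqxx andbT; have [->|_] := eqVneq l k.
  by rewrite uk add0r lexx ler01.
by rewrite addr0; exact: uu.
Qed.

Lemma plot_glueV k i (u : pl) : u k 0 = 0 ->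
  plot i u = plot ((dp k)^-1%g i) (u + unitv k).
Proof.
by move=> uk; rewrite [RHS](@plot_glue k) ?permKV ?addrK // !mxE !eqxx uk add0r.
Qed.

Lemma near_translate k (u v : pl) c (V : pl -> Prop) :
  (u k 0 = c -> \forall w \near (u + v), V w) ->
  \forall w \near u, (w : pl) k 0 = c -> V (w + v).
Proof.
have [uk|/eqP uk _] := eqVneq (u k 0) c; last first.
  by apply: filterS (near_coord_neq uk) => w h /h.
move=> /(_ uk) h.
have : \forall w \near u, V (w + v).
  exact: (cvgD (@cvg_id _ (nbhs u)) (cvg_cst v) h).
by apply: filterS.
Qed.

(* Classes are finite and the gluing is by closed conditions, so [pi] is a closed map. *)
Lemma near_fiber (p : X) (W : 'I_n -> pl -> Prop) :
  (forall i (u : pl), unit_square u -> plot i u = p ->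
     \forall w \near u, unit_square w -> W i w) ->
  \forall x \near p, forall i (u : pl), unit_square u -> plot i u = x -> W i u.
Proof.
move=> hW.
pose V j (w : pl) := \forall w' \near w, unit_square w' -> W j w'.
pose O := [set q | forall j (w : pl), unit_square w -> plot j w = q -> V j w].
suff oO : open O.
  have : nbhs p O by apply: open_nbhs_nbhs; split=> // i u; exact: hW.
  apply: filterS => x Ox i u uu e; exact: nbhs_singleton (Ox _ _ uu e) uu.
apply/open_plot => i; rewrite openE => u /= Ou.
suff: \forall w \near clamp u, unit_square w -> O (plot i w).
  move=> /(@clamp_continuous R u) h; apply: (@filterS _ (nbhs u) _ _ _ _ h) => w /=.
  by rewrite plot_clamp; apply; exact: clamp_unit.
move: Ou; rewrite /= -plot_clamp; move: (clamp u) (clamp_unit u) => {}u uu Ou.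
have n1 : \forall w \near u, V i w by apply: near_join; exact: Ou.
have n2 : \forall w \near u, forall k, (w : pl) k 0 = 1 -> V (dp k i) (w - unitv k).
  apply: near_forall => k; apply: near_translate => uk.
  by apply/near_join/Ou; [exact: unit_sub|rewrite -plot_glue].
have n3 : \forall w \near u, forall k, (w : pl) k 0 = 0 -> V ((dp k)^-1%g i) (w + unitv k).
  apply: near_forall => k; apply: near_translate => uk.
  by apply/near_join/Ou; [exact: unit_add|rewrite -plot_glueV].
near=> w => uw j w' uw' e.
have [eij|[k /= [ij w1 we]]|[k /= [ij w1 we']]|[/= cw' cw]] := plot_eqP uw' uw e.
- by case: eij => -> ->; near: w.
- have wk : w k 0 = 0 by rewrite we !mxE !eqxx w1 subrr.
  have -> : j = (dp k)^-1%g i by rewrite ij permK.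
  have -> : w' = w + unitv k by rewrite we subrK.
  by move: k wk {ij we w1}; near: w.
- by rewrite ij we'; move: k w1 {ij we'}; near: w.
(* Two glued corners: near u the only corner is u itself, and there the hypothesis on the whole
   fiber applies. *)
have /(_ cw) E : corner w -> w = u by near: w; exact: near_corner.
by apply: Ou => //; rewrite e E.
Unshelve. all: by end_near.
Qed.

(** A neighbourhood of a glued point is assembled from its pieces in the squares, one at each
    representative. *)
Lemma nbhs_plot (p : X) (N : set X) :
  (forall i (u : pl), unit_square u -> plot i u = p ->
     \forall w \near u, unit_square w -> N (plot i w)) -> nbhs p N.
Proof.
move=> /(@near_fiber p (fun i w => N (plot i w))); apply: filterS => x.
by have [j [w [uw e]]] := plot_surj x; move=> /(_ j w uw e); rewrite e.
Qed.

End Tiled.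

(** * Separation, zeros and regular points *)

Section GluedSquares.
Variables (R : realType) (n : nat) (s t : 'S_n).
Notation pl := 'cV[R]_2.
Notation X := (tiled_space R s t).
Notation dp := (dir_perm s t).
Notation unitv := (@unitv R).
Notation plot := (@plot R n s t).

(** Each coordinate is well defined modulo 1 on the surface: this is the projection to the unit
    square torus. *)
Lemma plot_coord i j (u w : pl) k : unit_square u -> unit_square w ->
  plot i u = plot j w ->
  [\/ u k 0 = w k 0, u k 0 = 0 /\ w k 0 = 1 | u k 0 = 1 /\ w k 0 = 0].
Proof.
move=> uu uw /(plot_eqP uu uw)[[_ ->]|[l [/= _ ul ->]]|[l [/= _ wl ->]]|[/= cu cw]].
- exact: Or31.
- rewrite !mxE eqxx andbT; have [->|_] := eqVneq k l.
    by apply: Or33; rewrite ul subrr.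
  by apply: Or31; rewrite subr0.
- rewrite !mxE eqxx andbT; have [->|_] := eqVneq k l.
    by apply: Or32; rewrite wl subrr.
  by apply: Or31; rewrite subr0.
- by case: (cu k) (cw k) => -> [] ->; by [exact: Or31|exact: Or32|exact: Or33].
Qed.

Lemma seq_separated (E : seq R) :
  exists2 r : R, 0 < r & forall a b, a \in E -> b \in E -> `|a - b| < r -> a = b.
Proof.
have H x : exists2 r : R, 0 < r & forall b, b \in E -> `|x - b| < r -> x = b.
  elim: E => [|y E [r r0 hr]]; first by exists 1.
  have [<-|xy] := eqVneq x y.
    exists r => // b; rewrite inE => /orP[/eqP->//|bE]; exact: hr.
  exists (Num.min r `|x - y|); first by rewrite lt_min r0 normr_gt0 subr_eq0.
  move=> b; rewrite lt_min inE => /orP[/eqP->|bE] /andP[h1 h2]; last exact: hr.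
  by rewrite ltxx in h2.
have : forall F : seq R, exists2 r : R, 0 < r &
    forall a b, a \in F -> b \in E -> `|a - b| < r -> a = b.
  elim=> [|y F [r r0 hr]]; first by exists 1.
  have [r' r'0 hr'] := H y.
  exists (Num.min r r'); first by rewrite lt_min r0.
  move=> a b; rewrite inE lt_min => /orP[/eqP->|aF] bE /andP[h1 h2].
    exact: hr'.
  exact: hr.
by move/(_ E).
Qed.

(** The coordinates of all representatives of p and q lie in the finite set E, with gaps at least r.
    A point close to both would have a representative within r / 2 of one of p and of one of q in
    the same square, which then coincide. *)
Lemma tiled_hausdorff : hausdorff_space X.
Proof.
move=> p q cl; have [i [u [uu pE]]] := plot_surj p; have [j [v [uv qE]]] := plot_surj q.
pose E := [:: 0; 1; u 0 0; u 1 0; v 0 0; v 1 0].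
have [r r0 hr] := seq_separated E.
have inE1 l (w : pl) k : unit_square w -> plot l w = p -> w k 0 \in E.
  move=> uw wp; have := plot_coord k uw uu (etrans wp (esym pE)).
  by case=> [->|[-> _]|[-> _]]; rewrite !inE ?eqxx ?orbT //; case: (ord2P k) => ->;
    rewrite ?eqxx ?orbT.
have inE2 l (w : pl) k : unit_square w -> plot l w = q -> w k 0 \in E.
  move=> uw wp; have := plot_coord k uw uv (etrans wp (esym qE)).
  by case=> [->|[-> _]|[-> _]]; rewrite !inE ?eqxx ?orbT //; case: (ord2P k) => ->;
    rewrite ?eqxx ?orbT.
have nb x : \forall y \near x, forall l (w : pl), unit_square w -> plot l w = y ->
    exists z : pl, [/\ unit_square z, plot l z = x & forall k, `|w k 0 - z k 0| < r / 2].
  apply: near_fiber => l z uz zx; apply/nbhs_cV2P; exists (r / 2); first exact: divr_gt0.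
  by move=> w hw uw; exists z.
have [y [py qy]] := cl _ _ (nb p) (nb q).
have [l [w [uw wy]]] := plot_surj y.
have [z [uz zp hz]] := py _ _ uw wy; have [z' [uz' zq hz']] := qy _ _ uw wy.
rewrite -zp -zq; congr plot; apply: cV2P => k.
apply: hr; [exact: inE1 zp|exact: inE2 zq|].
have := ltrD (hz k) (hz' k); rewrite -splitr; apply: le_lt_trans.
have -> : z k 0 - z' k 0 = (w k 0 - z' k 0) - (w k 0 - z k 0) by ring.
by rewrite [leRHS]addrC; exact: ler_normB.
Qed.

Definition corner_pt (b : bool * bool) : pl := \col_k ((if k == 0 then b.1 else b.2)%:R).

Lemma corner_pt_unit b : unit_square (corner_pt b).
Proof. by move=> k; rewrite mxE; case: (if _ then _ else _); rewrite /= ?lexx ler01. Qed.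

Lemma corner_corner_pt u : corner u -> exists b, u = corner_pt b.
Proof.
move=> cu; have h k : exists b : bool, u k 0 = b%:R.
  by case: (cu k) => ->; [exists false|exists true].
have [b0 e0] := h 0; have [b1 e1] := h 1; exists (b0, b1).
by apply: cV2P => k; rewrite mxE; case: (ord2P k) => ->.
Qed.

Lemma corner_atP x i b1 b2 : corner_at x i b1 b2 <-> plot i (corner_pt (b1, b2)) = x.
Proof.
split=> [[z [z0 z1] <-]|<-].
  rewrite -plot_val; congr plot; apply: cV2P => k; rewrite mxE.
  by case: (ord2P k) => ->.
exists (sq (corner_pt (b1, b2))); last by [].
by rewrite /= clamp_id ?mxE //; exact: corner_pt_unit.
Qed.

(* The square having the given corner of Q_i as its south-west corner, seen through
   the horizontal gluing first. *)
Definition sw_square (c : 'I_n * bool * bool) : 'I_n :=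
  let i := if c.1.2 then s c.1.1 else c.1.1 in if c.2 then t i else i.

Definition sw_square' (c : 'I_n * bool * bool) : 'I_n :=
  let i := if c.2 then t c.1.1 else c.1.1 in if c.1.2 then s i else i.

Lemma plot_sw_square c : plot c.1.1 (corner_pt (c.1.2, c.2)) = plot (sw_square c) 0.
Proof.
case: c => [[i b1] b2] /=; rewrite /sw_square /=.
transitivity (plot (if b1 then s i else i) (corner_pt (false, b2))).
  case: b1 => //; rewrite (@plot_glue _ _ _ _ 0) ?mxE //; congr plot.
  by apply: cV2P => k; rewrite !mxE; case: (ord2P k) => -> /=; rewrite ?subrr ?subr0.
case: b2 => /=; last by congr plot; apply: cV2P => k; rewrite !mxE; case: ifP.
rewrite (@plot_glue _ _ _ _ 1) ?mxE //; congr plot.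
by apply: cV2P => k; rewrite !mxE; case: (ord2P k) => -> /=; rewrite ?subrr ?subr0.
Qed.

Lemma plot_sw_square' c : plot c.1.1 (corner_pt (c.1.2, c.2)) = plot (sw_square' c) 0.
Proof.
case: c => [[i b1] b2] /=; rewrite /sw_square' /=.
transitivity (plot (if b2 then t i else i) (corner_pt (b1, false))).
  case: b2 => //; rewrite (@plot_glue _ _ _ _ 1) ?mxE //; congr plot.
  by apply: cV2P => k; rewrite !mxE; case: (ord2P k) => -> /=; rewrite ?subrr ?subr0.
case: b1 => /=; last by congr plot; apply: cV2P => k; rewrite !mxE; case: ifP.
rewrite (@plot_glue _ _ _ _ 0) ?mxE //; congr plot.
by apply: cV2P => k; rewrite !mxE; case: (ord2P k) => -> /=; rewrite ?subrr ?subr0.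
Qed.

(** Sending a corner to its south-west square while keeping its type is a bijection of the set of
    square corners. So each square with south-west corner at x accounts for four corners there, that
    is, for an angle 2 pi. *)
Lemma tiled_zerosP (x : X) :
  tiled_zeros x <-> exists i j, [/\ i != j, plot i 0 = x & plot j 0 = x].
Proof.
pose S := [set i | plot i 0 == x]%SET.
have cE : #|[pred c : 'I_n * bool * bool | `[< corner_at x c.1.1 c.1.2 c.2 >]]|
    = (#|S| * 4)%N.
  pose phi c := (sw_square c, c.1.2, c.2).
  have phi_inj : injective phi.
    move=> [[i b1] b2] [[i' b1'] b2']; rewrite /phi /sw_square /= => -[+ e1 e2].
    by rewrite -e1 -e2; case: b1 {e1}; case: b2 {e2}; do ?move/perm_inj; move=> ->.
  pose A := finset.setX (finset.setX S [set: bool]%SET) [set: bool]%SET.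
  transitivity #|phi @^-1: A|%SET.
    apply: eq_card => -[[i b1] b2]; rewrite !inE /= !andbT.
    rewrite -(plot_sw_square (i, b1, b2)).
    by apply/asboolP/eqP; rewrite corner_atP.
  rewrite on_card_preimset; last exact: onW_bij (injF_bij phi_inj).
  by rewrite !cardsX !cardsT card_bool -mulnA.
have -> : tiled_zeros x <-> (1 < #|S|)%N.
  rewrite /tiled_zeros /total_angle /= cE.
  have -> : (pi / 2) *+ (#|S| * 4) = 2 * pi * #|S|%:R :> R.
    by rewrite -mulr_natr natrM; field.
  by rewrite ltr_pMr ?ltr1n // mulr_gt0 // pi_gt0.
split.
  by move=> /card_gt1P [i [j [+ + ij]]]; rewrite !inE => /eqP iS /eqP jS; exists i, j.
move=> [i [j [ij /eqP iS /eqP jS]]]; apply/card_gt1P; exists i, j.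
by rewrite !inE.
Qed.

Lemma regular_sw_square (p : X) i j : ~ tiled_zeros p -> plot i 0 = p -> plot j 0 = p -> i = j.
Proof.
move=> pr pi pj; apply/eqP/negP => /negP ij.
by apply: pr; apply/tiled_zerosP; exists i, j.
Qed.

(* Two representatives of a regular point, one on each side of an edge, are glued
   along that edge: this is what fails when the total angle is larger. *)
Lemma regular_fiber (p : X) i j (u w : pl) : ~ tiled_zeros p ->
  unit_square u -> unit_square w -> plot i u = p -> plot j w = p ->
  [\/ (i, u) = (j, w), exists k, edge_glued s t k i u j w, exists k, edge_glued s t k j w i u |
      forall k, u k 0 <> w k 0].
Proof.
move=> pr uu uw up wp; case: (plot_eqP uu uw (etrans up (esym wp))) => [e|e|e|[/= cu cw]].
- exact: Or41.
- exact: Or42.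
- exact: Or43.
move: up wp; have [b ub] := corner_corner_pt cu; have [c wc] := corner_corner_pt cw.
subst u w; case: b c {cu cw uu uw} => [b0 b1] [c0 c1] up wp.
have /= e1 := plot_sw_square (i, b0, b1); have /= e1' := plot_sw_square' (i, b0, b1).
have /= e2 := plot_sw_square (j, c0, c1); have /= e2' := plot_sw_square' (j, c0, c1).
(* At a regular point the south-west square is the same for both representatives, in whichever order
   the edges are crossed. Cancelling the common outer permutation leaves an equality of squares or a
   single edge gluing. *)
have E : sw_square (i, b0, b1) = sw_square (j, c0, c1).
  by apply: (regular_sw_square pr); rewrite -?e1 -?e2.
have E' : sw_square' (i, b0, b1) = sw_square' (j, c0, c1).
  by apply: (regular_sw_square pr); rewrite -?e1' -?e2'.
rewrite /sw_square /sw_square' /= in E E'.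
have [b0c0|b0c0] := eqVneq b0 c0; have [b1c1|b1c1] := eqVneq b1 c1.
- subst c0 c1; apply: Or41; congr (_, _).
  by case: b0 b1 E {E' e1 e1' e2 e2' up wp} => [] []; do ?move/perm_inj.
- subst c0; have {}E' : (if b1 then t i else i) = (if c1 then t j else j).
    by case: b0 E' {E e1 e1' e2 e2' up wp} => // /perm_inj.
  case: b1 c1 b1c1 E' {E e1 e1' e2 e2' up wp} => [] [] //= _ e; [apply: Or42|apply: Or43];
    exists 1; (split; [by rewrite /dir_perm|by rewrite mxE|]);
    by apply: cV2P => k; rewrite !mxE; case: (ord2P k) => -> /=; rewrite ?subrr ?subr0.
- subst c1; have {}E : (if b0 then s i else i) = (if c0 then s j else j).
    by case: b1 E {E' e1 e1' e2 e2' up wp} => // /perm_inj.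
  case: b0 c0 b0c0 E {E' e1 e1' e2 e2' up wp} => [] [] //= _ e; [apply: Or42|apply: Or43];
    exists 0; (split; [by rewrite /dir_perm|by rewrite mxE|]);
    by apply: cV2P => k; rewrite !mxE; case: (ord2P k) => -> /=; rewrite ?subrr ?subr0.
- apply: Or44 => k; rewrite !mxE.
  have bN (b b' : bool) : b != b' -> (b%:R : R) <> b'%:R.
    by case: b; case: b' => //= _ /eqP; rewrite ?oner_eq0 // eq_sym oner_eq0.
  by case: (ord2P k) => -> /=; exact: bN.
Qed.

(** A representative stuck at an edge is replaced by the one across that edge, which leaves the
    other coordinate alone. Thus every point has a representative with room to move into any
    prescribed quadrant. *)
Lemma plot_room i (u : pl) (sg : 'I_2 -> bool) : unit_square u ->
  exists j w, [/\ unit_square w, plot j w = plot i u &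
    forall k, if sg k then w k 0 < 1 else 0 < w k 0].
Proof.
move=> uu.
have step k j (w : pl) : unit_square w -> exists j' w',
    [/\ unit_square w', plot j' w' = plot j w,
       (if sg k then w' k 0 < 1 else 0 < w' k 0) & forall l, l != k -> w' l 0 = w l 0].
  move=> uw; case sk: (sg k).
    have [wk|wk] := eqVneq (w k 0) 1.
      exists (dp k j), (w - unitv k); split; [exact: unit_sub|by rewrite -plot_glue| |].
        by rewrite !mxE !eqxx wk subrr ltr01.
      by move=> l lk; rewrite !mxE (negbTE lk) subr0.
    by exists j, w; split=> //; rewrite lt_neqAle wk; case/andP: (uw k).
  have [wk|wk] := eqVneq (w k 0) 0.
    exists ((dp k)^-1%g j), (w + unitv k); split; [exact: unit_add|by rewrite -plot_glueV| |].
      by rewrite !mxE !eqxx wk add0r ltr01.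
    by move=> l lk; rewrite !mxE (negbTE lk) addr0.
  by exists j, w; split=> //; rewrite lt_neqAle eq_sym wk; case/andP: (uw k).
have [j [w [uw e r0 _]]] := step 0 i u uu.
have [j' [w' [uw' e' r1 h]]] := step 1 j w uw.
exists j', w'; split=> //; first by rewrite e'.
by move=> k; case: (ord2P k) => -> //; rewrite h.
Qed.

End GluedSquares.

(** * Charts *)

Section NearPlane.
Variable R : realType.
Notation pl := 'cV[R]_2.

Lemma near_shift (a b : pl) (Q : pl -> Prop) :
  (\forall w \near b, Q w) -> \forall v \near a, Q (b + (v - a)).
Proof.
move=> /nbhs_cV2P [e e0 h]; apply/nbhs_cV2P; exists e => // v hv; apply: h => k.
by rewrite !mxE [_ + (_ - _)]addrC addrK; exact: hv.
Qed.

Lemma near_coord_dist (u : pl) e : 0 < e ->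
  \forall w \near u, forall k, `|(w : pl) k 0 - u k 0| < e.
Proof. by move=> e0; apply/nbhs_cV2P; exists e. Qed.

Lemma near_coord_lt (u : pl) k c : u k 0 < c -> \forall w \near u, (w : pl) k 0 < c.
Proof.
move=> uc; have := @near_coord_dist u (c - u k 0); rewrite subr_gt0 => /(_ uc).
by apply: filterS => w /(_ k); rewrite ltr_norml => /andP[_]; rewrite ltrD2r.
Qed.

Lemma near_coord_gt (u : pl) k c : c < u k 0 -> \forall w \near u, c < (w : pl) k 0.
Proof.
move=> uc; have := @near_coord_dist u (u k 0 - c); rewrite subr_gt0 => /(_ uc).
by apply: filterS => w /(_ k); rewrite ltr_norml opprB => /andP[+ _]; rewrite ltrD2r.
Qed.

End NearPlane.

Section Charts.
Variables (R : realType) (n : nat) (s t : 'S_n).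
Notation pl := 'cV[R]_2.
Notation X := (tiled_space R s t).
Notation plot := (@plot R n s t).
Implicit Types (U : set X) (f : X -> pl).

Definition plot_translation f i (u : pl) :=
  \forall w \near u, unit_square w -> f (plot i w) - f (plot i u) = w - u.

(** The plane around f q is the union of four quadrants, indexed by [sg]. For each of them, a
    representative of q with room in that direction supplies preimages of the nearby points of the
    quadrant. *)
Lemma plot_translation_open U f : open U ->
  (forall i (u : pl), unit_square u -> U (plot i u) -> plot_translation f i u) ->
  forall V, open V -> V `<=` U -> open (f @` V).
Proof.
move=> oU tr V oV VU; rewrite openE => _ [q Vq <-].
have H (sg : {ffun 'I_2 -> bool}) : \forall v \near f q,
    (forall k, (f q k 0 <= (v : pl) k 0) = sg k) -> (f @` V) v.
  have [i0 [u0 [uu0 e0]]] := plot_surj q.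
  have [j [w [uw e room]]] := plot_room s t i0 sg uu0.
  have {e0}e : plot j w = q by rewrite e.
  have n1 : \forall w' \near w, V (plot j w').
    by apply: (@plot_continuous _ _ s t j w); rewrite e; exact: open_nbhs_nbhs.
  have n2 : plot_translation f j w by apply: tr => //; rewrite e; exact: VU.
  have n3 : \forall w' \near w, forall k,
      if sg k then (w' : pl) k 0 < 1 else 0 < w' k 0.
    apply: near_forall => k; have := room k.
    by case: (sg k); [exact: near_coord_lt|exact: near_coord_gt].
  have : \forall w' \near w, [/\ V (plot j w'),
     unit_square w' -> f (plot j w') - f (plot j w) = w' - w &
     forall k, if sg k then (w' : pl) k 0 < 1 else 0 < w' k 0].
    by near=> w'; split; [near: w'|near: w'|near: w'].
  move=> /(@near_shift _ (f q)); apply: filterS => v [h1 h2 h3] hsg.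
  exists (plot j (w + (v - f q))) => //.
  suff uv : unit_square (w + (v - f q)).
    have := h2 uv; rewrite e => E; rewrite -[LHS](subrK (f q)) E.
    by rewrite [w + _]addrC addrK subrK.
  move=> k; have := h3 k; have := hsg k; rewrite !mxE.
  have /andP[w0 w1] := uw k.
  case: (sg k) => [h h'|/negbT]; first by rewrite (ltW h') andbT addr_ge0 // subr_ge0.
  by rewrite -ltNge => h h'; rewrite (ltW h') /= -lerBrDl; apply: le_trans (ltW (_ : _ < 0)) _;
    rewrite ?subr_lt0 ?subr_ge0.
have : \forall v \near f q, forall sg : {ffun 'I_2 -> bool},
    (forall k, (f q k 0 <= (v : pl) k 0) = sg k) -> (f @` V) v.
  exact: (@filter_forall _ _ (fun (sg : {ffun 'I_2 -> bool}) v =>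
    (forall k, (f q k 0 <= (v : pl) k 0) = sg k) -> (f @` V) v) (nbhs (f q)) _ H).
apply: filterS => v /(_ [ffun k => f q k 0 <= v k 0]); apply => k.
by rewrite ffunE.
Unshelve. all: by end_near.
Qed.

Lemma plot_translation_continuous f q :
  (forall i (u : pl), unit_square u -> plot i u = q -> plot_translation f i u) ->
  {for q, continuous f}.
Proof.
move=> tr N /nbhs_cV2P [e e0 hN]; apply: nbhs_plot => i u uu uq.
have := tr _ _ uu uq; have := near_coord_dist u e0; apply: filterS2 => w hw h uw.
apply: hN => k; have := hw k; have := congr1 (fun v : pl => v k 0) (h uw).
by rewrite !mxE -uq => ->.
Qed.

(** Continuity and openness follow from the translation condition on squares, so that charts can be
    built and used without them. *)
Lemma tiled_chartP U f : tiled_charts (U, f) <->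
  [/\ open U, forall q, U q -> ~ tiled_zeros q, set_inj U f &
     forall i (u : pl), unit_square u -> U (plot i u) -> plot_translation f i u].
Proof.
split=> [[[/= oU Uz] _ injf _ tr]|[oU Uz injf tr]].
  split=> //.
    by move=> q Uq zq; suff : set0 q by []; rewrite -Uz.
  move=> i u uu Uu; apply/translation_nearP => //; apply: tr.
  by move: Uu; rewrite -plot_val /= clamp_id.
split=> //=.
- split=> //; rewrite -subset0 => q [Uq]; exact: Uz.
- apply/continuous_in_subspaceT => q /set_mem Uq.
  apply: plot_translation_continuous => i u uu uq; apply: tr => //.
  by rewrite uq.
- exact: plot_translation_open.
- move=> i z; rewrite -plot_val -[in translation_near _ _ z](sqK z) => Uz'.
  by apply/translation_nearP; [exact: val_unit|apply: tr => //; exact: val_unit].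
Qed.

Lemma plot_diff (i j : 'I_n) (u w : pl) k : unit_square u -> unit_square w ->
  plot i u = plot j w -> [\/ u k 0 - w k 0 = 0, u k 0 - w k 0 = 1 | u k 0 - w k 0 = -1].
Proof.
move=> uu uw /(plot_coord k uu uw) [->|[-> ->]|[-> ->]].
- by apply: Or31; rewrite subrr.
- by apply: Or33; rewrite sub0r.
- by apply: Or32; rewrite subr0.
Qed.

(** The chart at p sends a representative w to w - z, where z represents p in the same square. The
    radius 1/2 makes this well defined: two candidate values differ by integers of absolute value
    less than 1. The corner condition keeps other marked points out of U. *)
Lemma chart_exists (p : X) : ~ tiled_zeros p ->
  exists U f, tiled_charts (U, f) /\ U p.
Proof.
move=> pr.
pose V j (w z : pl) := [/\ unit_square z, plot j z = p,
  forall k, `|w k 0 - z k 0| < 2^-1 & corner w -> w = z].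
pose U := [set q | forall j (w : pl), unit_square w -> plot j w = q -> exists z, V j w z].
pose D (q : X) := [set d : pl | exists j w z,
  [/\ unit_square w, plot j w = q, V j w z & d = w - z]].
pose f q := xget 0 (D q).
have D1 q d d' : D q d -> D q d' -> d = d'.
  move=> [j [w [z [uw wq [uz zp hz _] ->]]]] [j' [w' [z' [uw' wq' [uz' zp' hz' _] ->]]]].
  apply: cV2P => k; rewrite !mxE.
  have := plot_diff k uw uw' (etrans wq (esym wq')).
  have := plot_diff k uz uz' (etrans zp (esym zp')).
  move: (hz k) (hz' k); rewrite !ltr_norml => /andP[a1 a2] /andP[a3 a4].
  by case=> e1; case=> e2; lra.
have fE j w z : unit_square w -> V j w z -> f (plot j w) = w - z.
  move=> uw Vw; apply: (D1 (plot j w)); last by exists j, w, z.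
  by apply: (@xgetPex _ 0 (D (plot j w))); exists (w - z), j, w, z.
have Vnear j w z : V j w z -> \forall w' \near w, V j w' z.
  move=> [uz zp hz cz].
  have n1 : \forall w' \near w, forall k, `|(w' : pl) k 0 - z k 0| < 2^-1.
    apply: near_forall => k; have := hz k; rewrite ltr_norml => /andP[h1 h2].
    have := @near_coord_gt _ w k (z k 0 - 2^-1); have := @near_coord_lt _ w k (z k 0 + 2^-1).
    have -> : w k 0 < z k 0 + 2^-1 by lra.
    have -> : z k 0 - 2^-1 < w k 0 by lra.
    move=> /(_ isT) + /(_ isT); apply: filterS2 => v b1 b2.
    by rewrite ltr_norml; lra.
  have n2 := near_corner w.
  near=> v; split=> // [|cv]; first by near: v.
  have vw : v = w by move: cv; near: v.
  by rewrite vw; apply: cz; rewrite -vw.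
have oU : open U.
  rewrite openE => q Uq; apply: near_fiber => i u uu uq.
  have [z] := Uq _ _ uu uq; move=> /Vnear; apply: filterS => w h _; by exists z.
have Up : U p.
  move=> j w uw wp; exists w; split=> // k; rewrite subrr normr0; lra.
exists U, f; split=> //; apply/tiled_chartP; split=> //.
(* A zero is represented by a south-west corner, which in U can only represent p, and p is
   regular. *)
- move=> q Uq qz; have /tiled_zerosP [i [j [ij iq jq]]] := qz.
  have u0 : unit_square (0 : pl) by move=> k; rewrite mxE lexx ler01.
  have [z [_ zp _ cz]] := Uq _ _ u0 iq.
  apply: pr; rewrite -zp -cz; first by rewrite iq.
  by move=> k; left; rewrite mxE.
- move=> q q' /set_mem Uq /set_mem Uq'.
  have [j [w [uw wq]]] := plot_surj q; have [j' [w' [uw' wq']]] := plot_surj q'.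
  subst q q'; have [z Vz] := Uq _ _ uw erefl; have [z' Vz'] := Uq' _ _ uw' erefl.
  rewrite (fE _ _ _ uw Vz) (fE _ _ _ uw' Vz') => E.
  case: Vz Vz' => uz zp _ _ [uz' zp' _ _].
  have Ek k : w k 0 - z k 0 = w' k 0 - z' k 0.
    by have := congr1 (fun v : pl => v k 0) E; rewrite !mxE.
  case: (regular_fiber pr uz uz' zp zp') => [[<- zz]|[k [jk zk zE]]|[k [jk zk zE]]|zN].
  + by congr plot; apply: cV2P => k; have := Ek k; rewrite zz => /addIr.
  + have wE : w' = w - unitv R k.
      apply: cV2P => l; have := Ek l; rewrite zE !mxE => h; lra.
    rewrite jk wE -plot_glue //; have := uw' k; have := uw k.
    rewrite wE !mxE !eqxx /= => /andP[_ h1] /andP[h2 _]. lra.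
  + have wE : w = w' - unitv R k.
      apply: cV2P => l; have := Ek l; rewrite zE !mxE => h; lra.
    rewrite jk wE -plot_glue //; have := uw' k; have := uw k.
    by rewrite wE !mxE !eqxx /= => /andP[h1 _] /andP[_ h2]; lra.
  (* Here z and z' sit on opposite sides in both coordinates, so that equal offsets from them,
     inside the unit square, must vanish. *)
  + have h k : w k 0 = z k 0 /\ w' k 0 = z' k 0.
      have := plot_diff k uz uz' (etrans zp (esym zp')).
      move: (Ek k) (zN k) (uw k) (uw' k) (uz k) (uz' k).
      move=> e0 e1 /andP[? ?] /andP[? ?] /andP[? ?] /andP[? ?] [e|e|e].
      * by case: e1; lra.
      * by split; lra.
      * by split; lra.
    have -> : w = z by apply: cV2P => k; have [] := h k.
    have -> : w' = z' by apply: cV2P => k; have [] := h k.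
    by rewrite zp zp'.
- move=> i u uu Uu; have [z Vz] := Uu _ _ uu erefl.
  have := Vnear _ _ _ Vz; apply: filterS => w Vw uw.
  by rewrite (fE _ _ _ uw Vw) (fE _ _ _ uu Vz) opprB addrA subrK.
Unshelve. all: by end_near.
Qed.

End Charts.

(** * Affine maps *)

Section Affine.
Variables (R : realType) (n : nat).
Notation pl := 'cV[R]_2.
Implicit Types (s t : 'S_n) (A B : 'M[R]_2).

Lemma homeomorphism_bij (S T : topologicalType) (h : S -> T) :
  homeomorphism h -> bijective h.
Proof. by move=> [g [_ _ hK gK]]; exists g. Qed.

Definition locally_affine s t s' t' A (h : tiled_space R s t -> tiled_space R s' t') :=
  forall U f V g p, tiled_charts (U, f) -> tiled_charts (V, g) -> U p -> V (h p) ->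
  \forall q \near p, g (h q) - g (h p) = A *m (f q - f p).

Definition affine s t s' t' A (h : tiled_space R s t -> tiled_space R s' t') :=
  [/\ homeomorphism h, forall x, tiled_zeros (h x) <-> tiled_zeros x &
      locally_affine A h].

Lemma affine_continuous s t s' t' A (h : tiled_space R s t -> tiled_space R s' t') :
  affine A h -> continuous h.
Proof. by move=> [[g []]]. Qed.

Lemma chart_regular s t U f (p : tiled_space R s t) :
  tiled_charts (U, f) -> U p -> ~ tiled_zeros p.
Proof. by move=> /tiled_chartP [_ h _ _]; exact: h. Qed.

Lemma chart_near s t U f (p : tiled_space R s t) :
  tiled_charts (U, f) -> U p -> \forall q \near p, U q.
Proof. by move=> /tiled_chartP [oU _ _ _] Up; exact: open_nbhs_nbhs. Qed.

Lemma affine_comp s0 t0 s1 t1 s2 t2 A B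
    (h : tiled_space R s1 t1 -> tiled_space R s2 t2)
    (k : tiled_space R s0 t0 -> tiled_space R s1 t1) :
  affine A h -> affine B k -> affine (A *m B) (h \o k).
Proof.
move=> [[h' [hC h'C hK h'K]] hz hl] [[k' [kC k'C kK k'K]] kz kl]; split.
- exists (k' \o h'); split.
  + by move=> x; apply: continuous_comp; [exact: kC|exact: hC].
  + by move=> x; apply: continuous_comp; [exact: h'C|exact: k'C].
  + exact: can_comp.
  + exact: can_comp.
- by move=> x /=; rewrite hz kz.
move=> U f W e p cU cW Up Wp.
have /chart_exists [V [g [cV Vp]]] : ~ tiled_zeros (k p).
  by rewrite kz; exact: chart_regular cU Up.
have h1 := kl _ _ _ _ _ cU cV Up Vp.
have /(kC p) h2 := hl _ _ _ _ _ cV cW Vp Wp.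
near=> q; rewrite -mulmxA /=.
have <- : g (k q) - g (k p) = B *m (f q - f p) by near: q.
by near: q.
Unshelve. all: by end_near.
Qed.

Lemma affine_inv s t s' t' A (h : tiled_space R s t -> tiled_space R s' t') g :
  A \in unitmx -> affine A h -> cancel h g -> cancel g h -> affine (invmx A) g.
Proof.
move=> uA [[h' [hC h'C hK h'K]] hz hl] hg gh.
have h'g : h' = g by apply/funext => y; rewrite -[in LHS](gh y) hK.
subst h'; split.
- by exists h.
- by move=> x; rewrite -hz gh.
move=> U f V e p cU cV Up Vp.
have := hl V e U f (g p) cV cU Vp; rewrite gh => /(_ Up) /(h'C p).
apply: (@filterS _ (nbhs p)) => q /=; rewrite !gh => ->.
by rewrite mulKmx.
Qed.

Lemma affine_inverse s t s' t' A (h : tiled_space R s t -> tiled_space R s' t') :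
  A \in unitmx -> affine A h -> exists g, [/\ affine (invmx A) g, cancel h g & cancel g h].
Proof.
move=> uA ah; have [[g [_ _ hg gh]] _ _] := ah.
by exists g; split => //; exact: affine_inv ah hg gh.
Qed.

Lemma affine_id s t : affine 1%:M (@id (tiled_space R s t)).
Proof.
split=> //; first by exists id; split=> // x; exact: cvg_id.
move=> U f V g p cU cV Up Vp.
have [_ _ _ tU] := (tiled_chartP _ _).1 cU; have [_ _ _ tV] := (tiled_chartP _ _).1 cV.
apply: (@nbhs_plot _ _ _ _ p) => i u uu e; subst p.
have := tU _ _ uu Up; have := tV _ _ uu Vp; apply: filterS2 => w h1 h2 uw.
by rewrite mul1mx h1 ?h2.
Qed.

Lemma affine_plot s t s' t' A (h : tiled_space R s t -> tiled_space R s' t') i (u : pl) V g :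
  affine A h -> unit_square u -> tiled_charts (V, g) -> V (h (plot s t i u)) ->
  \forall w \near u, unit_square w ->
    g (h (plot s t i w)) - g (h (plot s t i u)) = A *m (w - u).
Proof.
move=> [_ hz hl] uu cV Vu.
have /chart_exists [U [f [cU Uu]]] : ~ tiled_zeros (plot s t i u).
  by rewrite -hz; exact: chart_regular cV Vu.
have /(@plot_continuous _ _ s t i u) h1 := hl _ _ _ _ _ cU cV Uu Vu.
have [_ _ _ tU] := (tiled_chartP _ _).1 cU.
have := tU _ _ uu Uu; apply: (@filterS2 _ (nbhs u) _ _ _ _ _ h1) => w /= {}h1 h2 uw.
by rewrite h1 h2.
Qed.

(** Charts of the source are translations on squares, so the derivative may be tested in square
    coordinates. *)
Lemma plot_affine s t s' t' A (h : tiled_space R s t -> tiled_space R s' t') :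
  (forall V g i (u : pl), unit_square u -> tiled_charts (V, g) -> V (h (plot s t i u)) ->
    \forall w \near u, unit_square w ->
    g (h (plot s t i w)) - g (h (plot s t i u)) = A *m (w - u)) -> locally_affine A h.
Proof.
move=> H U f V g p cU cV Up Vp; apply: (@nbhs_plot _ _ _ _ p) => i u uu e; subst p.
have [_ _ _ tU] := (tiled_chartP _ _).1 cU.
have := tU _ _ uu Up; have := H _ _ _ _ uu cV Vp; apply: filterS2 => w h1 h2 uw.
by rewrite h1 ?h2.
Qed.

Lemma affine_chart s t s' t' A (h : tiled_space R s t -> tiled_space R s' t') V g :
  A \in unitmx -> affine A h -> tiled_charts (V, g) ->
  tiled_charts (h @^-1` V, fun x => invmx A *m g (h x)).
Proof.
move=> uA ah cV; have [oV Vz injV tV] := (tiled_chartP _ _).1 cV.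
have [hh hz hl] := ah.
apply/tiled_chartP; split.
- by apply: open_comp => // x _; exact: (affine_continuous ah).
- by move=> q /= Vq; rewrite -hz; exact: Vz.
- move=> x y /set_mem Vx /set_mem Vy /(congr1 (mulmx A)).
  rewrite !mulKVmx // => e; have /bij_inj := homeomorphism_bij hh; apply.
  by apply: injV => //; exact: mem_set.
- move=> i u uu Vu; apply: filterS (affine_plot ah uu cV Vu) => w h1 uw.
  by rewrite -mulmxBr h1 // mulKmx.
Qed.

Definition intmx (A : 'M[int]_2) : 'M[R]_2 := map_mx intr A.

Lemma SL2Z_unitmx (A : 'M[int]_2) : SL2Z A -> intmx A \in unitmx.
Proof. by move=> dA; rewrite unitmxE det_map_mx dA rmorph1 unitr1. Qed.

Lemma image_zeros s t s' t' (h : tiled_space R s t -> tiled_space R s' t') :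
  homeomorphism h -> (h @` tiled_zeros (t := t) = tiled_zeros (t := t') <->
    forall x, tiled_zeros (h x) <-> tiled_zeros x).
Proof.
move=> [g [_ _ hg gh]]; split=> [E x|E].
  by rewrite -E; split=> [[y zy /(can_inj hg) <-]|zx] //; exists x.
rewrite eqEsubset; split=> [_ [x zx <-]|y zy]; first by rewrite E.
by exists (g y); rewrite ?gh // -E gh.
Qed.

Lemma translation_isoP s t s' t' (A : 'M[int]_2) : SL2Z A ->
  (translation_iso (SL2Z_act A (square_tiled R s t)) (square_tiled R s' t') <->
   exists h : tiled_space R s t -> tiled_space R s' t', affine (intmx A) h).
Proof.
move=> SA; have uA := SL2Z_unitmx SA; split=> [[h [hh hz hc]]|[h ah]].
  exists h; split=> //; first exact/image_zeros.
  apply: plot_affine => V g i u uu cV Vu.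
  have [[U f] /= cU [UE fE]] := (hc V g).1 cV.
  have [_ _ _ tU] := (tiled_chartP _ _).1 cU.
  have : U (plot s t i u) by rewrite UE.
  move=> /(tU _ _ uu); apply: filterS => w h1 uw.
  have gE x : g (h x) = intmx A *m f x by have := congr1 (@^~ x) fE => /= <-.
  by rewrite !gE -mulmxBr h1.
have [hh hz hl] := ah; exists h; split=> //; first exact/image_zeros.
move=> U f; split=> [cU|[[V g] /= cV [VE gE]]].
  exists (h @^-1` U, fun x => invmx (intmx A) *m f (h x)).
    exact: affine_chart.
  by congr (_, _); apply/funext => x; rewrite /= mulKVmx.
have [k [ak hk kh]] := affine_inverse uA ah.
have := @affine_chart _ _ _ _ _ k V g _ ak cV; rewrite unitmx_inv => /(_ uA).
rewrite invmxK; congr (tiled_charts (_, _)).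
  by rewrite VE; apply/funext => y; rewrite /= kh.
by apply/funext => y; have := congr1 (@^~ (k y)) gE; rewrite /= kh.
Qed.

End Affine.

(** * Constant derivatives and the mean value theorem *)

Section DiffPlane.
Variable R : realType.
Notation pl := 'cV[R]_2.

Lemma cvg_is_derive (f : R -> R) (x d : R) :
  h^-1 *: (f (h *: 1 + x) - f x) @[h --> 0^'] --> d -> is_derive x 1 f d.
Proof.
move=> h; apply: DeriveDef; first by apply: cvgP h.
exact: cvg_lim h.
Qed.

Lemma constant_slope (f : R -> R) (d a b : R) : a <= b ->
  (forall x : R, a < x < b -> is_derive x 1 f d) -> {within `[a, b], continuous f} ->
  f b - f a = d * (b - a).
Proof.
rewrite le_eqVlt => /orP[/eqP -> _ _|ab df cf]; first by rewrite !subrr mulr0.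
have df' (x : R) : x \in `]a, b[ -> is_derive x 1 f d by rewrite in_itv /= => /df.
by have [c _ ->] := MVT ab df' cf.
Qed.

Lemma segment_continuous (a v : pl) : continuous (fun x : R => a + x *: v).
Proof.
move=> x; apply: cvgD; first exact: cvg_cst.
by apply: cvgZ; [exact: cvg_id|exact: cvg_cst].
Qed.

Lemma near_itv (x a b : R) : a < x < b -> \forall y \near x, a <= y <= b.
Proof.
move=> h; have : x \in `]a, b[ by rewrite in_itv.
move=> /near_in_itvoo; apply: filterS => y; rewrite in_itv /= => /andP[a0 b0].
by rewrite !ltW.
Qed.

Lemma is_diff_affine (A : 'M[R]_2) (a c : pl) :
  is_diff a (fun z : pl => A *m (z - a) + c) (mulmx A).
Proof.
have dA : is_diff a (mulmx A : pl -> pl) (mulmx A).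
  apply: DiffDef; first by apply: linear_differentiable; exact: mulmx_continuous.
  by apply: diff_lin; exact: mulmx_continuous.
have -> : (fun z : pl => A *m (z - a) + c) = mulmx A + cst (c - A *m a).
  by apply/funext => z; rewrite mulmxBr -addrA [- _ + _]addrC.
have := is_diffD dA (is_diff_cst (c - A *m a) a).
by rewrite addr0.
Qed.

Lemma is_diff_coord (A : 'M[R]_2) (F : pl -> pl) (a v : pl) k (f : R -> R) x :
  is_diff a F (mulmx A) ->
  (\forall y \near x, f y = F (a + (y - x) *: v) k 0) -> is_derive x 1 f ((A *m v) k 0).
Proof.
move=> dF fE; apply: cvg_is_derive.
have dv : derivable F a v by apply: diff_derivable.
have E : 'D_v F a = A *m v by rewrite deriveE //; rewrite (diff_val (is_diff_def := dF)).
have fx := nbhs_singleton fE.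
have : (h^-1 *: (F (h *: v + a) - F a)) k 0 @[h --> (0:R)^'] --> (A *m v) k 0.
  have := cvg_comp _ _ dv (@coord_continuous _ _ _ k 0 ('D_v F a)).
  by rewrite E.
apply: cvg_trans; apply: near_eq_cvg.
have n0 : \forall h \near (0:R), f (h + x) = F (a + h *: v) k 0.
  have : (fun h : R => h + x) @ (0:R) --> x.
    by rewrite -[in X in _ --> X](add0r x); apply: cvgD; [exact: cvg_id|exact: cvg_cst].
  move=> /(_ _ fE) h1; apply: (@filterS _ (nbhs (0:R)) _ _ _ _ h1) => h /=.
  by rewrite addrK.
have := @nbhs_dnbhs _ (0:R) _ n0; apply: filterS => h hE.
rewrite [h *: 1]mulr1 hE fx subrr scale0r addr0 !mxE [a + _]addrC.
by [].
Qed.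

End DiffPlane.

Section AffineDiffeo.
Variables (R : realType) (n : nat) (s t : 'S_n).
Notation pl := 'cV[R]_2.
Notation X := (tiled_space R s t).

(** Squares are convex: on a short segment from u to w in a square, each coordinate of the chart
    expression of h has constant derivative, and the mean value theorem applies. Charts at the
    intermediate points exist because h preserves zeros. *)
Lemma constant_derivativeP (A : 'M[int]_2) (h : X -> X) : continuous h ->
  (forall x, tiled_zeros (h x) <-> tiled_zeros x) ->
  constant_derivative (S := square_tiled R s t) A h <-> locally_affine (intmx R A) h.
Proof.
move=> hC hz; split=> [cd|la]; last first.
  move=> U V f g p cU cV Up Vp.
  exists (fun z => intmx R A *m (z - f p) + g (h p)); split; last exact: is_diff_affine.
  by apply: filterS (la _ _ _ _ _ cU cV Up Vp) => q <-; rewrite subrK.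
apply: plot_affine => V g i u uu cV Vu.
have [oV _ _ tV] := (tiled_chartP _ _).1 cV.
pose phi w := g (h (plot s t i w)).
have Vphi (w : pl) : V (h (plot s t i w)) -> {for w, continuous phi}.
  move=> Vw; apply: (@continuous_comp _ _ _ (plot s t i) (g \o h)); first exact: plot_continuous.
  apply: continuous_comp; first exact: hC.
  by apply: plot_translation_continuous => j v uv e; apply: tV => //; rewrite e.
have /nbhs_cV2P [e e0 hV] : \forall w \near u, V (h (plot s t i w)).
  have n1 := open_nbhs_nbhs (conj oV Vu).
  exact: (@plot_continuous _ _ s t i u _ (hC _ _ n1)).
apply/nbhs_cV2P; exists e => // w hw uw.
pose c x : pl := u + x *: (w - u).
have cC : continuous c by exact: segment_continuous.
have c01 x k : 0 <= x <= 1 -> `|c x k 0 - u k 0| < e /\ 0 <= c x k 0 <= 1.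
  move=> /andP[x0 x1]; rewrite /c !mxE; split.
    rewrite addrAC subrr add0r normrM ger0_norm //.
    by apply: le_lt_trans (hw k); apply: ler_piMl.
  have /andP[? ?] := uu k; have /andP[? ?] := uw k; apply/andP; split; nra.
have Vc x : 0 <= x <= 1 -> V (h (plot s t i (c x))).
  by move=> hx; apply: hV => k; have [] := c01 x k hx.
have uc x : 0 <= x <= 1 -> unit_square (c x).
  by move=> hx k; have [] := c01 x k hx.
apply: cV2P => k.
have := @constant_slope R (fun x => phi (c x) k 0) ((intmx R A *m (w - u)) k 0) 0 1 ler01.
rewrite subr0 mulr1 /c scale0r scale1r addr0 subrKC /phi => H.
rewrite ![in LHS]mxE; apply: H.
- move=> x /andP[x0 x1]; have x01 : 0 <= x <= 1 by rewrite !ltW.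
  have [U [f [cU Up]]] : exists U f, tiled_charts (U, f) /\ U (plot s t i (c x)).
    by apply: chart_exists; rewrite -hz; apply: (chart_regular cV); exact: Vc.
  have [F [hF dF]] := cd U V f g _ cU cV Up (Vc _ x01).
  apply: (is_diff_coord dF).
  have [_ _ _ tU] := (tiled_chartP _ _).1 cU.
  have h1 := cC x _ (@plot_continuous _ _ s t i (c x) _ hF).
  have h2 := cC x _ (tU _ _ (uc x x01) Up).
  have h3 : \forall y \near x, 0 <= y <= 1 by apply: near_itv; rewrite x0.
  near=> y.
  rewrite -/(c y) [g _](_ : _ = F (f (plot s t i (c y)))); last by near: y.
  congr (F _ k 0).
  have : f (plot s t i (c y)) - f (plot s t i (c x)) = c y - c x.
    have : unit_square (c y) by apply: uc; near: y.
    by near: y.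
  move=> /eqP; rewrite subr_eq addrC => /eqP ->; congr (_ + _).
  by rewrite /c opprD addrACA subrr add0r -scalerBl.
- apply/continuous_in_subspaceT => x; rewrite inE /= in_itv /= => hx.
  apply: (@continuous_comp _ _ _ c (fun v => phi v k 0)); first exact: cC.
  apply: (@continuous_comp _ _ _ phi (fun v : pl => v k 0)); first exact: Vphi (Vc x hx).
  exact: coord_continuous.
Unshelve. all: by end_near.
Qed.

Lemma VeechP (A : 'M[int]_2) : Veech (square_tiled R s t) A <->
  SL2Z A /\ exists h : X -> X, affine (intmx R A) h.
Proof.
split=> -[SA [h]].
  move=> [hh hz cd]; split=> //; exists h.
  have hz' := (image_zeros hh).1 hz; split=> //.
  by apply/constant_derivativeP => //; case: hh => ? [].
move=> [hh hz la]; split=> //; exists h; split=> //; first exact/image_zeros.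
by apply/constant_derivativeP => //; case: hh => ? [].
Qed.

End AffineDiffeo.

(** * Straight paths *)

Section Paths.
Variables (R : realType) (n : nat) (s t : 'S_n).
Notation pl := 'cV[R]_2.
Notation X := (tiled_space R s t).

Lemma within_nearP (S T : topologicalType) (D : set S) (c : S -> T) :
  {within D, continuous c} <->
  forall x N, D x -> nbhs (c x) N -> \forall y \near x, D y -> N (c y).
Proof.
split=> [/subspace_continuousP h x N Dx nN|h]; first exact: (h x Dx N nN).
by apply/subspace_continuousP => x Dx N nN; exact: h.
Qed.

(** Vacuous when c x is a zero, since no chart contains it. *)
Definition straight (T : topologicalType) (d : T -> pl) (c : T -> X) (x : T) :=
  forall U f, tiled_charts (U, f) -> U (c x) -> translation_near (f \o c) d x.

Lemma straight_slope U f (c : R -> X) (v : pl) (a b : R) : tiled_charts (U, f) -> a <= b ->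
  {within `[a, b], continuous c} -> (forall x : R, a <= x <= b -> U (c x)) ->
  (forall x : R, a < x < b -> straight (fun y : R => y *: v) c x) ->
  f (c b) - f (c a) = (b - a) *: v.
Proof.
move=> cU ab /within_nearP cc Uc sc.
have [_ _ _ tU] := (tiled_chartP _ _).1 cU.
have fC q : U q -> {for q, continuous f}.
  move=> Uq; apply: plot_translation_continuous => i u uu e.
  by apply: tU => //; rewrite e.
apply: cV2P => k; rewrite !mxE mulrC.
apply: (@constant_slope R (fun x => f (c x) k 0)) => //.
  move=> x hx; have x01 : a <= x <= b by case/andP: hx => ? ?; rewrite !ltW.
  have dF := @is_diff_affine R 1%:M (f (c x)) (f (c x)).
  rewrite -[v](mul1mx v); apply: (is_diff_coord dF).
  apply: filterS (sc x hx U f cU (Uc x x01)) => y /= h.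
  by rewrite mul1mx [f (c x) + _]addrC addrK scalerBl -h subrK.
apply/within_nearP => x N xab nN.
have xab' : a <= x <= b by move: xab; rewrite /= in_itv.
apply: (cc x [set q | N (f q k 0)] xab); 
exact: (fC _ (Uc x xab') _ (@coord_continuous _ _ _ k 0 (f (c x)) _ nN)).
Qed.

(** Inside one chart both paths have the same displacement from the common point, and the chart is
    injective. *)
Lemma path_local (c d : R -> X) (v : pl) (a b x0 : R) :
  {within `[a, b], continuous c} -> {within `[a, b], continuous d} ->
  (forall x : R, a < x < b -> straight (fun y : R => y *: v) c x) ->
  (forall x : R, a < x < b -> straight (fun y : R => y *: v) d x) ->
  a <= x0 < b -> c x0 = d x0 -> ~ tiled_zeros (c x0) ->
  exists2 e, 0 < e & forall y, x0 <= y <= b -> y < x0 + e -> c y = d y.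
Proof.
move=> cC dC cs ds /andP[ax0 x0b] e0 /chart_exists [U [f [cU Ux0]]].
have [_ _ injU _] := (tiled_chartP _ _).1 cU.
have x0ab : `[a, b]%classic x0 by rewrite /= in_itv /= ax0 ltW.
have nc := (within_nearP _ _).1 cC x0 U x0ab (chart_near cU Ux0).
have nd : \forall y \near x0, `[a, b]%classic y -> U (d y).
  by apply: (within_nearP _ _).1 => //; rewrite -e0; exact: chart_near cU Ux0.
have /nbhs_ballP [e /= e_gt0 he] : \forall y \near x0,
    `[a, b]%classic y -> U (c y) /\ U (d y).
  by apply: filterS2 nc nd => y h1 h2 yab; split; [exact: h1|exact: h2].
exists e => // y /andP[x0y yb] ye.
have hU z : x0 <= z <= y -> U (c z) /\ U (d z).
  move=> /andP[z1 z2]; apply: he.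
    rewrite /ball /= ler0_norm; last by rewrite subr_le0.
    by rewrite opprB ltrBlDl; exact: le_lt_trans ye.
  by rewrite /= in_itv /=; apply/andP; split; [exact: le_trans z1|exact: le_trans yb].
have sub : `[x0, y]%classic `<=` `[a, b]%classic.
  move=> z /=; rewrite !in_itv /= => /andP[z1 z2].
  by rewrite (le_trans ax0 z1) (le_trans z2 yb).
have sub' z : x0 < z < y -> a < z < b.
  by move=> /andP[z1 z2]; rewrite (le_lt_trans ax0 z1) (lt_le_trans z2 yb).
have E1 := straight_slope cU x0y (continuous_subspaceW sub cC)
   (fun z hz => (hU z hz).1) (fun z hz => cs z (sub' z hz)).
have E2 := straight_slope cU x0y (continuous_subspaceW sub dC)
   (fun z hz => (hU z hz).2) (fun z hz => ds z (sub' z hz)).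
have [Uc Ud] : U (c y) /\ U (d y) by apply: hU; rewrite x0y lexx.
apply: injU; rewrite ?inE //; apply: (addIr (- f (c x0))).
by rewrite E1 e0 E2.
Qed.

(* A regular point has a chart, so that straight paths that agree at a regular point
   agree a little further; they agree on a closed set since the surface is Hausdorff. *)
Lemma path_unique (c d : R -> X) (v : pl) (a b : R) :
  {within `[a, b], continuous c} -> {within `[a, b], continuous d} ->
  (forall x : R, a < x < b -> straight (fun y : R => y *: v) c x) ->
  (forall x : R, a < x < b -> straight (fun y : R => y *: v) d x) ->
  (forall x : R, a <= x < b -> ~ tiled_zeros (c x)) ->
  c a = d a -> forall x : R, a <= x <= b -> c x = d x.
Proof.
move=> cC dC cs ds cr ca x1 /andP[ax1 x1b].
pose E := [set x | a <= x <= b /\ forall y, a <= y <= x -> c y = d y].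
have ab := le_trans ax1 x1b.
have Ea : E a.
  split; first by rewrite lexx.
  by move=> y ay; have -> : y = a by apply/eqP; rewrite eq_le andbC.
have ubE : ubound E b by move=> x [/andP[]].
have supE : has_sup E by split; [exists a|exists b].
pose S := sup E.
have aS : a <= S by exact: (sup_upper_bound supE).
have Sb : S <= b by apply: ge_sup => //; exists a.
have ltS y : a <= y -> y < S -> c y = d y.
  move=> ay yS; have Sy : 0 < S - y by rewrite subr_gt0.
  have [x [_ h]] := sup_adherent Sy supE.
  by rewrite subKr => yx; apply: h; rewrite ay ltW.
have cS : c S = d S.
  move: aS; rewrite le_eqVlt => /orP[/eqP <-//|aS].
  apply: tiled_hausdorff => N M nN nM.
  have Sab : `[a, b]%classic S by rewrite /= in_itv /= (ltW aS).
  have h1 := (within_nearP _ _).1 cC S N Sab nN.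
  have h2 := (within_nearP _ _).1 dC S M Sab nM.
  have /nbhs_ballP [e /= e0 he] : \forall y \near S,
      (`[a, b]%classic y -> N (c y)) /\ (`[a, b]%classic y -> M (d y)).
    by apply: filterS2 h1 h2 => y.
  pose y := Num.max a (S - e / 2).
  have yS : y < S by rewrite gt_max aS ltrBlDr ltrDl divr_gt0.
  have ay : a <= y by rewrite le_max lexx.
  have yab : `[a, b]%classic y by rewrite /= in_itv /= ay (le_trans (ltW yS)).
  have [|h1' h2'] := he y.
    rewrite /ball /= ger0_norm ?subr_ge0 ?ltW // ltrBlDr -ltrBlDl lt_max.
    by apply/orP; right; rewrite ltrD2l ltrN2 ltr_pdivrMr // ltr_pMr // ltr1n.
  exists (c y); split; first exact: h1'.
  by rewrite ltS //; exact: h2'.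
suff : b <= S.
  move=> bS; move: x1b; rewrite le_eqVlt => /orP[/eqP x1b|x1b].
    by have -> : x1 = S by apply/eqP; rewrite eq_le x1b bS.
  by apply: ltS => //; exact: lt_le_trans bS.
rewrite leNgt; apply/negP => Slb.
have aSb : a <= S < b by rewrite aS.
have [e e0 he] := path_local cC dC cs ds aSb cS (cr S aSb).
pose y := Num.min b (S + e / 2).
have yS : S < y by rewrite lt_min Slb ltrDl divr_gt0.
suff : y <= S by rewrite leNgt yS.
apply: (sup_upper_bound supE); split.
  by rewrite (le_trans aS (ltW yS)) ge_min lexx.
move=> z /andP[az zy]; have [zS|Sz] := ltP z S; first exact: ltS.
apply: he; first by rewrite Sz (le_trans zy) // ge_min lexx.
apply: le_lt_trans zy _; rewrite gt_min; apply/orP; right.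
by rewrite ltrD2l ltr_pdivrMr // ltr_pMr // ltr1n.
Qed.

End Paths.

(** * Shears and rotations *)

Section Lift.
Variables (R : realType) (n : nat) (s t : 'S_n) (T : Type).
Notation pl := 'cV[R]_2.
Variable H : 'I_n -> pl -> T.

(** H is read at the representative chosen by [repr]; this is meaningful once H is compatible with
    the gluing. *)
Definition lift_plot (p : tiled_space R s t) : T :=
  H (projT1 (repr p)) (\val (projT2 (repr p))).

Hypothesis Hglue : forall k i (u : pl), unit_square u -> u k 0 = 1 ->
  H i u = H (dir_perm s t k i) (u - unitv R k).

Lemma lift_plotE i (u : pl) : unit_square u -> lift_plot (plot s t i u) = H i u.
Proof.
move=> uu; rewrite /lift_plot.
have : \pi_(tiled_space R s t) (repr (plot s t i u)) = plot s t i u by rewrite reprK.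
move=> /eqmodP/asboolP.
suff E a b : clos_refl_sym_trans _ (fun x y => hglue s x y \/ vglue t x y) a b ->
    H (projT1 a) (\val (projT2 a)) = H (projT1 b) (\val (projT2 b)).
  by move/E => ->; rewrite /= clamp_id.
elim=> [x y xy|x|x y _ ->|x y z _ -> _ ->] //.
case: xy => [/(@edge_glued_hglue R n s t)|/(@edge_glued_vglue R n s t)] [-> h ->].
- have -> : s = dir_perm s t 0 by [].
  by apply: Hglue => //; exact: val_unit.
- have -> : t = dir_perm s t 1 by [].
  by apply: Hglue => //; exact: val_unit.
Qed.

End Lift.

Section Pieces.
Variables (R : realType) (n : nat) (s t s' t' : 'S_n).
Notation pl := 'cV[R]_2.
Variables (A : 'M[R]_2) (h : tiled_space R s t -> tiled_space R s' t').

(** Two pieces per square are what a shear needs, since it cuts each square along a diagonal. Maps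
    that do not cut take the whole plane for both pieces. *)
Definition two_pieces := forall i, exists (K : bool -> set pl) (j : bool -> 'I_n)
  (c : bool -> pl), [/\ forall b, closed (K b), forall w, unit_square w -> exists b, K b w &
    forall b w, unit_square w -> K b w -> unit_square (A *m w + c b) /\
       h (plot s t i w) = plot s' t' (j b) (A *m w + c b)].

Lemma closed_cover_near (K : bool -> set pl) (u : pl) (Q : pl -> Prop) :
  (forall b, closed (K b)) -> (forall w, unit_square w -> exists b, K b w) ->
  (forall b, K b u -> \forall w \near u, unit_square w -> K b w -> Q w) ->
  \forall w \near u, unit_square w -> Q w.
Proof.
move=> cK cov hQ.
have hb b : \forall w \near u, unit_square w -> K b w -> Q w.
  have [Ku|nKu] := pselect (K b u); first exact: hQ.
  have : \forall w \near u, ~ K b w.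
    by apply: open_nbhs_nbhs; split => //; exact: (closed_openC (cK b)).
  by apply: filterS => w nK _ /nK.
apply: filterS2 (hb true) (hb false) => w h1 h2 uw.
by have [[] Kw] := cov w uw; [exact: h1|exact: h2].
Qed.

Lemma affine_fun_continuous (c : pl) : continuous (fun w : pl => A *m w + c).
Proof. by move=> w; exact: (cvgD (@mulmx_continuous _ A w) (cvg_cst c)). Qed.

Lemma two_pieces_continuous : two_pieces -> continuous h.
Proof.
move=> tp; apply: tiled_continuous => i u N /= nN.
have [K [j [c [cK cov hK]]]] := tp i.
have hE : h (plot s t i u) = h (plot s t i (clamp u)) by rewrite plot_clamp.
suff : \forall w \near clamp u, unit_square w -> N (h (plot s t i w)).
  move=> /(@clamp_continuous R u) h1; apply: (@filterS _ (nbhs u) _ _ _ _ h1) => w /=.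
  by rewrite plot_clamp; apply; exact: clamp_unit.
apply: (closed_cover_near cK cov) => b Ku.
have [_ hu] := hK b _ (clamp_unit u) Ku.
have nN' : nbhs (plot s' t' (j b) (A *m clamp u + c b)) N by rewrite -hu -hE.
have h1 := affine_fun_continuous (@plot_continuous _ _ s' t' (j b) _ _ nN').
apply: (@filterS _ (nbhs (clamp u)) _ _ _ _ h1) => w /= Nw uw Kw.
by have [_ ->] := hK b _ uw Kw.
Qed.

Lemma two_pieces_affine : two_pieces -> locally_affine A h.
Proof.
move=> tp; apply: plot_affine => V g i u uu cV Vu.
have [K [j [c [cK cov hK]]]] := tp i.
apply: (closed_cover_near cK cov) => b Ku.
have [uu' hu] := hK b _ uu Ku.
have [_ _ _ tV] := (tiled_chartP _ _).1 cV.
rewrite hu in Vu *.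
have h1 := @affine_fun_continuous (c b) u _ (tV _ _ uu' Vu).
apply: (@filterS _ (nbhs u) _ _ _ _ h1) => w /= tw uw Kw.
have [uw' ->] := hK b _ uw Kw.
by rewrite tw // mulmxBr opprD addrACA subrr addr0.
Qed.

End Pieces.

Section Explicit.
Variables (R : realType) (n : nat).
Notation pl := 'cV[R]_2.
Implicit Types (s t : 'S_n).

(** Zeros are the points that are the south-west corner of two squares, so permuting these corners
    preserves them. *)
Lemma sw_zeros s t s' t' (h : tiled_space R s t -> tiled_space R s' t')
    (om : 'S_n) : bijective h ->
  (forall i, h (plot s t i 0) = plot s' t' (om i) 0) ->
  forall x, tiled_zeros (h x) <-> tiled_zeros x.
Proof.
move=> /bij_inj hI ho x; split=> /tiled_zerosP [i [j [ij ix jx]]]; apply/tiled_zerosP.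
  exists (om^-1 i)%g, (om^-1 j)%g; split; first by rewrite (inj_eq perm_inj).
    by apply: hI; rewrite ho permKV.
  by apply: hI; rewrite ho permKV.
by exists (om i), (om j); split; [rewrite (inj_eq perm_inj)|rewrite -ho ix|rewrite -ho jx].
Qed.

Lemma two_pieces_affine_map s t s' t' A B
    (h : tiled_space R s t -> tiled_space R s' t') g (om : 'S_n) :
  cancel h g -> cancel g h -> two_pieces A h -> two_pieces B g ->
  (forall i, h (plot s t i 0) = plot s' t' (om i) 0) -> affine A h.
Proof.
move=> hg gh ph pg ho; split.
- by exists g; split=> //; exact: two_pieces_continuous.
- by apply: sw_zeros ho; exists g.
- exact: two_pieces_affine.
Qed.

Lemma closed_halfplane (a b c : R) : closed [set w : pl | a * w 0 0 + b * w 1 0 <= c].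
Proof.
have C : continuous (fun w : pl => a * w 0 0 + b * w 1 0).
  suff h w : {for w, continuous (fun w : pl => a * w 0 0 + b * w 1 0)} by exact: h.
  by apply: continuousD; apply: continuousM; (try exact: cst_continuous); exact: coordC.
have -> : [set w : pl | a * w 0 0 + b * w 1 0 <= c] =
   (fun w : pl => a * w 0 0 + b * w 1 0) @^-1` [set x | x <= c] by [].
by apply: closed_comp; [move=> w _; exact: C|exact: closed_le].
Qed.

Lemma relabel_affine s t (om : 'S_n) : exists h : tiled_space R s t ->
  tiled_space R (s ^ om)%g (t ^ om)%g, affine 1%:M h.
Proof.
have dir_permJ k i : dir_perm (s ^ om)%g (t ^ om)%g k (om i) = om (dir_perm s t k i).
  by rewrite /dir_perm; case: ifP => _; rewrite permJ.
pose h := lift_plot (s := s) (t := t) (fun i (u : pl) => plot (s ^ om)%g (t ^ om)%g (om i) u).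
pose g := lift_plot (s := (s ^ om)%g) (t := (t ^ om)%g)
  (fun i (u : pl) => plot s t (om^-1 i)%g u).
have hE i (u : pl) : unit_square u -> h (plot s t i u) = plot (s ^ om)%g (t ^ om)%g (om i) u.
  move=> uu; rewrite /h lift_plotE // => k j w uw w1.
  by rewrite (plot_glue _ _ _ w1) dir_permJ.
have gE i (u : pl) : unit_square u -> g (plot (s ^ om)%g (t ^ om)%g i u) =
    plot s t (om^-1 i)%g u.
  move=> uu; rewrite /g lift_plotE // => k j w uw w1.
  rewrite (plot_glue _ _ _ w1); congr plot.
  by apply: (@perm_inj _ om); rewrite permKV -dir_permJ permKV.
exists h; apply: (@two_pieces_affine_map _ _ _ _ 1%:M 1%:M h g om).
- by move=> p; have [i [u [uu <-]]] := plot_surj p; rewrite hE // gE // permK.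
- by move=> p; have [i [u [uu <-]]] := plot_surj p; rewrite gE // hE // permKV.
- move=> i; exists (fun=> setT), (fun=> om i), (fun=> 0); split=> [_|w _|_ w uw _].
  + exact: closedT.
  + by exists true.
  + by rewrite mul1mx addr0 hE.
- move=> i; exists (fun=> setT), (fun=> om^-1 i)%g, (fun=> 0); split=> [_|w _|_ w uw _].
  + exact: closedT.
  + by exists true.
  + by rewrite mul1mx addr0 gE.
- by move=> i; rewrite hE // => k; rewrite mxE lexx ler01.
Qed.

Definition rot_mx : 'M[int]_2 := \matrix_(i, j) (if i == j then 0 else if i == 0 then -1 else 1).

(** The added unit vector brings the turned square back onto the unit square. *)
Lemma rotE (u : pl) : let v := intmx R rot_mx *m u + unitv R 0 in
  v 0 0 = 1 - u 1 0 /\ v 1 0 = u 0 0.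
Proof. by move=> v; split; rewrite [LHS]mxE mulmx2E !mxE /=; ring. Qed.

Lemma rotVE (u : pl) : let v := intmx R (- rot_mx) *m u + unitv R 1 in
  v 0 0 = u 1 0 /\ v 1 0 = 1 - u 0 0.
Proof. by move=> v; split; rewrite [LHS]mxE mulmx2E !mxE /=; ring. Qed.

Lemma rot_unit (u : pl) : unit_square u -> unit_square (intmx R rot_mx *m u + unitv R 0).
Proof.
move=> uu k; have [h0 h1] := rotE u.
by case: (ord2P k) => ->; rewrite ?h0 ?h1 //; have := uu 1; lra.
Qed.

Lemma rotV_unit (u : pl) : unit_square u -> unit_square (intmx R (- rot_mx) *m u + unitv R 1).
Proof.
move=> uu k; have [h0 h1] := rotVE u.
by case: (ord2P k) => ->; rewrite ?h0 ?h1 //; have := uu 0; lra.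
Qed.

(* The square Q_i of the source is turned a quarter onto the left neighbour of Q_i, so
   that its bottom side becomes the left side of Q_i. *)
Lemma rotation_affine s t : exists h : tiled_space R (t ^ s)%g s^-1%g -> tiled_space R s t,
  affine (intmx R rot_mx) h /\ forall i (u : pl), unit_square u ->
     h (plot (t ^ s)%g s^-1%g i u) =
     plot s t (s^-1 i)%g (intmx R rot_mx *m u + unitv R 0).
Proof.
set s1 := (t ^ s)%g; set t1 := s^-1%g.
pose F (u : pl) := intmx R rot_mx *m u + unitv R 0.
pose G (u : pl) := intmx R (- rot_mx) *m u + unitv R 1.
have FG u : F (G u) = u.
  apply: cV2P => k; have [f0 f1] := rotE (G u); have [g0 g1] := rotVE u.
  by case: (ord2P k) => ->; rewrite /F ?f0 ?f1 /G ?g0 ?g1; ring.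
have GF u : G (F u) = u.
  apply: cV2P => k; have [f0 f1] := rotE u; have [g0 g1] := rotVE (F u).
  by case: (ord2P k) => ->; rewrite /G ?g0 ?g1 /F ?f0 ?f1; ring.
have F_sub k u : F (u - unitv R k) = F u + (if k == 0 then - unitv R 1 else unitv R 0).
  apply: cV2P => l; have [f0 f1] := rotE u; have [f0' f1'] := rotE (u - unitv R k).
  rewrite [RHS]mxE; case: (ord2P l) => ->; rewrite /F ?f0 ?f1 ?f0' ?f1' !mxE;
    by case: (ord2P k) => -> /=; rewrite !mxE /=; ring.
have G_sub k u : G (u - unitv R k) = G u + (if k == 0 then unitv R 1 else - unitv R 0).
  apply: cV2P => l; have [f0 f1] := rotVE u; have [f0' f1'] := rotVE (u - unitv R k).
  rewrite [RHS]mxE; case: (ord2P l) => ->; rewrite /G ?f0 ?f1 ?f0' ?f1' !mxE;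
    by case: (ord2P k) => -> /=; rewrite !mxE /=; ring.
pose h := lift_plot (s := s1) (t := t1) (fun i (u : pl) => plot s t (t1 i) (F u)).
pose g := lift_plot (s := s) (t := t) (fun i (u : pl) => plot s1 t1 (s i) (G u)).
have hE i (u : pl) : unit_square u -> h (plot s1 t1 i u) = plot s t (t1 i) (F u).
  move=> uu; rewrite /h lift_plotE // => k j w uw w1; rewrite F_sub.
  have [f0 f1] := rotE w.
  case: (ord2P k) w1 => -> w1 /=.
    rewrite (@plot_glue _ _ _ _ 1) ?f1 //; congr plot; rewrite /dir_perm /=.
    by apply: (@perm_inj _ s); rewrite permKV -permJ permKV.
  rewrite [RHS](@plot_glue _ _ _ _ 0); last by rewrite mxE f0 w1 mxE /=; ring.
  by rewrite addrK /dir_perm /= permKV.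
have gE i (u : pl) : unit_square u -> g (plot s t i u) = plot s1 t1 (s i) (G u).
  move=> uu; rewrite /g lift_plotE // => k j w uw w1; rewrite G_sub.
  have [f0 f1] := rotVE w.
  case: (ord2P k) w1 => -> w1 /=.
    rewrite [RHS](@plot_glue _ _ _ _ 1); last by rewrite mxE f1 w1 mxE /=; ring.
    by rewrite addrK /dir_perm /= permK.
  by rewrite (@plot_glue _ _ _ _ 0) ?f0 // /dir_perm /= /s1 permJ.
exists h; split=> //.
apply: (@two_pieces_affine_map _ _ _ _ (intmx R rot_mx) (intmx R (- rot_mx)) h g 1%g).
- move=> p; have [i [u [uu <-]]] := plot_surj p.
  by rewrite hE // gE ?GF ?permKV //; exact: rot_unit.
- move=> p; have [i [u [uu <-]]] := plot_surj p.
  by rewrite gE // hE ?FG ?permK //; exact: rotV_unit.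
- move=> i; exists (fun=> setT), (fun=> t1 i), (fun=> unitv R 0); split=> [_|w _|_ w uw _].
  + exact: closedT.
  + by exists true.
  + by split; [exact: rot_unit|exact: hE].
- move=> i; exists (fun=> setT), (fun=> s i), (fun=> unitv R 1); split=> [_|w _|_ w uw _].
  + exact: closedT.
  + by exists true.
  + by split; [exact: rotV_unit|exact: gE].
move=> i; rewrite hE; last by move=> k; rewrite mxE lexx ler01.
rewrite /F mulmx0 add0r (@plot_glue _ _ _ _ 0) ?subrr ?mxE //.
by rewrite /dir_perm /= permKV perm1.
Qed.

End Explicit.

Section Shear.
Variables (R : realType) (n : nat).
Notation pl := 'cV[R]_2.
Notation unitv := (unitv R).

Definition shear_mx (k : 'I_2) : 'M[int]_2 := \matrix_(i, j) ((i == j) || (i == k))%:R.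

(* The gluings of the tiling by the images of the squares under the shear in direction k. *)
Definition shear_perm (s t : 'S_n) (k m : 'I_2) : 'S_n :=
  if m == k then dir_perm s t k else (dir_perm s t k * dir_perm s t m)%g.

Definition shear_pair (k : 'I_2) (w : 'S_n * 'S_n) : 'S_n * 'S_n :=
  (shear_perm w.1 w.2 k 0, shear_perm w.1 w.2 k 1).

Variables (s t : 'S_n) (k : 'I_2).
Notation s1 := (shear_perm s t k 0).
Notation t1 := (shear_perm s t k 1).
Notation dp := (dir_perm s t).

Lemma dir_perm_shear m : dir_perm s1 t1 m = shear_perm s t k m.
Proof. by rewrite /dir_perm; case: (ord2P m) => ->. Qed.

Let coord_sum (u : pl) := u 0 0 + u 1 0.
(** The difference [coord_sum u - u k 0] is the other coordinate, written without naming its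
    index. *)
Let shear (u : pl) : pl := u + (coord_sum u - u k 0) *: unitv k.
Let unshear (u : pl) : pl := u - (coord_sum u - u k 0) *: unitv k.

Lemma coord_sum_unitv (u : pl) m : coord_sum (u - unitv m) = coord_sum u - 1.
Proof. by rewrite /coord_sum !mxE; case: (ord2P m) => -> /=; ring. Qed.

Lemma shearE (u : pl) m : shear u m 0 = if m == k then coord_sum u else u m 0.
Proof. by rewrite !mxE eqxx andbT; have [->|_] := eqVneq m k; rewrite /=; ring. Qed.

Lemma unshearE (u : pl) m : unshear u m 0 = if m == k then u k 0 *+ 2 - coord_sum u else u m 0.
Proof. by rewrite !mxE eqxx andbT; have [->|_] := eqVneq m k; rewrite /=; ring. Qed.

Lemma coord_sum_other (u : pl) m : m != k -> coord_sum u = u k 0 + u m 0.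
Proof.
by rewrite /coord_sum; case: (ord2P m) (ord2P k) => -> [] -> //= _; rewrite addrC.
Qed.

Lemma shear_unitv (u : pl) : shear (u - unitv k) = shear u - unitv k.
Proof.
by rewrite /shear coord_sum_unitv !mxE !eqxx /=; apply: cV2P => m; rewrite !mxE; ring.
Qed.

Lemma shear_unitv' (u : pl) m : m != k -> shear (u - unitv m) = shear u - unitv k - unitv m.
Proof.
move=> mk; rewrite /shear coord_sum_unitv !mxE eq_sym (negbTE mk) /=.
by apply: cV2P => l; rewrite !mxE; ring.
Qed.

Lemma unshear_unitv (u : pl) : unshear (u - unitv k) = unshear u - unitv k.
Proof.
by rewrite /unshear coord_sum_unitv !mxE !eqxx /=; apply: cV2P => m; rewrite !mxE; ring.
Qed.

Lemma unshear_unitv' (u : pl) m : m != k -> unshear (u - unitv m) = unshear u + unitv k - unitv m.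
Proof.
move=> mk; rewrite /unshear coord_sum_unitv !mxE eq_sym (negbTE mk) /=.
by apply: cV2P => l; rewrite !mxE; ring.
Qed.

Lemma ord2_other : exists m : 'I_2, m != k.
Proof. by case: (ord2P k) => ->; [exists 1|exists 0]. Qed.

Lemma shearK u : unshear (shear u) = u.
Proof.
have [m mk] := ord2_other; apply: cV2P => l;
  rewrite unshearE (coord_sum_other _ mk) !shearE eqxx (negbTE mk).
by have [->|//] := eqVneq l k; rewrite (coord_sum_other _ mk); ring.
Qed.

Lemma unshearK u : shear (unshear u) = u.
Proof.
have [m mk] := ord2_other; apply: cV2P => l;
  rewrite shearE (coord_sum_other _ mk) !unshearE eqxx (negbTE mk).
by have [->|//] := eqVneq l k; rewrite (coord_sum_other _ mk); ring.
Qed.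

Lemma shear_unit u : unit_square u -> coord_sum u <= 1 -> unit_square (shear u).
Proof.
move=> uu u1 m; rewrite shearE; case: ifP => _; last exact: uu.
by rewrite u1 andbT; apply: addr_ge0; [have /andP[] := uu 0|have /andP[] := uu 1].
Qed.

Lemma shear_unit' u : unit_square u -> 1 <= coord_sum u -> unit_square (shear u - unitv k).
Proof.
move=> uu u1 m; rewrite mxE shearE !mxE eqxx andbT; case: ifP => _ /=; last by rewrite subr0;
  exact: uu.
by have := uu 0; have := uu 1; rewrite /coord_sum in u1 *; lra.
Qed.

Lemma unshear_unit u : unit_square u -> 0 <= unshear u k 0 -> unit_square (unshear u).
Proof.
move=> uu u1 l; have [m mk] := ord2_other.
have := unshearE u l; have := uu k; have := uu m; move: u1;
  rewrite unshearE eqxx (coord_sum_other _ mk).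
have [_|_] := eqVneq l k => h h1 h2 ->; [lra|exact: uu].
Qed.

Lemma unshear_unit' u : unit_square u -> unshear u k 0 <= 0 -> unit_square (unshear u + unitv k).
Proof.
move=> uu u1 l; have [m mk] := ord2_other.
have := unshearE u l; have := uu k; have := uu m; move: u1;
  rewrite unshearE eqxx (coord_sum_other _ mk).
rewrite !mxE eqxx andbT /=.
have [_|_] := eqVneq l k => h h1 h2 ->; [rewrite mulr1n; lra|rewrite addr0; exact: uu].
Qed.

(** The sheared Q_i is a parallelogram over Q_i and its neighbour in direction k; the cut between
    them is where the coordinates add up to 1. The inverse map is cut along the other diagonal. *)
Let H i (u : pl) := if coord_sum u <= 1 then plot s t i (shear u) else plot s t (dp k i) (shear
  u - unitv k).
Let G i (u : pl) := if 0 <= unshear u k 0 then plot s1 t1 i (unshear u)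
  else plot s1 t1 ((dp k)^-1%g i) (unshear u + unitv k).

Lemma shear_plot_ge i u : 1 <= coord_sum u -> H i u = plot s t (dp k i) (shear u - unitv k).
Proof.
rewrite /H le_eqVlt => /orP[/eqP e|]; last by rewrite ltNge => /negbTE ->.
by rewrite -e lexx (@plot_glue _ _ _ _ k) // shearE eqxx.
Qed.

Lemma shear_plot_le i u : coord_sum u <= 1 -> H i u = plot s t i (shear u).
Proof. by rewrite /H => ->. Qed.

Lemma unshear_plot_ge i u : 0 <= unshear u k 0 -> G i u = plot s1 t1 i (unshear u).
Proof. by rewrite /G => ->. Qed.

Lemma unshear_plot_le i u : unshear u k 0 <= 0 -> G i u = plot s1 t1 ((dp k)^-1%g i) (unshear u
  + unitv k).
Proof.
rewrite /G le_eqVlt => /orP[/eqP e|]; last by rewrite ltNge => /negbTE ->.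
by rewrite e lexx (@plot_glueV _ _ _ _ k) // dir_perm_shear /shear_perm eqxx.
Qed.

(** The origin of the product in [shear_perm]: a point on the side transverse to k is sheared into
    the neighbour in direction k, and crosses into direction m from there. *)
Lemma shear_plot_glue m i (u : pl) : unit_square u -> u m 0 = 1 ->
  H i u = H (dir_perm s1 t1 m i) (u - unitv m).
Proof.
move=> uu um; rewrite dir_perm_shear /shear_perm.
have sum1 : 1 <= coord_sum u /\ coord_sum (u - unitv m) <= 1.
  by rewrite coord_sum_unitv /coord_sum; have := uu 0; have := uu 1;
    case: (ord2P m) um => -> ->; lra.
rewrite shear_plot_ge ?shear_plot_le; [|by case: sum1..].
have [->|mk] := eqVneq m k; first by rewrite shear_unitv.
rewrite (@plot_glue _ _ _ _ m); first by rewrite permM shear_unitv'.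
by rewrite sub_unitvE shearE (negbTE mk) um /= subr0.
Qed.

Lemma unshear_plot_glue m i (u : pl) : unit_square u -> u m 0 = 1 ->
  G i u = G (dp m i) (u - unitv m).
Proof.
move=> uu um; have [l lk] := ord2_other.
have [mE|mk] := eqVneq m k.
  subst m; have h : 0 <= unshear u k 0 /\ unshear (u - unitv k) k 0 <= 0.
    rewrite unshear_unitv sub_unitvE unshearE eqxx (coord_sum_other _ lk) um /=.
    by have := uu l; lra.
  by rewrite unshear_plot_ge ?unshear_plot_le; [|by case: h..]; rewrite permK unshear_unitv subrK.
have h : unshear u k 0 <= 0 /\ 0 <= unshear (u - unitv m) k 0.
  rewrite unshear_unitv' // sub_unitvE add_unitvE unshearE eqxx [k == m]eq_sym (negbTE mk) /=
    (coord_sum_other _ mk) um.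
  by have := uu k; lra.
rewrite unshear_plot_le ?unshear_plot_ge; [|by case: h..].
rewrite (@plot_glue _ _ _ _ m); last by rewrite add_unitvE unshearE (negbTE mk) um /= addr0.
by rewrite dir_perm_shear /shear_perm (negbTE mk) permM permKV unshear_unitv'.
Qed.

Lemma shear_mxE (u : pl) : intmx R (shear_mx k) *m u = shear u.
Proof.
apply: cV2P => m; rewrite mulmx2E shearE !mxE /coord_sum.
by case: (ord2P m) (ord2P k) => -> [] -> /=; ring.
Qed.

Lemma shearV_mxE (u : pl) : intmx R (2%:M - shear_mx k) *m u = unshear u.
Proof.
apply: cV2P => m; rewrite mulmx2E unshearE !mxE /coord_sum.
by case: (ord2P m) (ord2P k) => -> [] -> /=; ring.
Qed.

Lemma shear_affine : exists h : tiled_space R s1 t1 -> tiled_space R s t,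
  affine (intmx R (shear_mx k)) h /\ forall i (u : pl), unit_square u -> coord_sum u <= 1 ->
     h (plot s1 t1 i u) = plot s t i (intmx R (shear_mx k) *m u).
Proof.
pose h := lift_plot (s := s1) (t := t1) H.
pose g := lift_plot (s := s) (t := t) G.
have hE i (u : pl) : unit_square u -> h (plot s1 t1 i u) = H i u.
  by move=> uu; rewrite /h lift_plotE // => *; exact: shear_plot_glue.
have gE i (u : pl) : unit_square u -> g (plot s t i u) = G i u.
  by move=> uu; rewrite /g lift_plotE // => *; exact: unshear_plot_glue.
have [l lk] := ord2_other.
exists h; split; last by move=> i u uu u1; rewrite hE // shear_plot_le // shear_mxE.
apply: (@two_pieces_affine_map _ _ _ _ _ _ _ (intmx R (2%:M - shear_mx k)) h g 1%g).
- move=> p; have [i [u [uu <-]]] := plot_surj p; rewrite hE //.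
  have [u1|/ltW u1] := leP (coord_sum u) 1.
    rewrite shear_plot_le // gE; last exact: shear_unit.
    by rewrite unshear_plot_ge shearK //; case/andP: (uu k).
  rewrite shear_plot_ge // gE; last exact: shear_unit'.
  rewrite unshear_plot_le unshear_unitv shearK; last by rewrite sub_unitvE eqxx subr_le0;
    case/andP: (uu k).
  by rewrite permK subrK.
- move=> p; have [i [u [uu <-]]] := plot_surj p; rewrite gE //.
  have [u1|/ltW u1] := leP 0 (unshear u k 0).
    rewrite unshear_plot_ge // hE; last exact: unshear_unit.
    have h1 : coord_sum (unshear u) = u k 0.
      by rewrite (coord_sum_other _ lk) !unshearE eqxx (negbTE lk) (coord_sum_other _ lk); ring.
    by rewrite shear_plot_le ?unshearK // h1; case/andP: (uu k).
  rewrite unshear_plot_le // hE; last exact: unshear_unit'.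
  have h1 : coord_sum (unshear u + unitv k) = u k 0 + 1.
    rewrite (coord_sum_other _ lk) !add_unitvE !unshearE eqxx (negbTE lk) (coord_sum_other _ lk)
      /=.
    by ring.
  rewrite shear_plot_ge; last by rewrite h1 lerDr; case/andP: (uu k).
  rewrite permKV; congr plot; rewrite -shear_unitv addrK.
  exact: unshearK.
- move=> i; exists (fun b => if b then [set w : pl | 1 * w 0 0 + 1 * w 1 0 <= 1]
                      else [set w : pl | -1 * w 0 0 + -1 * w 1 0 <= -1]),
    (fun b => if b then i else dp k i), (fun b => if b then 0 else - unitv k); split.
  + by case; exact: closed_halfplane.
  + move=> w _; have [w1|/ltW w1] := leP (coord_sum w) 1; [exists true|exists false];
      rewrite /= /coord_sum in w1 *; lra.
  + case=> w uw /= w1; rewrite shear_mxE hE // ?addr0.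
      have w1' : coord_sum w <= 1 by rewrite /coord_sum; lra.
      by rewrite shear_plot_le //; split=> //; exact: shear_unit.
    have w1' : 1 <= coord_sum w by rewrite /coord_sum; lra.
    by rewrite shear_plot_ge //; split=> //; exact: shear_unit'.
(* The coefficients of the k-th coordinate of [unshear], which presents the two pieces as
   half-planes. *)
- pose c : pl := \col_m (if m == k then 1 else -1).
  have cE (w : pl) : unshear w k 0 = c 0 0 * w 0 0 + c 1 0 * w 1 0.
    by rewrite unshearE eqxx /coord_sum !mxE; case: (ord2P k) => -> /=; ring.
  move=> i; exists (fun b => if b then [set w : pl | - c 0 0 * w 0 0 + - c 1 0 * w 1 0 <= 0]
                      else [set w : pl | c 0 0 * w 0 0 + c 1 0 * w 1 0 <= 0]),
    (fun b => if b then i else (dp k)^-1%g i), (fun b => if b then 0 else unitv k); split.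
  + by case; exact: closed_halfplane.
  + move=> w _; have [w1|/ltW w1] := leP 0 (unshear w k 0); [exists true|exists false];
      rewrite /= cE in w1 *; lra.
  + case=> w uw /= w1; rewrite shearV_mxE gE // ?addr0.
      have w1' : 0 <= unshear w k 0 by rewrite cE; lra.
      by rewrite unshear_plot_ge //; split=> //; exact: unshear_unit.
    have w1' : unshear w k 0 <= 0 by rewrite cE; lra.
    by rewrite unshear_plot_le //; split=> //; exact: unshear_unit'.
move=> i; rewrite hE; last by move=> m; rewrite mxE lexx ler01.
have s0 : coord_sum 0 = 0 by rewrite /coord_sum !mxE addr0.
by rewrite shear_plot_le ?s0 ?ler01 // /shear s0 mxE subr0 scale0r addr0 perm1.
Qed.

End Shear.

(** * Rigidity *)

Section Strips.
Variables (R : realType) (n : nat) (s t : 'S_n) (k : 'I_2).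
Notation pl := 'cV[R]_2.
Notation X := (tiled_space R s t).
Notation dp := (dir_perm s t).

(* The row of squares Q_i, dp k i, dp k (dp k i), ..., glued in direction k. *)
Fixpoint strip (N : nat) (i : 'I_n) (u : pl) : X :=
  if N is N'.+1 then if u k 0 <= 1 then plot s t i u else strip N' (dp k i) (u - unitv R k)
  else plot s t i u.

Definition strip_domain (N : nat) (u : pl) :=
  0 <= u k 0 <= N.+1%:R /\ forall l, l != k -> 0 <= u l 0 <= 1.

Lemma strip_le N i (u : pl) : u k 0 <= 1 -> strip N i u = plot s t i u.
Proof. by case: N => //= N ->. Qed.

Lemma strip_ge N i (u : pl) : 1 <= u k 0 -> strip N.+1 i u = strip N (dp k i) (u - unitv R k).
Proof.
rewrite le_eqVlt => /orP[/eqP e|]; last by rewrite ltNge /= => /negbTE ->.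
rewrite strip_le -?e // strip_le; last by rewrite sub_unitvE -e eqxx subrr ler01.
exact: plot_glue.
Qed.

Lemma strip_domainS N (u : pl) : 1 <= u k 0 -> strip_domain N.+1 u ->
  strip_domain N (u - unitv R k).
Proof.
move=> u1 [/andP[u0 uN] ul]; split.
  by rewrite sub_unitvE eqxx subr_ge0 u1 lerBlDr natr1.
by move=> l lk; rewrite sub_unitvE (negbTE lk) subr0; exact: ul.
Qed.

Lemma strip_domain_unit N (u : pl) : u k 0 <= 1 -> strip_domain N u -> unit_square u.
Proof.
move=> u1 [/andP[u0 _] ul] l; have [->|] := eqVneq l k; last exact: ul.
by rewrite u0.
Qed.

Lemma strip_plot N i (u : pl) : strip_domain N u -> exists j w,
  [/\ unit_square w, strip N i u = plot s t j w & forall l, l != k -> w l 0 = u l 0].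
Proof.
elim: N i u => [|N IH] i u Du.
  have u1 : u k 0 <= 1 by case: Du => /andP[].
  by exists i, u; split=> //; exact: strip_domain_unit Du.
have [u1|/ltW u1] := leP (u k 0) 1.
  by exists i, u; split=> //; [exact: strip_domain_unit Du|rewrite strip_le].
have [j [w [uw e wl]]] := IH (dp k i) _ (strip_domainS u1 Du).
exists j, w; split=> //; first by rewrite strip_ge.
by move=> l lk; rewrite wl // sub_unitvE (negbTE lk) subr0.
Qed.

Lemma near_halves (u : pl) (Q : pl -> Prop) :
  (u k 0 <= 1 -> \forall w \near u, (w : pl) k 0 <= 1 -> Q w) ->
  (1 <= u k 0 -> \forall w \near u, 1 <= (w : pl) k 0 -> Q w) ->
  \forall w \near u, Q w.
Proof.
move=> h1 h2.
have n1 : \forall w \near u, (w : pl) k 0 <= 1 -> Q w.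
  have [/h1 //|u1] := leP (u k 0) 1.
  by apply: filterS (near_coord_gt u1) => w; rewrite ltNge => /negP.
have n2 : \forall w \near u, 1 <= (w : pl) k 0 -> Q w.
  have [/h2 //|u1] := leP 1 (u k 0).
  by apply: filterS (near_coord_lt u1) => w; rewrite ltNge => /negP.
by apply: filterS2 n1 n2 => w w1 w2; have [/w1|/ltW /w2] := leP (w k 0) 1.
Qed.

Lemma sub_continuous (v : pl) : continuous (fun w : pl => w - v).
Proof. by move=> w; exact: (cvgB (@cvg_id _ (nbhs w)) (cvg_cst v)). Qed.

Lemma strip_continuous N i : continuous (strip N i).
Proof.
elim: N i => [|N IH] i; first exact: plot_continuous.
move=> u M nM; apply: (@near_halves u (fun w => M (strip N.+1 i w))) => u1.
  rewrite strip_le // in nM.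
  have h := @plot_continuous _ _ s t i u _ nM.
  by apply: (@filterS _ (nbhs u) _ _ _ _ h) => w /= Mw w1; rewrite w1.
rewrite strip_ge // in nM.
apply: (@filterS _ (nbhs u) _ _ _ _ (@sub_continuous (unitv R k) u _ (IH (dp k i) _ _ nM))) => w
  Mw w1.
by rewrite strip_ge.
Qed.

(** A row of squares develops into a rectangle: charts see a translation even across the glued
    edges. *)
Lemma strip_translation U f N i (u : pl) : tiled_charts (U, f) ->
  strip_domain N u -> U (strip N i u) ->
  \forall w \near u, strip_domain N w -> f (strip N i w) - f (strip N i u) = w - u.
Proof.
move=> cU; have [_ _ _ tU] := (tiled_chartP _ _).1 cU.
have base i' N' (v : pl) : v k 0 <= 1 -> strip_domain N' v -> U (plot s t i' v) ->
    \forall w \near v, (w : pl) k 0 <= 1 -> strip_domain N' w ->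
      f (plot s t i' w) - f (plot s t i' v) = w - v.
  move=> v1 Dv Uv; have := tU _ _ (strip_domain_unit v1 Dv) Uv.
  by apply: filterS => w h w1 Dw; apply: h; exact: strip_domain_unit Dw.
elim: N i u => [|N IH] i u Du Uu.
  have u1 : u k 0 <= 1 by case: Du => /andP[].
  apply: filterS (base i 0 u u1 Du Uu) => w h Dw; apply: h => //.
  by case: Dw => /andP[].
apply: near_halves => u1.
  rewrite strip_le // in Uu *.
  by apply: filterS (base i _ u u1 Du Uu) => w h w1 Dw; rewrite strip_le // h.
rewrite strip_ge // in Uu *.
apply: (@filterS _ (nbhs u) _ _ _ _
  (@sub_continuous (unitv R k) u _ (IH (dp k i) _ (strip_domainS u1 Du) Uu))) => w h w1 Dw.
rewrite strip_ge //; move: h => /= ->; last exact: strip_domainS.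
by rewrite opprB addrA subrK.
Qed.

Lemma strip_straight (T : topologicalType) (g d : T -> pl) N i x :
  {for x, continuous g} -> (\forall y \near x, strip_domain N (g y)) ->
  (forall y, g y - g x = d y - d x) -> straight d (strip N i \o g) x.
Proof.
move=> gC gD gd U f cU Ux.
have h := gC _ (strip_translation cU (nbhs_singleton gD) Ux).
apply: (@filterS2 _ (nbhs x) _ _ _ _ _ h gD) => y /= hy Dy.
by rewrite -gd; exact: hy.
Qed.

End Strips.

Section HalfOpen.
Variables (R : realType) (n : nat) (s t : 'S_n).
Notation pl := 'cV[R]_2.
Notation X := (tiled_space R s t).

(** Coordinates are determined modulo 1 and those of a zero are integers. *)
Lemma noncorner_regular i (u : pl) k : unit_square u -> u k 0 != 0 -> u k 0 != 1 ->
  ~ tiled_zeros (plot s t i u).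
Proof.
move=> uu u0 u1 /tiled_zerosP [j [_ [_ e _]]].
have z0 : unit_square (0 : pl) by move=> l; rewrite mxE lexx ler01.
case: (plot_coord k z0 uu e) => [E|[_ E]|[E _]].
- by rewrite -E mxE eqxx in u0.
- by rewrite E eqxx in u1.
- by move/eqP: E; rewrite mxE eq_sym oner_eq0.
Qed.

Lemma half_open_exists (p : X) : exists (c : 'I_n * pl),
  [/\ unit_square c.2, forall k, c.2 k 0 < 1 & plot s t c.1 c.2 = p].
Proof.
have [i [u [uu <-]]] := plot_surj p.
have [j [w [uw e w1]]] := plot_room s t i (fun=> true) uu.
by exists (j, w).
Qed.

(** Two distinct representatives of a regular point lie on either side of some edge, so one of them
    has a coordinate 1. At a zero, several south-west corners would qualify. *)
Lemma half_open_unique (p : X) i j (u w : pl) : ~ tiled_zeros p ->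
  unit_square u -> unit_square w -> (forall k, u k 0 < 1) -> (forall k, w k 0 < 1) ->
  plot s t i u = p -> plot s t j w = p -> (i, u) = (j, w).
Proof.
move=> pr uu uw u1 w1 up wp.
case: (regular_fiber pr uu uw up wp) => [//|[k [_ e _]]|[k [_ e _]]|h].
- by have := u1 k; rewrite e ltxx.
- by have := w1 k; rewrite e ltxx.
- case: (plot_coord 0 uu uw (etrans up (esym wp))) => [/h //|[_ e]|[e _]].
    by have := w1 0; rewrite e ltxx.
  by have := u1 0; rewrite e ltxx.
Qed.

End HalfOpen.

Section Rigidity.
Variables (R : realType) (n : nat) (s t s' t' : 'S_n).
Notation pl := 'cV[R]_2.
Variable h : tiled_space R s t -> tiled_space R s' t'.
Hypothesis ah : affine 1%:M h.

Let c0 : pl := const_mx 2^-1.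

Lemma centerE k : c0 k 0 = 2^-1. Proof. by rewrite mxE. Qed.

Lemma center_unit : unit_square c0.
Proof. by move=> k; rewrite centerE; lra. Qed.

Lemma straight_affine (T : topologicalType) (A : 'M[R]_2) (d : T -> pl)
    (s1 t1 s2 t2 : 'S_n) (f : tiled_space R s1 t1 -> tiled_space R s2 t2)
    (c : T -> tiled_space R s1 t1) x : affine A f -> {for x, continuous c} ->
  straight d c x -> straight (fun y => A *m d y) (f \o c) x.
Proof.
move=> af cC sc V g cV Vx.
have [U [e [cU Ux]]] : exists U e, tiled_charts (U, e) /\ U (c x).
  by apply: chart_exists; case: af => _ <- _; exact: chart_regular cV Vx.
have [_ _ hl] := af.
have h1 := sc U e cU Ux; have h2 := cC _ (hl _ _ _ _ _ cU cV Ux Vx).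
by apply: (@filterS2 _ (nbhs x) _ _ _ _ _ h1 h2) => y /= h3 ->; rewrite h3 mulmxBr.
Qed.

Lemma center_path_regular k i x : 0 <= x <= 1 ->
  ~ tiled_zeros (strip s t k 1 i (c0 + x *: unitv R k)).
Proof.
move=> x01; have [l lk] := ord2_other k.
have D : strip_domain k 1 (c0 + x *: unitv R k).
  split; first by rewrite !mxE !eqxx /=; lra.
  by move=> m mk; rewrite !mxE (negbTE mk) /=; lra.
have [j [w [uw -> wl]]] := strip_plot s t i D.
have wl' : w l 0 = 2^-1 by rewrite wl // !mxE (negbTE lk) /=; ring.
by apply: (@noncorner_regular R n s t j w l) => //; rewrite wl' ?invr_eq0 ?invr_eq1 ?pnatr_eq0
    ?pnatr_eq1.
Qed.

Lemma strip_path_continuous (s1 t1 : 'S_n) k i (z : pl) :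
  continuous (fun x : R => strip s1 t1 k 1 i (z + x *: unitv R k)).
Proof.
move=> x; apply: (@continuous_comp _ _ _ (fun x : R => z + x *: unitv R k)).
  exact: segment_continuous.
exact: strip_continuous.
Qed.

Lemma strip_path_straight (s1 t1 : 'S_n) k i (z : pl) (x : R) : unit_square z -> 0 < x < 1 ->
  straight (fun y : R => y *: unitv R k) (fun x : R => strip s1 t1 k 1 i (z + x *: unitv R k)) x.
Proof.
move=> uz x01.
apply: (@strip_straight R n s1 t1 k R (fun x : R => z + x *: unitv R k)).
- exact: segment_continuous.
- apply: filterS (near_itv x01) => y y01; split.
    by rewrite !mxE !eqxx /= mulr1; have := uz k; lra.
  by move=> l lk; rewrite !mxE (negbTE lk) /= mulr0 addr0; exact: uz.
- by move=> y; rewrite opprD addrACA subrr add0r.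
Qed.

(** The image of the path from the center of a square to the next center is straight and starts at z
    in Q_j, so it coincides with the path from z along the row of Q_j. *)
Lemma center_transport k i j (z : pl) : unit_square z -> (forall l, z l 0 < 1) ->
  h (plot s t i c0) = plot s' t' j z ->
  h (plot s t (dir_perm s t k i) c0) = plot s' t' (dir_perm s' t' k j) z.
Proof.
move=> uz z1 e.
pose c x := h (strip s t k 1 i (c0 + x *: unitv R k)).
pose d x := strip s' t' k 1 j (z + x *: unitv R k).
have cC : continuous c.
  move=> x; have H := @continuous_comp _ _ _ (fun x : R => strip s t k 1 i (c0 + x *: unitv R
    k)) h x.
  apply: H; first exact: strip_path_continuous.
  exact: (affine_continuous ah).
have dC : continuous d by exact: strip_path_continuous.
have cs (x : R) : 0 < x < 1 -> straight (fun y : R => y *: unitv R k) c x.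
  move=> x01; have := straight_affine ah (@strip_path_continuous s t k i c0 x)
     (@strip_path_straight s t k i c0 x center_unit x01).
  by have -> : (fun y : R => 1%:M *m (y *: unitv R k)) = (fun y : R => y *: unitv R k)
    by apply/funext => y; rewrite mul1mx.
have ds (x : R) : 0 < x < 1 -> straight (fun y : R => y *: unitv R k) d x.
  exact: strip_path_straight.
(* Regularity is read at the source: the path between centers avoids all corners and h preserves
   zeros, while nothing is known yet about d. *)
have cr (x : R) : 0 <= x < 1 -> ~ tiled_zeros (c x).
  move=> /andP[x0 x1]; case: ah => _ -> _; apply: center_path_regular.
  by rewrite x0 ltW.
have cd0 : c 0 = d 0.
  by rewrite /c /d !scale0r !addr0 !strip_le // ?ltW ?z1 // centerE; lra.
have := @path_unique R n s' t' c d (unitv R k) 0 1 (continuous_subspaceT cC)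
  (continuous_subspaceT dC) cs ds cr cd0 1.
rewrite lexx ler01 => /(_ isT).
rewrite /c /d !scale1r !strip_ge ?addrK //.
- by rewrite add_unitvE eqxx; case/andP: (uz k) => ? _; rewrite lerDr.
- by rewrite add_unitvE eqxx centerE /=; lra.
Qed.

(** The pair [c i] is the target square and the offset in it where the center of Q_i lands.
    Neighbours keep the offset, so the map to target squares intertwines the permutations; what
    remains is its injectivity. *)
Lemma rigidity : exists om : 'S_n, s' = (s ^ om)%g /\ t' = (t ^ om)%g.
Proof.
have [hh hz _] := ah; have [g [_ gC hg gh]] := hh.
have [c hc] := choice (fun i => half_open_exists (h (plot s t i c0))).
have cr i : ~ tiled_zeros (h (plot s t i c0)).
  rewrite hz; apply: (@noncorner_regular R n s t i c0 0); first exact: center_unit;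
  by rewrite centerE ?invr_eq0 ?invr_eq1 ?pnatr_eq0
    ?pnatr_eq1.
have cS k i : c (dir_perm s t k i) = (dir_perm s' t' k (c i).1, (c i).2).
  have [uz z1 e] := hc i; have e' := center_transport k uz z1 (esym e).
  have [uz' z1' e''] := hc (dir_perm s t k i).
  by rewrite [LHS]surjective_pairing; exact: (half_open_unique (@cr (dir_perm s t k i)) uz' uz).
have c2_inj i j : (c i).1 = (c j).1 -> (c i).2 = (c j).2.
  move=> e; apply/eqP/negP => /negP cij.
  (* Centers landing in one target square have the same offset. The segment joining their images
     pulls back to a path in the source, along which [phi], constant on every square and compatible
     with the gluing, would pass from 1 to 0 without the value 1/2. *)
  pose phi (p : tiled_space R s t) : R :=
    (lift_plot (s := s) (t := t) (fun l (_ : pl) => (c l).2) p == (c i).2)%:R.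
  have phiE l (u : pl) : phi (plot s t l u) = ((c l).2 == (c i).2)%:R.
    rewrite /phi -plot_clamp lift_plotE //; last exact: clamp_unit.
    by move=> k m v _ _ /=; rewrite cS.
  have phiC : continuous phi.
    apply: tiled_continuous => l.
    have -> : phi \o plot s t l = cst ((c l).2 == (c i).2)%:R.
      by apply/funext => u; exact: phiE.
    by move=> u; exact: cst_continuous.
  pose psi (x : R) := phi (g (plot s' t' (c i).1 ((c i).2 + x *: ((c j).2 - (c i).2)))).
  have psiC : continuous psi.
    move=> x; apply: (@continuous_comp _ _ _ _ phi); last exact: phiC.
    apply: (@continuous_comp _ _ _ _ g); last exact: gC.
    apply: (@continuous_comp _ _ _ _ (plot s' t' (c i).1)); last exact: plot_continuous.
    exact: segment_continuous.
  have [_ _ ei] := hc i; have [_ _ ej] := hc j.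
  have psi0 : psi 0 = 1 by rewrite /psi scale0r addr0 ei hg phiE eqxx.
  have psi1 : psi 1 = 0.
    by rewrite /psi scale1r addrC subrK e ej hg phiE eq_sym (negbTE cij).
  have [|x _] := @IVT R psi 0 1 2^-1 ler01 (continuous_subspaceT psiC).
    by rewrite psi0 psi1 ge_min le_max; apply/andP; split; apply/orP; [right|left]; lra.
  rewrite /psi /phi; case: (_ == _) => /=; lra.
have om_inj : injective (fun i => (c i).1).
  move=> i j /= e; have e2 := c2_inj _ _ e.
  have [_ _ ei] := hc i; have [_ _ ej] := hc j.
  have : h (plot s t i c0) = h (plot s t j c0) by rewrite -ei -ej e e2.
  move=> /(can_inj hg) /(plot_eqP center_unit center_unit).
  case=> [[]|[k /= [_ H _]]|[k /= [_ H _]]|[/= /(_ 0) H _]]; first by [].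
  - by exfalso; move: H; rewrite centerE; lra.
  - by exfalso; move: H; rewrite centerE; lra.
  - by exfalso; case: H; rewrite centerE; lra.
exists (perm om_inj); split.
  apply/permP => j; rewrite -[j](permKV (perm om_inj)); set i := ((perm om_inj)^-1)%g j.
  by rewrite permJ !permE; have /(congr1 fst) /= := cS 0 i.
apply/permP => j; rewrite -[j](permKV (perm om_inj)); set i := ((perm om_inj)^-1)%g j.
by rewrite permJ !permE; have /(congr1 fst) /= := cS 1 i.
Qed.

End Rigidity.

(** * Codes *)

Section CodeAlong.
Variables (R : realType) (n : nat).
Notation pl := 'cV[R]_2.
Implicit Types (s t w : 'S_n).

(* [on_left] and [is_codeL] with an arbitrary transversal direction m in place of the left
   normal of v: unlike orthogonality, this makes sense after applying a matrix. *)
Definition on_left_along s t (C : set (tiled_space R s t)) (v m : pl) (L : R)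
    (beta : R -> tiled_space R s t) : Prop :=
  exists2 e : R, 0 < e & exists Phi : R * R -> tiled_space R s t,
    [/\ {within `[0, L] `*` `[0, e[, continuous Phi},
        forall x : R, 0 <= x <= L -> Phi (x, 0) = beta x,
        forall x y : R, 0 < x < L -> 0 < y < e -> C (Phi (x, y)) &
        forall x y : R, 0 < x < L -> 0 < y < e ->
          straight (fun z : R * R => z.1 *: v + z.2 *: m) Phi (x, y)].

Definition code_along s t (v m : pl) w : Prop :=
  exists gamma : 'I_n -> R -> tiled_space R s t,
    (forall j, saddle_connection v j (gamma j)) /\
    forall i, exists C, [/\ cylinder gamma C, on_left_along C v m 1 (gamma i),
      on_left_along C v m 1 (gamma (w i)) &
      exists beta, [/\ on_left_along C v m 2 beta,
        forall x : R, 0 <= x <= 1 -> beta x = gamma i x &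
        forall x : R, 0 <= x <= 1 -> beta (1 + x) = gamma (w i) x]].

Lemma is_codeLE s t (v : 'cV[int]_2) w : is_codeL R s t v w =
  code_along s t (map_mx intr v) (left_normal (map_mx intr v)) w.
Proof. by []. Qed.

Lemma straight_eq s t (T : topologicalType) (d d' : T -> pl) (c : T -> tiled_space R s t) x :
  (forall y, d y - d x = d' y - d' x) -> straight d c x -> straight d' c x.
Proof. by move=> e h U f cU Ux; apply: filterS (h U f cU Ux) => y ->. Qed.

Lemma straight_comp s t (S T : topologicalType) (d : T -> pl) (c : T -> tiled_space R s t)
    (f : S -> T) x : {for x, continuous f} -> straight d c (f x) ->
  straight (d \o f) (c \o f) x.
Proof. by move=> fC h U g cU Ux; exact: fC _ (h U g cU Ux). Qed.

Lemma connected_component_homeo (S T : topologicalType) (h : S -> T) (g : T -> S)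
    (D : set S) x : continuous h -> continuous g -> cancel h g -> cancel g h -> D x ->
  connected_component (h @` D) (h x) = h @` connected_component D x.
Proof.
have sub (S' T' : topologicalType) (f : S' -> T') (A : set S') y : continuous f -> A y ->
    f @` connected_component A y `<=` connected_component (f @` A) (f y).
  move=> fC Ay; apply: connected_component_max.
  - by exists y => //; exact: connected_component_refl.
  - by move=> _ [z hz <-]; exists z => //; exact: connected_component_sub hz.
  - apply: connected_continuous_connected; last exact: continuous_subspaceT.
    exact: component_connected.
move=> hC gC hg gh Dx; rewrite eqEsubset; split; last exact: sub.
move=> y hy; exists (g y); last exact: gh.
have : (g @` connected_component (h @` D) (h x)) (g y) by exists y.
move=> /(sub _ _ _ _ _ gC (ex_intro2 _ _ _ Dx erefl)).
rewrite hg; congr (connected_component _ _ _).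
rewrite eqEsubset; split=> [_ [_ [z Dz <-] <-]|z Dz]; first by rewrite hg.
by exists (h z); [exists z|rewrite hg].
Qed.

Lemma near_rectangle (L e x y : R) : 0 < x < L -> 0 < y < e ->
  \forall z \near (x, y), (`[0, L] `*` `[0, e[)%classic z.
Proof.
move=> hx hy; have h1 := near_itv hx.
have h2 : \forall z \near y, z \in `]0, e[ by apply: near_in_itvoo; rewrite in_itv.
exists ([set z | 0 <= z <= L], [set z | z \in `]0, e[]) => //= -[z z'] [/= zL].
by rewrite !in_itv /= zL => /andP[/ltW -> ->].
Qed.

Lemma within_interior (S T : topologicalType) (D : set S) (c : S -> T) x :
  {within D, continuous c} -> (\forall y \near x, D y) -> {for x, continuous c}.
Proof.
move=> /within_nearP cC nD N nN.
have h := cC x N (nbhs_singleton nD) nN.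
by apply: (@filterS2 _ (nbhs x) _ _ _ _ _ nD h) => y Dy; exact.
Qed.

Section Transport.
Variables (s1 t1 s t : 'S_n) (A : 'M[R]_2) (h : tiled_space R s1 t1 -> tiled_space R s t).
Hypothesis ah : affine A h.

Lemma on_left_transport C (v m : pl) L beta : on_left_along C v m L beta ->
  on_left_along (h @` C) (A *m v) (A *m m) L (h \o beta).
Proof.
have hC := affine_continuous ah.
move=> [e e0 [Phi [PC P0 PiC Ps]]]; exists e => //; exists (h \o Phi); split.
- apply/within_nearP => z N Dz nN.
  exact: (within_nearP _ _).1 PC z _ Dz (hC _ _ nN).
- by move=> x hx /=; rewrite P0.
- by move=> x y hx hy; exists (Phi (x, y)) => //; exact: PiC.
- move=> x y hx hy.
  have PhiC : {for (x, y), continuous Phi}.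
    exact: within_interior PC (near_rectangle hx hy).
  apply: straight_eq (straight_affine ah PhiC (Ps x y hx hy)) => z.
  by rewrite !mulmxDr -!scalemxAr.
Qed.

(** The label of a saddle connection only prescribes an initial segment, so the labels on the two
    sides need to be compared only near the corner. *)
Lemma saddle_transport (v : pl) j gamma :
  (exists2 e, 0 < e & forall x : R, 0 <= x <= e -> [/\ unit_square (x *: v),
     unit_square (x *: (A *m v)) & h (plot s1 t1 j (x *: v)) = plot s t j (x *: (A *m v))]) ->
  saddle_connection v j gamma -> saddle_connection (A *m v) j (h \o gamma).
Proof.
have hC := affine_continuous ah.
move=> [e e0 he] [gC [e' e'0 ge] gs]; split.
- apply/within_nearP => z N Dz nN.
  exact: (within_nearP _ _).1 gC z _ Dz (hC _ _ nN).
- exists (Num.min e e'); first by rewrite lt_min e0.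
  move=> x /andP[x0]; rewrite le_min => /andP[xe xe'].
  have [|u1 u2 hx] := he x; first by rewrite x0.
  have [|z zE gx] := ge x; first by rewrite x0.
  exists (sq (x *: (A *m v))); first by rewrite /= clamp_id.
  by rewrite /= gx -plot_val zE hx.
- move=> x hx.
  have gCx : {for x, continuous gamma}.
    apply: within_interior gC _; apply: filterS (near_itv hx) => y hy.
    by rewrite /= in_itv.
  apply: straight_eq (straight_affine ah gCx (gs x hx)) => y.
  by rewrite -!scalemxAr.
Qed.

Lemma code_transport (v m : pl) w :
  (forall j, exists2 e, 0 < e & forall x : R, 0 <= x <= e -> [/\ unit_square (x *: v),
     unit_square (x *: (A *m v)) & h (plot s1 t1 j (x *: v)) = plot s t j (x *: (A *m v))]) ->
  code_along s1 t1 v m w -> code_along s t (A *m v) (A *m m) w.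
Proof.
move=> lab [gamma [gs gn]]; exists (fun j => h \o gamma j); split.
  by move=> j; exact: saddle_transport.
move=> i; have [C [cC l1 l2 [beta [l3 b1 b2]]]] := gn i.
exists (h @` C); split; try exact: on_left_transport.
- have [[g [hC gC hg gh]] _ _] := ah.
  have [x Dx ->] := cC.
  have DE : h @` (~` \bigcup_j (gamma j @` `[0, 1])) =
      ~` \bigcup_j ((h \o gamma j) @` `[0, 1]).
    rewrite eqEsubset; split.
      move=> _ [p Dp <-] [j _ [y hy /= /(can_inj hg) e]]; apply: Dp; exists j => //.
      by exists y.
    move=> p Dp; exists (g p); last exact: gh.
    move=> [j _ [y hy e]]; apply: Dp; exists j => //; exists y => //.
    by rewrite /= e gh.
  exists (h x); first by rewrite -DE; exists x.
  by rewrite -DE (connected_component_homeo hC gC hg gh).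
- exists (h \o beta); split; first exact: on_left_transport.
    by move=> x hx /=; rewrite b1.
  by move=> x hx /=; rewrite b2.
Qed.

End Transport.

End CodeAlong.

(** * Existence and uniqueness of the code of the horizontal direction *)

Section HorizontalCode.
Variables (R : realType) (n : nat) (s t : 'S_n).
Notation pl := 'cV[R]_2.
Notation X := (tiled_space R s t).
Notation plot := (plot s t).
Notation e0 := (unitv R 0).
Variable m : pl.
Hypothesis m1 : 0 < m 1 0.

Lemma scale_e0E (x : R) : (x *: e0) 0 0 = x /\ (x *: e0) 1 0 = 0.
Proof. by rewrite !mxE /=; split; ring. Qed.

Lemma e0mE (x y : R) : (x *: e0 + y *: m) 0 0 = x + y * m 0 0 /\
  (x *: e0 + y *: m) 1 0 = y * m 1 0.
Proof. by rewrite !mxE /=; split; ring. Qed.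

Lemma scale_e0_unit (x : R) : 0 <= x <= 1 -> unit_square (x *: e0).
Proof.
move=> hx k; have [h0 h1] := scale_e0E x.
by case: (ord2P k) => ->; rewrite ?h0 ?h1 ?lexx ?ler01.
Qed.

Lemma scale_e0_continuous : continuous (fun x : R => x *: e0 : pl).
Proof.
have -> : (fun x : R => x *: e0 : pl) = (fun x : R => 0 + x *: e0).
  by apply/funext => x; rewrite add0r.
exact: segment_continuous.
Qed.

Definition bottom_side i (x : R) : X := plot i (x *: e0).

Lemma bottom_side_continuous i : continuous (bottom_side i).
Proof.
by move=> x; apply: (@continuous_comp _ _ _ (fun x : R => x *: e0 : pl));
  [exact: scale_e0_continuous|exact: plot_continuous].
Qed.

Lemma bottom_side_regular i (x : R) : 0 < x < 1 -> ~ tiled_zeros (bottom_side i x).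
Proof.
move=> /andP[x0 x1]; have [h0 _] := scale_e0E x.
apply: (@noncorner_regular R n s t i (x *: e0) 0).
- by apply: scale_e0_unit; rewrite !ltW.
- by rewrite h0 gt_eqF.
- by rewrite h0 lt_eqF.
Qed.

Lemma bottom_side_straight i (x : R) : 0 < x < 1 ->
  straight (fun y : R => y *: e0) (bottom_side i) x.
Proof.
move=> hx; apply: (@strip_straight R n s t 0 R (fun x : R => x *: e0) _ 0 i).
- exact: scale_e0_continuous.
- apply: filterS (near_itv hx) => y hy; have [h0 h1] := scale_e0E y.
  split; first by rewrite h0.
  by move=> l; case: (ord2P l) => ->; rewrite ?h1 ?lexx ?ler01.
- by [].
Qed.

Lemma bottom_side_saddle i : saddle_connection e0 i (bottom_side i).
Proof.
split.
- exact: continuous_subspaceT (@bottom_side_continuous i).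
- exists 1 => // x hx; exists (sq (x *: e0)); last by [].
  by rewrite /= clamp_id //; exact: scale_e0_unit.
- exact: bottom_side_straight.
Qed.

(** Four squares starting one to the left of Q_i: a thin parallelogram over two bottom sides leans
    by less than 1 to either side, so its abscissas stay between -1 and 3. *)
Definition square_row i (u : pl) : X := strip s t 0 3 (s^-1 i)%g (u + e0).

Lemma square_rowE i (u : pl) : 0 <= u 0 0 -> square_row i u = strip s t 0 2 i u.
Proof.
move=> u0; rewrite /square_row strip_ge; last by rewrite add_unitvE eqxx lerDr.
by rewrite addrK /dir_perm /= permKV.
Qed.

Lemma square_row_bottom i (x : R) : 0 <= x <= 1 -> square_row i (x *: e0) = bottom_side i x.
Proof.
by move=> /andP[x0 x1]; have [h0 _] := scale_e0E x; rewrite square_rowE ?h0 // strip_le ?h0.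
Qed.

Lemma square_row_bottom1 i (x : R) : 0 <= x <= 1 -> square_row i ((1 + x) *: e0) = bottom_side
  (s i) x.
Proof.
move=> /andP[x0 x1]; have [h0 _] := scale_e0E (1 + x); have [h1 _] := scale_e0E x.
rewrite square_rowE ?h0 ?addr_ge0 // strip_ge ?h0 ?lerDl //.
have -> : (1 + x) *: e0 - unitv R 0 = x *: e0 by rewrite scalerDl scale1r addrC addKr.
by rewrite strip_le ?h1.
Qed.

Lemma square_row_continuous i : continuous (square_row i).
Proof.
move=> u; apply: (@continuous_comp _ _ _ (fun u : pl => u + e0)); last exact: strip_continuous.
by move=> N; exact: (cvgD (@cvg_id _ (nbhs u)) (cvg_cst e0)).
Qed.

Definition square_row_domain (u : pl) := -1 <= u 0 0 <= 3 /\ 0 <= u 1 0 <= 1.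

Lemma square_row_strip_domain u : square_row_domain u -> strip_domain 0 3 (u + e0).
Proof.
move=> [h0 h1]; split; first by rewrite add_unitvE /=; lra.
by move=> l; case: (ord2P l) => -> // _; rewrite add_unitvE /= addr0.
Qed.

Lemma square_row_offbottom i u : square_row_domain u -> 0 < u 1 0 < 1 ->
  (~` \bigcup_j (bottom_side j @` `[0, 1])) (square_row i u).
Proof.
move=> Du /andP[u0 u1] [j _ [x]]; rewrite /= in_itv /= => hx; rewrite /square_row.
have [l [w [uw -> wl]]] := strip_plot s t (s^-1 i)%g (square_row_strip_domain Du).
move=> e; have [_ h1] := scale_e0E x.
have w1 : w 1 0 = u 1 0 by rewrite wl // add_unitvE /= addr0.
have := plot_coord 1 (scale_e0_unit hx) uw e; rewrite h1 w1 => -[E|[_ E]|[/esym/eqP E _]].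
- by rewrite -E ltxx in u0.
- by rewrite E ltxx in u1.
- by rewrite oner_eq0 in E.
Qed.

Let c0 : pl := const_mx 2^-1.

Definition square_row_component i := connected_component (~` \bigcup_j (bottom_side j @` `[0,
  1])) (square_row i c0).

Lemma center_domain : square_row_domain c0 /\ 0 < c0 1 0 < 1.
Proof. by rewrite /square_row_domain !mxE; split; [split|]; lra. Qed.

(** The open row is convex in row coordinates, so a segment from the center of Q_i reaches each of
    its points while avoiding the bottom sides. *)
Lemma square_row_in_component i u : square_row_domain u -> 0 < u 1 0 < 1 -> square_row_component
  i (square_row i u).
Proof.
move=> Du u1; have [Dc c1] := center_domain.
have D1 x : 0 <= x <= 1 -> square_row_domain (c0 + x *: (u - c0)) /\
    0 < (c0 + x *: (u - c0)) 1 0 < 1.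
  move=> /andP[x0 x1]; move: Du => [/andP[? ?] _]; move: u1 => /andP[? ?].
  rewrite /square_row_domain !mxE.
  by split; [split|]; apply/andP; split; nra.
pose B := (fun x : R => square_row i (c0 + x *: (u - c0))) @` `[0, 1].
have : B `<=` square_row_component i.
  apply: connected_component_max.
  - by exists 0; rewrite ?scale0r ?addr0 //= in_itv /= lexx ler01.
  - move=> _ [x + <-]; rewrite /= in_itv /= => /D1 [].
    exact: square_row_offbottom.
  - apply: connected_continuous_connected; first exact: segment_connected.
    apply: continuous_subspaceT => x.
    apply: (@continuous_comp _ _ _ (fun x : R => c0 + x *: (u - c0)) (square_row i)).
      exact: segment_continuous.
    exact: square_row_continuous.
apply; exists 1; first by rewrite /= in_itv /= lexx ler01.
by rewrite scale1r addrC subrK.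
Qed.

Lemma square_row_on_left i (a L : R) beta : 0 <= a -> a + L <= 2 ->
  (forall x, 0 <= x <= L -> beta x = square_row i ((a + x) *: e0)) ->
  on_left_along (square_row_component i) e0 m L beta.
Proof.
move=> a0 aL hb.
(* The inverse of this number is the height of the parallelogram: below it both the lean [y * m 0 0]
   and the rise [y * m 1 0] are less than 1 in absolute value. *)
have d0 : 0 < 1 + `|m 0 0| + m 1 0 by rewrite addr_gt0 // ltr_pwDl.
pose g (z : R * R) : pl := (a *: e0) + (z.1 *: e0 + z.2 *: m).
have g0 z : g z 0 0 = a + z.1 + z.2 * m 0 0.
  by rewrite [LHS]mxE (scale_e0E a).1 (e0mE z.1 z.2).1; ring.
have g1 z : g z 1 0 = z.2 * m 1 0.
  by rewrite [LHS]mxE (scale_e0E a).2 (e0mE z.1 z.2).2; ring.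
have gC : continuous g.
  move=> z; apply: (cvgD (cvg_cst _)).
  apply: cvgD; apply: cvgZ; (try exact: cvg_cst); [exact: cvg_fst|exact: cvg_snd].
have gD (x y : R) : 0 <= x <= L -> 0 <= y < (1 + `|m 0 0| + m 1 0)^-1 ->
    square_row_domain (g (x, y)) /\ y * m 1 0 < 1.
  move=> /andP[x0 xL] /andP[y0]; rewrite -div1r ltr_pdivlMr // => ye.
  have ym : - (y * `|m 0 0|) <= y * m 0 0 <= y * `|m 0 0|.
    by rewrite -mulrN !ler_wpM2l // ?ler_norm // lerNl -normrN ler_norm.
  have h1 : 0 <= y * `|m 0 0| by rewrite mulr_ge0.
  have h2 : 0 <= y * m 1 0 by rewrite mulr_ge0 // ltW.
  by rewrite /square_row_domain g0 g1 /=; split; [split|]; lra.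
exists (1 + `|m 0 0| + m 1 0)^-1; first by rewrite invr_gt0.
exists (square_row i \o g); split.
- apply: continuous_subspaceT => z; apply: continuous_comp; first exact: gC.
  exact: square_row_continuous.
- by move=> x hx; rewrite hb //= /g /= scale0r addr0 -scalerDl.
- move=> x y /andP[x0 xL] /andP[y0 ye]; have [||Dg yg] := gD x y.
  + by rewrite !ltW.
  + by rewrite ltW.
  + by apply: square_row_in_component => //; rewrite g1 yg andbT mulr_gt0.
- move=> x y hx hy.
  have := @strip_straight R n s t 0 _ (fun z => g z + e0) (fun z : R * R => z.1 *: e0 + z.2 *: m)
     3 (s^-1 i)%g (x, y).
  apply.
  + by apply: (cvgD _ (cvg_cst _)); exact: gC.
  + apply: filterS (near_rectangle hx hy) => -[x' y'] [/=]; rewrite !in_itv /= => h1 h2.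
    by apply: square_row_strip_domain; have [] := gD x' y' h1 h2.
  + by move=> z; rewrite opprD addrACA subrr addr0 /g opprD addrACA subrr add0r.
Qed.

Lemma horizontal_code : code_along s t e0 m s.
Proof.
exists bottom_side; split; first exact: bottom_side_saddle.
move=> i; exists (square_row_component i); split.
- exists (square_row i c0) => //; have [D1 D2] := center_domain; exact: square_row_offbottom.
- apply: (@square_row_on_left i 0) => //; first by rewrite add0r; lra.
  by move=> x hx; rewrite add0r square_row_bottom.
- apply: (@square_row_on_left i 1) => //.
  by move=> x hx; rewrite square_row_bottom1.
- exists (fun x => square_row i (x *: e0)); split.
  + by apply: (@square_row_on_left i 0) => // [|x _]; rewrite add0r.
  + by move=> x hx; rewrite square_row_bottom.
  + by move=> x hx; rewrite square_row_bottom1.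
Qed.

End HorizontalCode.

Section HorizontalCodeUnique.
Variables (R : realType) (n : nat) (s t : 'S_n).
Notation pl := 'cV[R]_2.
Notation X := (tiled_space R s t).
Notation plot := (plot s t).
Notation e0 := (unitv R 0).
Notation bottom_side := (bottom_side s t).

Lemma pair_continuous (x0 : R) : continuous (fun y : R => (x0, y)).
Proof. by move=> y; exact: (@cvg_pair _ _ _ (nbhs y) _ _ _ _ _ _ _ (cvg_cst x0) (@cvg_id _ (nbhs
  y))). Qed.

Lemma pair_continuous' (y0 : R) : continuous (fun x : R => (x, y0)).
Proof. by move=> y; exact: (@cvg_pair _ _ _ (nbhs y) _ _ _ _ _ _ _ (@cvg_id _ (nbhs y)) (cvg_cst
  y0)). Qed.

Lemma within_comp (S T U : topologicalType) (D : set S) (E : set T) (f : S -> T) (c : T -> U) :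
  continuous f -> (forall x, D x -> E (f x)) -> {within E, continuous c} ->
  {within D, continuous c \o f}.
Proof.
move=> fC DE /within_nearP cC; apply/within_nearP => x N Dx nN.
have := fC x _ (cC _ _ (DE _ Dx) nN).
by apply: (@filterS _ (nbhs x)) => y /= h /DE.
Qed.

(** The starting corner may be a zero, where straight paths branch. Up to e the label decides;
    uniqueness of straight paths takes over from e on, in the interior of the side. *)
Lemma saddle_bottom j (gamma : R -> X) x : saddle_connection e0 j gamma -> 0 <= x < 1 ->
  gamma x = bottom_side j x.
Proof.
move=> [gC [e epos ge] gs] /andP[x0 x1].
have start y : 0 <= y <= e -> gamma y = bottom_side j y.
  by move=> hy; have [z zE ->] := ge y hy; rewrite -plot_val zE.
have [xe|/ltW ex] := leP x e; first by apply: start; rewrite x0.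
have sub : `[e, x]%classic `<=` `[0, 1]%classic.
  move=> z; rewrite /= !in_itv /= => /andP[z1 z2].
  by rewrite (le_trans (ltW epos) z1) (le_trans z2 (ltW x1)).
have sub' z : e < z < x -> 0 < z < 1.
  by move=> /andP[z1 z2]; rewrite (lt_trans epos z1) (lt_trans z2 x1).
symmetry; apply: (@path_unique R n s t (bottom_side j) gamma e0 e x).
- exact: continuous_subspaceT (@bottom_side_continuous R n s t j).
- exact: continuous_subspaceW sub gC.
- by move=> z /sub'; exact: bottom_side_straight.
- by move=> z /sub'; exact: gs.
- move=> z /andP[z1 z2]; apply: bottom_side_regular.
  by rewrite (lt_le_trans epos z1) (lt_trans z2 x1).
- by rewrite start // lexx ltW.
- by rewrite ex lexx.
Qed.

Variable m : pl.
Hypothesis m1 : 0 < m 1 0.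

Lemma transversal_continuous i (a : pl) : continuous (fun y : R => plot i (a + y *: m)).
Proof.
move=> y; apply: (@continuous_comp _ _ _ (fun y : R => a + y *: m)); last exact: plot_continuous.
exact: segment_continuous.
Qed.

Lemma transversal_straight i (a v : pl) (y : R) :
  (\forall z \near y, unit_square (a + z *: v)) ->
  straight (fun z : R => z *: v) (fun z : R => plot i (a + z *: v)) y.
Proof.
move=> h; apply: (@strip_straight R n s t 0 R (fun z : R => a + z *: v) _ 0 i).
- exact: segment_continuous.
- apply: filterS h => z uz; split; first exact: uz.
  by move=> l _; exact: uz.
- by move=> z; rewrite opprD addrACA subrr add0r.
Qed.

(** Between the two saddle connections the boundary walk meets a corner that may be a zero, so it is
    not determined by its first half. The midpoints of the two sides are instead joined through C,
    which contains no zeros. *)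
Lemma horizontal_code_unique w : code_along s t e0 m w -> w = s.
Proof.
move=> [gamma [gs gn]]; apply/permP => i.
have [C [[p0 Dp0 CE] _ _ [beta [[e epos [Phi [PC P0 PiC Ps]]] b1 b2]]]] := gn i.
have CD : C `<=` ~` \bigcup_j (gamma j @` `[0, 1]) by rewrite CE; exact: connected_component_sub.
(* Every zero is the south-west corner of some square, hence the start of a saddle connection. *)
have Cr p : C p -> ~ tiled_zeros p.
  move=> /CD Dp /tiled_zerosP [j [_ [_ jp _]]]; apply: Dp; exists j => //; exists 0.
    by rewrite /= in_itv /= lexx ler01.
  by rewrite (saddle_bottom (gs j)) ?lexx ?ltr01 // /bottom_side scale0r.
(* Up to height 1 / M, the transversal from the midpoint of a bottom side moves by at most 1/4 in
   each coordinate and stays in the square; up to e / 2 it stays in the domain of [Phi]. *)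
pose M := 4 * (1 + `|m 0 0| + m 1 0).
have M0 : 0 < M by rewrite /M mulr_gt0 // addr_gt0 // ltr_pwDl.
pose y0 := Num.min (e / 2) M^-1.
have y00 : 0 < y0 by rewrite lt_min divr_gt0 //= invr_gt0.
have y0e : y0 < e by rewrite gt_min ltr_pdivrMr // ltr_pMr // ltr1n.
have bnd y : 0 <= y <= y0 -> -4^-1 <= y * m 0 0 <= 4^-1 /\ 0 <= y * m 1 0 <= 4^-1.
  move=> /andP[yp yy].
  have : y <= M^-1 by apply: le_trans yy _; rewrite ge_min lexx orbT.
  rewrite -div1r ler_pdivlMr // /M => yM.
  have ym : - (y * `|m 0 0|) <= y * m 0 0 <= y * `|m 0 0|.
    by rewrite -mulrN !ler_wpM2l // ?ler_norm // lerNl -normrN ler_norm.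
  have h1 : 0 <= y * `|m 0 0| by rewrite mulr_ge0.
  have h2 : 0 <= y * m 1 0 by rewrite mulr_ge0 // ltW.
  by split; lra.
have half : 0 < (2^-1 : R) < 1 by lra.
have half2 : 0 <= (2^-1 : R) <= 2 by lra.
have half3 : 0 <= (1 + 2^-1 : R) <= 2 by lra.
pose a : pl := 2^-1 *: e0.
have aE y : (a + y *: m) 0 0 = 2^-1 + y * m 0 0 /\ (a + y *: m) 1 0 = y * m 1 0.
  exact: e0mE.
have a_unit y : 0 <= y <= y0 -> unit_square (a + y *: m).
  move=> /bnd [h0 h1] k; have [a0 a1] := aE y.
  by case: (ord2P k) => ->; rewrite ?a0 ?a1; lra.
have a_reg j y : 0 <= y <= y0 -> ~ tiled_zeros (plot j (a + y *: m)).
  move=> hy; have [h0 _] := bnd y hy; have [a0 _] := aE y.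
  by apply: (@noncorner_regular R n s t j _ 0); [exact: a_unit|rewrite a0; apply/eqP; lra..].
have beta_i : beta 2^-1 = plot i a.
  by rewrite b1 ?(saddle_bottom (gs i)) //; lra.
have beta_w : beta (1 + 2^-1) = plot (w i) a.
  by rewrite b2 ?(saddle_bottom (gs (w i))) //; lra.
have PhiE (x y : R) : 0 <= x <= 2 -> 0 <= y <= y0 -> (`[0, 2] `*` `[0, e[)%classic (x, y).
  move=> hx /andP[hy yy]; split; rewrite /= in_itv //= hy /=.
  exact: le_lt_trans yy y0e.
(* Up from the midpoint of the bottom side of Q_i, ... *)
have E1 : Phi (2^-1, y0) = plot i (a + y0 *: m).
  symmetry; apply: (@path_unique R n s t (fun y : R => plot i (a + y *: m))
    (fun y : R => Phi (2^-1, y)) m 0 y0).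
  - exact: continuous_subspaceT (@transversal_continuous i a).
  - apply: (within_comp (@pair_continuous 2^-1) _ PC) => y hy.
    by apply: (PhiE _ _ half2); move: hy; rewrite /= in_itv.
  - move=> y hy; apply: transversal_straight; apply: filterS (near_itv hy) => z.
    exact: a_unit.
  - move=> y /andP[h1 h2]; have hy : 0 < y < e by rewrite h1 (lt_trans h2).
    apply: straight_eq (straight_comp (@pair_continuous 2^-1 y) (Ps _ _ _ hy)); last by lra.
    by move=> z /=; rewrite opprD addrACA subrr add0r.
  - by move=> y /andP[h1 h2]; apply: a_reg; rewrite h1 ltW.
  - by rewrite scale0r addr0 P0 ?beta_i //; lra.
  - by rewrite lexx ltW.
(* ... then to the right at height y0, ... *)
have yy0 : 0 <= y0 <= y0 by rewrite lexx ltW.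
have [bm0 bm1] := bnd _ yy0.
have ym1 : 0 < y0 * m 1 0 by rewrite mulr_gt0.
have E2 : Phi (1 + 2^-1, y0) = plot (s i) (a + y0 *: m).
  have := @path_unique R n s t (fun x : R => Phi (x, y0))
    (fun x : R => strip s t 0 1 i (y0 *: m + x *: e0)) e0 2^-1 (1 + 2^-1).
  have E3 x : y0 *: m + x *: e0 = x *: e0 + y0 *: m by rewrite addrC.
  move=> ->.
  - rewrite strip_ge; last by rewrite E3 (e0mE _ _ _).1; lra.
    rewrite strip_le; last by rewrite sub_unitvE E3 (e0mE _ _ _).1 /=; lra.
    have -> : y0 *: m + (1 + 2^-1) *: e0 - e0 = a + y0 *: m; last by [].
    by rewrite scalerDl scale1r [e0 + _]addrC addrA addrK addrC.
  - apply: (within_comp (@pair_continuous' y0) _ PC) => x hx.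
    by apply: PhiE; [move: hx; rewrite set_itvE /= => hx; lra|rewrite lexx ltW].
  - apply: continuous_subspaceT => x.
    apply: (@continuous_comp _ _ _ (fun x : R => y0 *: m + x *: e0));
      last exact: strip_continuous.
    exact: segment_continuous.
  - move=> x hx; have hx' : 0 < x < 2 by lra.
    have hy : 0 < y0 < e by rewrite y00.
    apply: straight_eq (straight_comp (@pair_continuous' y0 x) (Ps _ _ hx' hy)).
    by move=> z /=; rewrite opprD addrACA subrr addr0.
  - move=> x hx; apply: (@strip_straight R n s t 0 R (fun x : R => y0 *: m + x *: e0)).
    + exact: segment_continuous.
    + apply: filterS (near_itv hx) => z hz; rewrite E3; have [q0 q1] := e0mE m z y0.
      split; first by rewrite q0; lra.
      by move=> l; case: (ord2P l) => -> // _; rewrite q1; lra.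
    + by move=> z; rewrite opprD addrACA subrr add0r.
  - move=> x hx; apply: Cr; apply: PiC; first by lra.
    by rewrite y00.
  - rewrite E1 strip_le; last by rewrite E3 (e0mE _ _ _).1; lra.
    by rewrite addrC.
  - by lra.
(* ... and down to the boundary. *)
have E3 : Phi (1 + 2^-1, 0) = plot (s i) a.
  have := @path_unique R n s t (fun y : R => plot (s i) ((a + y0 *: m) + y *: - m))
    (fun y : R => Phi (1 + 2^-1, y0 - y)) (- m) 0 y0.
  have F y : (a + y0 *: m) + y *: - m = a + (y0 - y) *: m.
    by rewrite scalerN scalerBl addrA.
  have sub_continuous' : continuous (fun y : R => y0 - y).
    by move=> y; apply: cvgB; [exact: cvg_cst|exact: cvg_id].
  have pC : continuous (fun y : R => (1 + 2^-1 : R, y0 - y)).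
    move=> y; apply: (@continuous_comp _ _ _ (fun y : R => y0 - y)); first exact: sub_continuous'.
    exact: pair_continuous.
  move=> H.
  suff : plot (s i) ((a + y0 *: m) + y0 *: - m) = Phi (1 + 2^-1, y0 - y0).
    by rewrite F subrr scale0r addr0.
  apply: H.
  - apply: continuous_subspaceT => y.
    apply: (@continuous_comp _ _ _ (fun y : R => (a + y0 *: m) + y *: - m));
      last exact: plot_continuous.
    exact: segment_continuous.
  - apply: (within_comp pC _ PC) => y hy.
    apply: (PhiE _ _ half3); move: hy; rewrite /= in_itv /= => /andP[h1 h2].
    by rewrite subr_ge0 h2 lerBlDr lerDl.
  - move=> y hy; apply: transversal_straight; apply: filterS (near_itv hy) => z /andP[h1 h2].
    by rewrite F; apply: a_unit; rewrite subr_ge0 h2 lerBlDr lerDl.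
  - move=> y /andP[h1 h2].
    have hy : 0 < y0 - y < e by rewrite subr_gt0 h2 (lt_trans _ y0e) // ltrBlDr ltrDl.
    have hx : 0 < (1 + 2^-1 : R) < 2 by lra.
    apply: straight_eq (straight_comp (pC y) (Ps _ _ hx hy)).
    move=> z /=; rewrite opprD addrACA subrr add0r -!scalerBl !scalerN -scaleNr; congr (_ *: _).
    by ring.
  - move=> y /andP[h1 h2]; rewrite F; apply: a_reg.
    by rewrite subr_ge0 ltW // lerBlDr lerDl.
  - by rewrite scale0r addr0 subr0 E2.
  - by rewrite lexx ltW.
have E4 : plot (w i) a = plot (s i) a.
  by rewrite -beta_w -E3 P0 //; lra.
have a_unit0 : unit_square a by apply: scale_e0_unit; lra.
have a1 k : a k 0 < 1.
  have [h0 h1] := scale_e0E (2^-1 : R).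
  by case: (ord2P k) => ->; rewrite /a ?h0 ?h1 ?ltr01 //; case/andP: half.
have := half_open_unique (bottom_side_regular (s := s) (t := t) (i := w i) half)
  a_unit0 a_unit0 a1 a1 erefl (esym E4).
by case.
Qed.

End HorizontalCodeUnique.

(** * Generators of SL_2(Z) *)

Section Generation.
Implicit Types (A B : 'M[int]_2) (Q : 'M[int]_2 -> Prop).

(** The inverse of the shear: with N the nilpotent part, (1 + N)^-1 = 1 - N = 2 - (1 + N). *)
Definition shearV_mx (k : 'I_2) : 'M[int]_2 := 2%:M - shear_mx k.

Lemma mx2P (T : Type) (A B : 'M[T]_2) :
  A 0 0 = B 0 0 -> A 0 1 = B 0 1 -> A 1 0 = B 1 0 -> A 1 1 = B 1 1 -> A = B.
Proof.
by move=> ? ? ? ?; apply/matrixP => i j; case: (ord2P i) (ord2P j) => -> [] ->.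
Qed.

Lemma det_mx22 A : \det A = A 0 0 * A 1 1 - A 1 0 * A 0 1.
Proof.
rewrite (expand_det_row _ 0) !big_ord_recl big_ord0 addr0 /cofactor !det_mx11 !mxE /=.
rewrite lift01 expr0 expr1 mul1r mulN1r mulrN [A 1 0 * _]mulrC.
by congr (A _ _ * A _ _ - A _ _ * A _ _); exact/val_inj.
Qed.

Lemma mulmx_shear A k i j :
  (A *m shear_mx k) i j = if j == k then A i j else A i j + A i k.
Proof.
rewrite mxE !big_ord_recl big_ord0 addr0 lift01 !mxE.
by case: (ord2P j) (ord2P k) => -> [] -> /=; ring.
Qed.

Lemma mulmx_shearV A k i j :
  (A *m shearV_mx k) i j = if j == k then A i j else A i j - A i k.
Proof.
rewrite mxE !big_ord_recl big_ord0 addr0 lift01 !mxE.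
by case: (ord2P j) (ord2P k) => -> [] -> /=; ring.
Qed.

Lemma mulmx_shearK A k : A *m shear_mx k *m shearV_mx k = A.
Proof.
apply/matrixP => i j; rewrite mulmx_shearV !mulmx_shear eqxx.
by have [//|_] := eqVneq j k; rewrite addrK.
Qed.

Lemma mulmx_shearVK A k : A *m shearV_mx k *m shear_mx k = A.
Proof.
apply/matrixP => i j; rewrite mulmx_shear !mulmx_shearV eqxx.
by have [//|_] := eqVneq j k; rewrite subrK.
Qed.

Lemma det_shear k : \det (shear_mx k) = 1.
Proof. by rewrite det_mx22 !mxE; case: (ord2P k) => ->. Qed.

Lemma det_shearV k : \det (shearV_mx k) = 1.
Proof. by rewrite det_mx22 !mxE; case: (ord2P k) => ->. Qed.

Lemma SL2Z1 : SL2Z 1%:M. Proof. exact: det1. Qed.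

Lemma SL2ZM A B : SL2Z A -> SL2Z B -> SL2Z (A *m B).
Proof. by rewrite /SL2Z /= det_mulmx => -> ->. Qed.

(** Determinant 1 forces one column to dominate the other entrywise, unless A is the identity.
    Subtracting the smaller column keeps the entries nonnegative and lowers their sum. *)
Lemma SL2Zplus_ind Q : Q 1%:M ->
  (forall A k, SL2Zplus A -> Q A -> Q (A *m shear_mx k)) -> forall A, SL2Zplus A -> Q A.
Proof.
move=> Q1 QM A; pose mu B := absz (B 0 0 + B 0 1 + B 1 0 + B 1 1).
move: {2}(mu A).+1 (ltnSn (mu A)) => N; elim: N A => // N IH A AN [dA A0].
have step k : (forall i j, 0 <= (A *m shearV_mx k) i j) -> Q A.
  move=> h; rewrite -(mulmx_shearVK A k); have SA : SL2Zplus (A *m shearV_mx k).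
    by split=> //; exact: SL2ZM dA (det_shearV k).
  apply: QM => //; apply: IH => //; move: AN.
  have := A0 0 0; have := A0 0 1; have := A0 1 0; have := A0 1 1.
  have := h 0 0; have := h 0 1; have := h 1 0; have := h 1 1.
  move: dA; rewrite /SL2Z /mu /= det_mx22 !mulmx_shearV.
  case: (ord2P k) => -> /=; move: (A 0 0) (A 0 1) (A 1 0) (A 1 1) => a c b d; nia.
have [ac|ac] := leP (A 0 0) (A 0 1);
  [have [bd|bd] := leP (A 1 0) (A 1 1)|have [bd|bd] := leP (A 1 1) (A 1 0)].
- apply: (step 0) => i j; rewrite mulmx_shearV.
  by case: (ord2P i) (ord2P j) => -> [] -> //=; rewrite subr_ge0.
- move: dA (A0 0 0) (A0 0 1) (A0 1 0) (A0 1 1); rewrite /SL2Z /= det_mx22.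
  move: (A 0 0) (A 0 1) (A 1 0) (A 1 1) ac bd => a c b d *; nia.
- have ac' := ltW ac; apply: (step 1) => i j; rewrite mulmx_shearV.
  by case: (ord2P i) (ord2P j) => -> [] -> //=; rewrite subr_ge0.
- suff -> : A = 1%:M by [].
  move: dA (A0 0 0) (A0 0 1) (A0 1 0) (A0 1 1); rewrite /SL2Z /= det_mx22.
  suff H (a c b d : int) : c < a -> b < d -> a * d - b * c = 1 -> 0 <= a -> 0 <= c ->
      0 <= b -> 0 <= d -> [/\ a = 1, c = 0, b = 0 & d = 1].
    by move=> d1 a0 c0 b0 d0; have [*] := H _ _ _ _ ac bd d1 a0 c0 b0 d0;
      apply: mx2P; rewrite !mxE.
  move=> ca bd' e a0 c0 b0 d0.
  (* Together with a * d = b * c + 1 this gives b + c <= 0. *)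
  have h : (c + 1) * (b + 1) <= a * d by apply: ler_pM; lia.
  have cb : c = 0 /\ b = 0 by nia.
  by case: cb e => -> ->; split; nia.
Qed.

Lemma absz_sub_lt (c d : int) : c != 0 -> d != 0 -> (absz c <= absz d)%N -> 0 <= c * d ->
  (absz (d - c)%R < absz d)%N.
Proof.
move=> c0 d0 cd sg.
have [[h1 h2]|[h1 h2]] : (0 < c /\ 0 < d) \/ (c < 0 /\ d < 0) by nia.
  lia.
lia.
Qed.

Lemma absz_add_lt (c d : int) : c != 0 -> d != 0 -> (absz c <= absz d)%N -> c * d < 0 ->
  (absz (d + c)%R < absz d)%N.
Proof.
move=> c0 d0 cd sg.
have [[h1 h2]|[h1 h2]] : (0 < c /\ d < 0) \/ (c < 0 /\ 0 < d) by nia.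
  lia.
lia.
Qed.

(** The quarter turn with rows (0, 1) and (-1, 0), as a word in the shears; on the right it
    exchanges the columns up to a sign. *)
Definition quarter_mx : 'M[int]_2 := shear_mx 0 *m shearV_mx 1 *m shear_mx 0.

Lemma mulmx_quarter A i :
  (A *m quarter_mx) i 0 = - A i 1 /\ (A *m quarter_mx) i 1 = A i 0.
Proof.
by rewrite /quarter_mx !mulmxA !(mulmx_shear, mulmx_shearV) /=; split; ring.
Qed.

(** Euclid's algorithm on the bottom row, by column operations, until one of its entries vanishes. A
    quarter turn puts the zero on the left, and the matrix is then unipotent up to a sign. *)
Lemma SL2Z_ind Q : Q 1%:M ->
  (forall A k, SL2Z A -> Q A -> Q (A *m shear_mx k)) ->
  (forall A k, SL2Z A -> Q A -> Q (A *m shearV_mx k)) -> forall A, SL2Z A -> Q A.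
Proof.
move=> Q1 QS QV.
have SS A k : SL2Z A -> SL2Z (A *m shear_mx k) by move=> /SL2ZM; apply; exact: det_shear.
have SV A k : SL2Z A -> SL2Z (A *m shearV_mx k) by move=> /SL2ZM; apply; exact: det_shearV.
(* Q passes through both a shear and its inverse, so it may be tested after multiplication by
   either. *)
have Qs A k : SL2Z A -> Q (A *m shear_mx k) -> Q A.
  by move=> SA /(QV _ k (SS A k SA)); rewrite mulmx_shearK.
have Qv A k : SL2Z A -> Q (A *m shearV_mx k) -> Q A.
  by move=> SA /(QS _ k (SV A k SA)); rewrite mulmx_shearVK.
have Qq A : SL2Z A -> Q (A *m quarter_mx) -> Q A.
  move=> SA; rewrite /quarter_mx !mulmxA => /Qs h.
  by apply/(Qs A 0)/(Qv _ 1) => //; [exact: SS|apply: h; exact/SV/SS].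
have Sq A : SL2Z A -> SL2Z (A *m quarter_mx).
  by move=> SA; rewrite /quarter_mx !mulmxA; exact/SS/SV/SS.
have Qu : forall A, SL2Z A -> A 1 0 = 0 -> A 1 1 = 1 -> Q A.
  move=> A; move: {2}(absz (A 0 1)).+1 (ltnSn (absz (A 0 1))) => N;
    elim: N A => // N IH A AN SA c0 d1.
  have a1 : A 0 0 = 1 by have := SA; rewrite /SL2Z /= det_mx22 c0 d1; lia.
  have [b|b|b] := ltgtP (A 0 1) 0.
  - apply: (Qs A 0) => //; apply: IH; rewrite ?mulmx_shear //=; [lia|exact: SS|by rewrite c0 d1].
  - apply: (Qv A 0) => //; apply: IH; rewrite ?mulmx_shearV //=; [lia|exact: SV|by rewrite c0 d1].
  - by suff -> : A = 1%:M by []; apply: mx2P; rewrite !mxE.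
have Q0 A : SL2Z A -> A 1 0 = 0 -> Q A.
  move=> SA c0; have dA := SA; rewrite /SL2Z /= det_mx22 c0 in dA.
  have : absz (A 0 0 * A 1 1) = 1%N by move: dA; rewrite mul0r subr0 => ->.
  rewrite abszM => /eqP; rewrite muln_eq1 => /andP[_ /eqP d1].
  have {d1}[d1|d1] : A 1 1 = 1 \/ A 1 1 = -1 by lia.
    exact: Qu.
  (* Two quarter turns multiply by -1, which makes the diagonal positive. *)
  apply/Qq/Qq => //; first exact: Sq.
  have [h0 h1] := mulmx_quarter (A *m quarter_mx) 1; have [g0 g1] := mulmx_quarter A 1.
  by apply: Qu; [exact/Sq/Sq|rewrite h0 g1 c0 oppr0|rewrite h1 g0 d1].
move=> A; pose mu B := addn (absz (B 1 0)) (absz (B 1 1)).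
move: {2}(mu A).+1 (ltnSn (mu A)) => N.
elim: N A => // N IH A AN SA.
have [c0|c0] := eqVneq (A 1 0) 0; first exact: Q0.
have [d0|d0] := eqVneq (A 1 1) 0.
  by apply: Qq => //; apply: Q0; [exact: Sq|rewrite (mulmx_quarter A 1).1 d0 oppr0].
have [cd|cd] := leqP (absz (A 1 0)) (absz (A 1 1)); have [sg|sg] := leP 0 (A 1 0 * A 1 1).
- apply: (Qv A 0) => //; apply: IH; last exact: SV.
  by have := absz_sub_lt c0 d0 cd sg; move: AN; rewrite /mu !mulmx_shearV /=; lia.
- apply: (Qs A 0) => //; apply: IH; last exact: SS.
  by have := absz_add_lt c0 d0 cd sg; move: AN; rewrite /mu !mulmx_shear /=; lia.
- rewrite mulrC in sg; apply: (Qv A 1) => //; apply: IH; last exact: SV.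
  by have := absz_sub_lt d0 c0 (ltnW cd) sg; move: AN; rewrite /mu !mulmx_shearV /=; lia.
- rewrite mulrC in sg; apply: (Qs A 1) => //; apply: IH; last exact: SS.
  by have := absz_add_lt d0 c0 (ltnW cd) sg; move: AN; rewrite /mu !mulmx_shear /=; lia.
Qed.

End Generation.

(** * Affine isomorphisms, labelled corners and codes *)

Section Main.
Variables (R : realType) (n : nat).
Notation pl := 'cV[R]_2.
Implicit Types (p q w : 'S_n * 'S_n) (A B : 'M[int]_2).
Notation surf p := (tiled_space R p.1 p.2).

Definition affine_iso A p q := exists h : surf p -> surf q, affine (intmx R A) h.

(* h is affine and carries the south-west corner of each Q_i to that of the square with
   the same label. *)
Definition corner_affine A p q (h : surf p -> surf q) := affine (intmx R A) h /\
  forall i, exists2 e : R, 0 < e <= 1 & forall u : pl, (forall k, 0 <= u k 0 <= e) ->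
    unit_square (intmx R A *m u) /\ h (plot p.1 p.2 i u) = plot q.1 q.2 i (intmx R A *m u).

Lemma intmxM A B : intmx R (A *m B) = intmx R A *m intmx R B.
Proof. exact: map_mxM. Qed.

Lemma intmx1 : intmx R 1%:M = 1%:M.
Proof. exact: map_mx1. Qed.

Lemma SL2Z_unit A : SL2Z A -> A \in unitmx.
Proof. by move=> dA; rewrite unitmxE dA unitr1. Qed.

Lemma SL2ZV A : SL2Z A -> SL2Z (invmx A).
Proof. by move=> dA; rewrite /SL2Z /= det_inv dA invr1. Qed.

Lemma intmxV A : SL2Z A -> intmx R (invmx A) = invmx (intmx R A).
Proof.
move=> SA; have uA := SL2Z_unitmx R SA.
by rewrite -[LHS](mulKmx uA) -intmxM mulmxV ?SL2Z_unit // intmx1 mulmx1.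
Qed.

Lemma affine_iso1 p : affine_iso 1%:M p p.
Proof. by exists id; rewrite intmx1; exact: affine_id. Qed.

Lemma affine_isoM A B p q w : affine_iso A q w -> affine_iso B p q -> affine_iso (A *m B) p w.
Proof. by move=> [h ah] [g ag]; exists (h \o g); rewrite intmxM; exact: affine_comp. Qed.

Lemma affine_isoV A p q : SL2Z A -> affine_iso A p q -> affine_iso (invmx A) q p.
Proof.
move=> SA [h /(affine_inverse (SL2Z_unitmx R SA)) [g [ag _ _]]]; exists g.
by rewrite intmxV.
Qed.

Lemma affine_iso_conj p q : affine_iso 1%:M p q <-> exists om : 'S_n, q = ((p.1 ^ om)%g, (p.2 ^
  om)%g).
Proof.
split=> [[h]|[om ->]].
  rewrite intmx1 => /rigidity [om [e1 e2]]; exists om.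
  by rewrite [q]surjective_pairing e1 e2.
by have [h ah] := relabel_affine R p.1 p.2 om; exists h; rewrite intmx1.
Qed.

Lemma equiv_class_affine_iso p q : Defs.equiv_class p q <-> affine_iso 1%:M p q.
Proof. by rewrite affine_iso_conj; split=> [[om _ <-]|[om ->]]; exists om. Qed.

Lemma equiv_class_eq p q : affine_iso 1%:M p q -> Defs.equiv_class p = Defs.equiv_class q.
Proof.
move=> pq; have qp := affine_isoV SL2Z1 pq; rewrite invmx1 in qp.
rewrite eqEsubset; split=> w /equiv_class_affine_iso pw; apply/equiv_class_affine_iso.
  by rewrite -[1%:M]mulmx1; exact: affine_isoM pw qp.
by rewrite -[1%:M]mulmx1; exact: affine_isoM pw pq.
Qed.

Lemma corner_affine1 p : exists h : surf p -> surf p, corner_affine 1%:M h.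
Proof.
exists id; split; first by rewrite intmx1; exact: affine_id.
move=> i; exists 1; first by rewrite ltr01 lexx.
by move=> u h; rewrite intmx1 mul1mx.
Qed.

Lemma shear_corner_affine k p : exists h : surf (shear_pair k p) -> surf p, corner_affine
  (shear_mx k) h.
Proof.
have [h [ah hE]] := shear_affine R p.1 p.2 k; exists h; split=> // i.
(* Coordinates of at most 1/2 add up to at most 1, so u lies in the triangle whose label the shear
   keeps. *)
exists 2^-1; first by lra.
move=> u hu; have u0 := hu 0; have u1 := hu 1.
have uu : unit_square u by move=> l; have := hu l; lra.
have us : u 0 0 + u 1 0 <= 1 by lra.
split; last exact: hE.
by rewrite shear_mxE; exact: shear_unit.
Qed.

Lemma corner_affine_shear A k p q (h : surf p -> surf q) : corner_affine A h ->
  exists g : surf (shear_pair k p) -> surf q, corner_affine (A *m shear_mx k) g.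
Proof.
move=> [ah hE]; have [g [ag gE]] := shear_corner_affine k p; exists (h \o g); split.
  by rewrite intmxM; exact: affine_comp.
move=> i; have [e /andP[e0 e1] he] := hE i; have [e' /andP[e'0 e'1] he'] := gE i.
(* A sheared coordinate is the sum of two coordinates, hence the half. *)
exists (Num.min (e / 2) e').
  by rewrite lt_min divr_gt0 // e'0 /= ge_min e'1 orbT.
move=> u hu.
have hu1 l : 0 <= u l 0 <= e / 2 by have := hu l; rewrite le_min => /and3P[-> ->].
have hu2 l : 0 <= u l 0 <= e' by have := hu l; rewrite le_min => /and3P[-> _ ->].
have [_ E] := he' u hu2; rewrite intmxM -mulmxA /= E.
apply: he => l; rewrite shear_mxE shearE.
by have := hu1 0; have := hu1 1; have := hu1 l; case: ifP => _; lra.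
Qed.

Lemma corner_affine_plus A q : SL2Zplus A -> exists p (h : surf p -> surf q), corner_affine A h.
Proof.
move=> SA; elim/SL2Zplus_ind: A / SA => [|A k _ [p [h hA]]].
  by exists q; exact: corner_affine1.
by exists (shear_pair k p); exact: corner_affine_shear hA.
Qed.

Lemma intmx_col A : map_mx intr (col 0 A) = intmx R A *m unitv R 0.
Proof.
by apply: cV2P => k; rewrite mulmx2E !mxE /=; ring.
Qed.

(** Both directions transport the code: h carries the horizontal code of the source to direction v,
    and the inverse of h brings any code in direction v back to the horizontal, where it is
    unique. *)
Lemma code_iff A (s1 t1 s t w : 'S_n) (h : tiled_space R s1 t1 -> tiled_space R s t) : SL2Z A ->
  affine (intmx R A) h ->
  (forall i, exists2 e, 0 < e <= 1 & forall x : R, 0 <= x <= e ->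
     unit_square (x *: (intmx R A *m unitv R 0)) /\
     h (plot s1 t1 i (x *: unitv R 0)) = plot s t i (x *: (intmx R A *m unitv R 0))) ->
  is_codeL R s t (col 0 A) w <-> w = s1.
Proof.
move=> SA ah lab; have uA := SL2Z_unitmx R SA.
rewrite is_codeLE intmx_col; set v := _ *m unitv R 0; set N := left_normal v.
pose m := invmx (intmx R A) *m N.
have Am : intmx R A *m m = N by rewrite mulKVmx.
(* The pulled-back normal m is no longer orthogonal but still points upwards: by Cramer's rule
   [m 1 0] is the determinant of v and its left normal, the squared length of v. *)
have m1 : 0 < m 1 0.
  pose a := intmx R A; have Av k : v k 0 = a k 0.
    by rewrite /v mulmx2E /a !unitvE /=; ring.
  have e k : N k 0 = a k 0 * m 0 0 + a k 1 * m 1 0 by rewrite -Am mulmx2E.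
  have d : a 0 0 * a 1 1 - a 1 0 * a 0 1 = 1.
    by rewrite /a !mxE -!intrM -intrB -det_mx22 (SA : \det A = 1).
  have N0 : N 0 0 = - a 1 0 by rewrite /N /left_normal mxE /= Av.
  have N1 : N 1 0 = a 0 0 by rewrite /N /left_normal mxE /= Av.
  have -> : m 1 0 = a 0 0 ^+ 2 + a 1 0 ^+ 2.
    rewrite -[LHS]mul1r -d.
    transitivity (a 0 0 * N 1 0 - a 1 0 * N 0 0); first by rewrite !e; ring.
    by rewrite N0 N1; ring.
  have [a0|a0] := eqVneq (a 0 0) 0.
    rewrite a0 expr0n add0r exprn_even_gt0 //; apply/eqP => a1.
    by move/eqP: d; rewrite a0 a1 !mul0r subrr eq_sym oner_eq0.
  by rewrite ltr_pwDl ?exprn_even_gt0 // sqr_ge0.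
have lab' i : exists2 e, 0 < e & forall x : R, 0 <= x <= e -> [/\ unit_square (x *: unitv R 0),
     unit_square (x *: v) & h (plot s1 t1 i (x *: unitv R 0)) = plot s t i (x *: v)].
  have [e /andP[e0 e1] he] := lab i; exists e => // x hx; have [h1 h2] := he x hx.
  by split=> //; apply: scale_e0_unit; case/andP: hx => -> h3; exact: le_trans e1.
split=> [cw|->]; last first.
  by rewrite -Am; apply: (code_transport ah lab'); exact: horizontal_code.
have [g [ag hg gh]] := affine_inverse uA ah.
have vE : invmx (intmx R A) *m v = unitv R 0 by rewrite mulKmx.
apply: (@horizontal_code_unique R n s1 t1 m m1).
have := @code_transport R n s t s1 t1 _ g ag v N w _ cw; rewrite vE; apply.
move=> i; have [e e0 he] := lab' i; exists e => // x hx; have [h1 h2 h3] := he x hx.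
by split; rewrite ?vE // -h3 hg.
Qed.

(** The second column is the first column of [A *m rot_mx], so its code is the horizontal
    permutation of the surface turned by a quarter. *)
Lemma code_plus A p q (h : surf p -> surf q) w : SL2Zplus A -> corner_affine A h ->
  is_codeL_mx R q.1 q.2 A w <-> w = (p.1, (p.2 ^ p.1)%g).
Proof.
move=> [SA A0] [ah hE].
have c1 : is_codeL R q.1 q.2 (col 0 A) w.1 <-> w.1 = p.1.
  apply: (@code_iff A p.1 p.2 q.1 q.2 w.1 h) => // i; have [e /andP[e0 e1] he] := hE i.
  exists e; first by rewrite e0.
  move=> x /andP[x0 xe]; have [k|h1 h2] := he (x *: unitv R 0).
    have [f0 f1] := scale_e0E x; case: (ord2P k) => ->; rewrite ?f0 ?f1.
      by rewrite x0.
    by rewrite lexx ltW.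
  by rewrite -scalemxAr in h1 h2.
have [r [ar rE]] := rotation_affine R p.1 p.2.
have Sr : SL2Z rot_mx by rewrite /SL2Z /= det_mx22 !mxE.
have c2 : is_codeL R q.1 q.2 (col 1 A) w.2 <-> w.2 = (p.2 ^ p.1)%g.
  have -> : col 1 A = col 0 (A *m rot_mx).
    apply/matrixP => i j; rewrite !mxE !big_ord_recl big_ord0 addr0 lift01 !mxE /=; ring.
  apply: (@code_iff (A *m rot_mx) _ _ q.1 q.2 w.2 (h \o r)); first exact: SL2ZM.
    by rewrite intmxM; exact: affine_comp.
  move=> i; have [e /andP[e0 e1] he] := hE i; exists e; first by rewrite e0.
  move=> x /andP[x0 xe]; rewrite intmxM -mulmxA.
  have E1 : intmx R rot_mx *m unitv R 0 = unitv R 1.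
    by apply: cV2P => k; rewrite mulmx2E !mxE; case: (ord2P k) => -> /=; ring.
  have [k|h1 h2] := he (x *: unitv R 1).
    rewrite !mxE; case: (ord2P k) => -> /=; rewrite ?mulr0 ?mulr1.
      by rewrite lexx ltW.
    by rewrite x0.
  rewrite E1; rewrite -scalemxAr in h1 h2; split=> //=.
  rewrite rE -?scalemxAr ?E1; last first.
    by apply: scale_e0_unit; rewrite x0 (le_trans xe).
  (* The turned bottom side is the right side of the left neighbour of Q_i; the gluing reads it as
     the left side of Q_i. *)
  rewrite (@plot_glue _ _ _ _ 0); last by rewrite !mxE /=; ring.
  by rewrite addrK /dir_perm /= permKV.
rewrite /is_codeL_mx c1 c2; split=> [[<- <-]|->] //.
exact: surjective_pairing.
Qed.

(** Conjugation by [p.1] fixes [p.1]. *)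
Lemma affine_iso_code p : affine_iso 1%:M p (p.1, (p.2 ^ p.1)%g).
Proof. by apply/affine_iso_conj; exists p.1;
  have -> : (p.1 ^ p.1)%g = p.1 by rewrite conjgE mulKg. Qed.

(** * Orbits *)

Lemma shear_pair_inj k : injective (@shear_pair n k).
Proof.
move=> [s t] [s' t']; rewrite /shear_pair /shear_perm /dir_perm /=.
by case: (ord2P k) => -> /= -[]; [move=> -> /mulgI ->|move=> e1 e2; move: e1;
  rewrite e2 => /mulgI ->].
Qed.

Variable (x : 'S_n * 'S_n).

Definition plus_orbit p := exists A (h : surf p -> surf x), SL2Zplus A /\ corner_affine A h.

Lemma SL2Zplus_shear A k : SL2Zplus A -> SL2Zplus (A *m shear_mx k).
Proof.
move=> [SA A0]; split; first exact: SL2ZM SA (det_shear k).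
by move=> i j; rewrite mulmx_shear; case: ifP => // _; rewrite addr_ge0.
Qed.

Lemma plus_orbit_shear k p : plus_orbit p -> plus_orbit (shear_pair k p).
Proof.
move=> [A [h [SA hA]]]; have [g gA] := corner_affine_shear k hA.
by exists (A *m shear_mx k), g; split=> //; exact: SL2Zplus_shear.
Qed.

(* A forward-invariant subset of a finite set is invariant under a permutation and its inverse. *)
Lemma plus_orbit_shearV k p : plus_orbit p -> plus_orbit (finv (shear_pair k) p).
Proof.
move=> px; rewrite /finv; elim: _.-1 => //= N; exact: plus_orbit_shear.
Qed.

(** Generators are multiplied on the right of B, that is, at the source p, so each step moves p by
    [shear_pair] or its inverse, and the plus orbit is stable under both. *)
Lemma SL2Z_orbit_plus B : SL2Z B -> exists p, plus_orbit p /\ affine_iso B p x.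
Proof.
move=> SB; elim/SL2Z_ind: B / SB => [|A k SA [p [px ap]]|A k SA [p [px ap]]].
- exists x; split; last exact: affine_iso1.
  have [h h1] := corner_affine1 x; exists 1%:M, h; split=> //; split; first exact: SL2Z1.
  by move=> i j; rewrite !mxE; case: (i == j).
- exists (shear_pair k p); split; first exact: plus_orbit_shear.
  by apply: (affine_isoM ap); have [h [ah _]] := shear_corner_affine k p; exists h.
- set p' := finv (shear_pair k) p.
  have e : shear_pair k p' = p by exact: f_finv (@shear_pair_inj k) p.
  exists p'; split; first exact: plus_orbit_shearV.
  have -> : shearV_mx k = invmx (shear_mx k).
    have := mulmx_shearK 1%:M k; rewrite mul1mx => E.
    by rewrite -[LHS](mulKmx (SL2Z_unit (det_shear k))) E mulmx1.
  apply: (affine_isoM ap); apply: affine_isoV; first exact: det_shear.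
  by rewrite -{1}e; have [h [ah _]] := shear_corner_affine k p'; exists h.
Qed.

Lemma orbit_SL2ZP (K : set ('S_n * 'S_n)) : orbit_SL2Z R x.1 x.2 K <->
  exists A w, [/\ SL2Z A, affine_iso A x w & K = Defs.equiv_class w].
Proof.
split=> [[w [A SA /(translation_isoP R x.1 x.2 w.1 w.2 SA) h] <-]|[A [w [SA [h ah] ->]]]].
  by exists A, w.
by exists w => //; exists A => //; apply/translation_isoP => //; exists h.
Qed.

Lemma orbit_SL2Z_plus : orbit_SL2Z R x.1 x.2 = orbit_plus R x.1 x.2.
Proof.
rewrite eqEsubset; split=> K.
  move=> /orbit_SL2ZP [A [w [SA aw ->]]].
  (* The inverse of A, because the plus orbit is made of maps into x while the orbit is made of maps
     out of x. *)
  have [p [[B [h [SB hB]]] ap]] := SL2Z_orbit_plus (SL2ZV SA).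
  have pw : affine_iso 1%:M p w by rewrite -(mulmxV (SL2Z_unit SA)); exact: affine_isoM aw ap.
  exists (p.1, (p.2 ^ p.1)%g); first by exists B => //; apply/(code_plus _ SB hB).
  by rewrite -(equiv_class_eq pw) (equiv_class_eq (affine_iso_code p)).
move=> [w [A SA cw] <-]; apply/orbit_SL2ZP.
have [p [h hA]] := corner_affine_plus x SA.
have wE := (code_plus w SA hA).1 cw; have SA' := SA.1.
exists (invmx A), p; split; first exact: SL2ZV.
  by apply: affine_isoV => //; exists h; case: hA.
by rewrite wE (equiv_class_eq (affine_iso_code p)).
Qed.

Lemma Veech_affine_iso A : Veech (square_tiled R x.1 x.2) A <-> SL2Z A /\ affine_iso A x x.
Proof. exact: VeechP. Qed.

Notation V := (Veech (square_tiled R x.1 x.2)).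

(** Sends the coset of A to the class of A X; all matrices of K are used, so no representative has
    to be chosen. *)
Definition coset_class (K : set 'M[int]_2) : set ('S_n * 'S_n) :=
  [set w | exists B, [/\ K B, SL2Z B & affine_iso B x w]].

Lemma coset_classE A w : SL2Z A -> affine_iso A x w ->
  coset_class [set A *m B | B in V] = Defs.equiv_class w.
Proof.
move=> SA aw; rewrite eqEsubset; split=> u.
  move=> [_ [[B /Veech_affine_iso [SB aB] <-] _ au]]; apply/equiv_class_affine_iso.
  have wx := affine_isoV SA aw; have := affine_isoM au (affine_isoM (affine_isoV SB aB) wx).
  by rewrite mulmxA mulmxK ?SL2Z_unit // mulmxV ?SL2Z_unit.
move=> /equiv_class_affine_iso wu; exists A; split=> //.
  exists 1%:M; last by rewrite mulmx1.
  by apply/Veech_affine_iso; split; [exact: SL2Z1|exact: affine_iso1].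
by rewrite -[A]mul1mx; exact: affine_isoM wu aw.
Qed.

Lemma affine_iso_exists A : SL2Z A -> exists w, affine_iso A x w.
Proof.
move=> SA; have [p [_ /(affine_isoV (SL2ZV SA))]] := SL2Z_orbit_plus (SL2ZV SA).
by rewrite invmxK; exists p.
Qed.

Lemma card_lcosets : (SL2Z_lcosets V #= orbit_SL2Z R x.1 x.2)%card.
Proof.
apply/card_set_bijP; exists coset_class; split.
- move=> _ [A SA <-]; have [w aw] := affine_iso_exists SA; apply/orbit_SL2ZP.
  by exists A, w; split=> //; exact: coset_classE.
- move=> K L /set_mem [A SA <-] /set_mem [B SB <-].
  have [w aw] := affine_iso_exists SA; have [u au] := affine_iso_exists SB.
  rewrite (coset_classE SA aw) (coset_classE SB au) => E.
  have wu : affine_iso 1%:M w u by apply/equiv_class_affine_iso; rewrite E;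
    apply/equiv_class_affine_iso; exact: affine_iso1.
  have sub A' B' w' u' : SL2Z A' -> SL2Z B' -> affine_iso A' x w' -> affine_iso B' x u' ->
    affine_iso 1%:M w' u' ->
      [set A' *m C | C in V] `<=` [set B' *m C | C in V].
    move=> SA' SB' aw' au' wu' _ [C /Veech_affine_iso [SC aC] <-].
    exists (invmx B' *m (A' *m C)); last by rewrite mulKVmx // SL2Z_unit.
    apply/Veech_affine_iso; split; first by apply: SL2ZM (SL2ZV SB') (SL2ZM SA' SC).
    apply: affine_isoM (affine_isoV SB' au') _; rewrite -[A' *m C]mul1mx.
    exact: affine_isoM wu' (affine_isoM aw' aC).
  rewrite eqEsubset; split; first exact: sub aw au wu.
  by apply: sub au aw _ => //; have := affine_isoV SL2Z1 wu; rewrite invmx1.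
- move=> K /orbit_SL2ZP [A [w [SA aw ->]]].
  by exists [set A *m B | B in V]; [exists A|exact: coset_classE].
Qed.

End Main.

Theorem theorem6p2p1 (R : realType) (n : nat) (s t : 'S_n) :
  orbit_SL2Z R s t = orbit_plus R s t /\
  (SL2Z_lcosets (Veech (square_tiled R s t)) #= orbit_plus R s t)%card.
Proof.
have e : orbit_SL2Z R s t = orbit_plus R s t := orbit_SL2Z_plus R (s, t).
by split=> //; rewrite -e; exact: (card_lcosets R (s, t)).
Qed.
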